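(* Suppose $X, X^n \in L^2(\Omega,\mathcal{F},P)$ for every $n\in\mathbb{N}$, with $X^n$ being $\mathcal{F}^n$-measurable. Then the following assertions are equivalent as $n$ tends to infinity: (i) $X^n \to X$ strongly (resp. weakly) in $L^2(\Omega,\mathcal{F},P)$. (ii) $(S^nX^n)(\check g^n)\to (SX)(g)$ for every $g\in\mathcal{E}$, and additionally $\mathbb{E}[(X^n)^2]\to\mathbb{E}[X^2]$ in the case of strong convergence (resp. $\sup_{n\in\mathbb{N}}\mathbb{E}[(X^n)^2]<\infty$ in the case of weak convergence). Moreover, in the case of strong convergence, (i) is also equivalent to (iii) $(X^n,\exp^{\diamond_n}(I^n(\check g^n)))\to (X,\exp^{\diamond}(I(g)))$ in distribution (as pairs) for every $g\in\mathcal{E}$, and $((X^n)^2)_{n\in\mathbb{N}}$ is uniformly integrable.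
   Context: Setting: $(\Omega,\mathcal{F},P)$ is a probability space carrying a Brownian motion $B=(B_t)_{t\ge 0}$, where $\mathcal{F}$ is the $\sigma$-field generated by $B$, completed by null sets. $\xi$ is a square-integrable random variable with zero expectation and variance one. For each $n\in\mathbb{N}=\{1,2,\dots\}$, $(\xi^n_i)_{i\in\mathbb{N}}$ is a sequence of independent random variables on $(\Omega,\mathcal{F},P)$ with the same distribution as $\xi$, and $B^n_t=\frac{1}{\sqrt n}\sum_{i=1}^{\lfloor nt\rfloor}\xi^n_i$. Standing assumption: for every $t\ge 0$, $B^n_t\to B_t$ in probability as $n\to\infty$. $\mathcal{F}^n=\sigma(\xi^n_i, i\in\mathbb{N})$. Wiener integral: $I(f)$ for $f\in L^2([0,\infty))$ is the continuous linear extension of $\mathbf{1}_{(0,t]}\mapsto B_t$ to a map $L^2([0,\infty))\to L^2(\Omega,\mathcal{F},P)$. $L^2_n(\mathbb{N})$ is the space of $f^n:\mathbb{N}\to\mathbb{R}$ with $\|f^n\|^2_{L^2_n(\mathbb{N})}=\frac1n\sum_{i\ge1}f^n(i)^2<\infty$; for such $f^n$, $I^n(f^n)=\frac{1}{\sqrt n}\sum_{i\ge 1}f^n(i)\xi^n_i$. Wick exponentials: $\exp^{\diamond}(I(f))=\exp\left(I(f)-\frac12\int_0^\infty f(s)^2ds\right)$ and $\exp^{\diamond_n}(I^n(f^n))=\prod_{i=1}^\infty\left(1+\frac{1}{\sqrt n}f^n(i)\xi^n_i\right)$. $S$-transforms: $(SX)(f)=\mathbb{E}[X\exp^{\diamond}(I(f))]$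 for $X\in L^2(\Omega,\mathcal{F},P)$, $f\in L^2([0,\infty))$; $(S^nX^n)(f^n)=\mathbb{E}[X^n\exp^{\diamond_n}(I^n(f^n))]$ for $X^n\in L^2(\Omega,\mathcal{F}^n,P)$, $f^n\in L^2_n(\mathbb{N})$. $\mathcal{E}$ is the set of step functions $g(x)=\sum_{j=1}^m a_j\mathbf{1}_{(b_j,c_j]}(x)$, $m\in\mathbb{N}$, $a_j,b_j,c_j\in\mathbb{R}$ (regarded as functions on $[0,\infty)$), and $\check g^n=(g(1/n),g(2/n),\dots)$, i.e. $\check g^n(i)=g(i/n)$. *)

(* Defs.v *)
From HB Require Import structures.
From mathcomp Require Import all_boot all_order all_algebra.
From mathcomp Require Import all_classical all_reals all_analysis.

Set Implicit Arguments.
Unset Strict Implicit.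
Unset Printing Implicit Defensive.
Import Order.TTheory GRing.Theory Num.Theory.
Import numFieldNormedType.Exports.

Local Open Scope classical_set_scope.
Local Open Scope ring_scope.

Section Probability.
Context {R : realType} {d : measure_display} {T : measurableType d}.
Variable P : probability T R.

Definition mutually_independent (I : eqType) (D : set I) (Y : I -> T -> R) :=
  forall (s : seq I) (A : I -> set R), uniq s ->
    (forall i, i \in s -> D i /\ measurable (A i)) ->
    P (\bigcap_(i in [set` s]) (Y i @^-1` A i))
      = (\prod_(i <- s) P (Y i @^-1` A i))%E.

Definition sigma_of (I : Type) (D : set I) (Y : I -> T -> R) : set (set T) :=
  <<s \bigcup_(i in D) preimage_set_system setT (Y i) measurable >>.

Definition measurable_wrt (G : set (set T)) (X : T -> R) :=
  forall U : set R, measurable U -> G (X @^-1` U).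

(* Completion of the sub-sigma-algebra G: the null sets added to G are the
   subsets of the P-null members of G. *)
Definition null_completion (G : set (set T)) : set (set T) :=
  [set A | exists C N, [/\ G C, G N, P N = 0%E &
                           (A `\` C) `|` (C `\` A) `<=` N]].

Definition same_law (X Y : T -> R) :=
  forall U : set R, measurable U -> P (X @^-1` U) = P (Y @^-1` U).

Definition cvg_in_probability (Y : nat -> T -> R) (Z : T -> R) :=
  forall e : R, 0 < e ->
    P [set w | e <= `|Y n w - Z w|] @[n --> \oo] --> 0%E.

Definition cvg_in_distribution (V : topologicalType)
    (Y : nat -> T -> V) (Z : T -> V) :=
  forall phi : V -> R, continuous phi ->
    (exists M : R, forall v, `|phi v| <= M) ->
    ('E_P[phi \o Y n])%E @[n --> \oo] --> ('E_P[phi \o Z])%E.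

Definition uniformly_integrable (I : Type) (D : set I) (Y : I -> T -> R) :=
  ereal_sup [set (\int[P]_(w in [set w | (K < `|Y i w|)%R]) (`|Y i w|%R)%:E)%E
            | i in D] @[K --> +oo%R] --> 0%E.

Definition cvg_L2_strong (Y : nat -> T -> R) (Z : T -> R) :=
  ('N[P]_2%:E[EFin \o (Y n \- Z)%R])%E @[n --> \oo] --> 0%E.

Definition cvg_L2_weak (Y : nat -> T -> R) (Z : T -> R) :=
  forall V : T -> R, V \in Lfun P 2%:E ->
    ('E_P[Y n \* V])%E @[n --> \oo] --> ('E_P[Z \* V])%E.

(* Only the values B t with 0 <= t matter. In normal_prob the second
   parameter is the standard deviation. *)
Definition brownian_motion (B : R -> T -> R) :=
  [/\ {ae P, forall w, B 0 w = 0},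
      forall t : nat -> R, 0 <= t 0%N ->
        {homo t : i j / (i <= j)%N >-> i <= j} ->
        mutually_independent setT (fun i => B (t i.+1) \- B (t i)),
      forall s t : R, 0 <= s -> s < t ->
        forall U : set R, measurable U ->
          P ((B t \- B s) @^-1` U) = normal_prob 0 (Num.sqrt (t - s)) U &
      {ae P, forall w, {within `[0, +oo[, continuous (fun t => B t w)}}].

End Probability.

Section WickExponentials.
Context {R : realType} {d : measure_display} {T : measurableType d}.
Variable P : probability T R.

(* Functions on [0, +oo) are total functions on R of which only the
   restriction to [0, +oo) is used. *)
Definition L2_halfline (f : R -> R) :=
  measurable_fun (`[0, +oo[ : set R) f /\
  (\int[lebesgue_measure]_(x in `[0%R, +oo[) (f x ^+ 2)%:E < +oo)%E.

(* A list s of pairs (a, t) encodes the linear combination of the functions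
   1_(0,t] with coefficients a; span_integral B s is its image under the linear
   extension of 1_(0,t] |-> B t. *)
Definition span_indic (s : seq (R * R)) (x : R) : R :=
  \sum_(p <- s) p.1 * \1_(`]0, p.2]) x.

Definition span_integral (B : R -> T -> R) (s : seq (R * R)) (w : T) : R :=
  \sum_(p <- s) p.1 * B p.2 w.

(* Y is a version of the value at f of the continuous linear extension of
   1_(0,t] |-> B t to L^2([0, +oo)). *)
Definition is_wiener_integral (B : R -> T -> R) (f : R -> R) (Y : T -> R) :=
  [/\ L2_halfline f, Y \in Lfun P 2%:E &
   exists s : nat -> seq (R * R),
    [/\ forall k p, p \in s k -> 0 <= p.2,
        (\int[lebesgue_measure]_(x in `[0%R, +oo[)
           ((span_indic (s k) x - f x) ^+ 2)%:E)%E @[k --> \oo] --> 0%E &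
        cvg_L2_strong P (fun k => span_integral B (s k)) Y]].

(* The integral is determined up to a P-null set; a version is chosen. *)
Definition wiener_integral (B : R -> T -> R) (f : R -> R) : T -> R :=
  xget (cst 0) [set Y | is_wiener_integral B f Y].

Definition wick_exp (B : R -> T -> R) (f : R -> R) (w : T) : R :=
  expR (wiener_integral B f w
        - 2^-1 * \int[lebesgue_measure]_(x in `[0, +oo[) f x ^+ 2).

Definition S_transform (B : R -> T -> R) (X : T -> R) (f : R -> R) : \bar R :=
  ('E_P[X \* wick_exp B f])%E.

(* xi is the row (xi^n_i)_i at level n; only the indices i >= 1 are used. The
   infinite product is the pointwise limit of the partial products; it is a
   finite product when f vanishes from some index on. *)
Definition discrete_wick_exp (n : nat) (xi : nat -> T -> R) (f : nat -> R)
    (w : T) : R :=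
  limn (fun N => \prod_(1 <= i < N.+1)
                   (1 + (Num.sqrt n%:R)^-1 * f i * xi i w)).

Definition discrete_S_transform (n : nat) (xi : nat -> T -> R)
    (X : T -> R) (f : nat -> R) : \bar R :=
  ('E_P[X \* discrete_wick_exp n xi f])%E.

Definition scaled_walk (n : nat) (xi : nat -> T -> R) (t : R) (w : T) : R :=
  (Num.sqrt n%:R)^-1 * \sum_(1 <= i < (Num.truncn (n%:R * t)).+1) xi i w.

End WickExponentials.

Definition step_functions {R : realType} : set (R -> R) :=
  [set g | exists m : nat, (0 < m)%N /\ exists a b c : 'I_m -> R,
    g = fun x => \sum_(j < m) a j * \1_(`]b j, c j]) x].

Definition grid {R : realType} (g : R -> R) (n : nat) : nat -> R :=
  fun i => g (i%:R / n%:R).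

(* Main.v *)
Require Import Defs.
From HB Require Import structures.
From mathcomp Require Import all_boot all_order all_algebra.
From mathcomp Require Import all_classical all_reals all_analysis.
From mathcomp Require Import measurable_realfun ring lra.

Set Implicit Arguments.
Unset Strict Implicit.
Unset Printing Implicit Defensive.
Import Order.TTheory GRing.Theory Num.Theory.
Import numFieldNormedType.Exports.

Local Open Scope classical_set_scope.
Local Open Scope ring_scope.

(** The theorem compares two S-transforms, that is, pairings with two families
    of test functions: the discrete Wick exponentials Y^n(g) and the Wick
    exponentials Y(g) of step functions g. Two facts carry it.

    First, Y^n(g) tends to Y(g) in mean square (wick_prod_cvg_L2). A step
    function is, on positive arguments, a combination of indicators of intervals
    ]0, t], so its Wiener integral is the same combination Z of values of B, and
    Y^n(g) is a finite product of factors 1 + x_i. Its logarithm is the sum of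
    the x_i minus half the sum of their squares, up to a small error
    (cvg_wick_product). The first sum is the combination of values of the random
    walk that tends to Z in probability, and the second tends to the integral of
    g^2 by a law of large numbers with truncation (low_dev_cvg0, high_sum_cvg0).
    This gives almost sure convergence along subsequences. Independence bounds
    the second moment of Y^n(g) by the exponential of a Riemann sum of g^2, and
    shows that the products of positive parts have mean at least 1; in the limit
    the mean of Y(2g) is at least 1, which is a lower bound for the second moment
    of Y(g). So no mass is lost, and almost sure convergence improves to mean
    square convergence. The same bounds on moments of Y(g) control the second
    moment of Z, which makes the Wiener integral of g unique, equal to Z.

    Second, the exponentials e^Z are total (exponentials_total): a linear space of
    square-integrable functions that contains them and is closed under dominated
    limits contains everything. The functions F such that multiplication by F
    preserves the space, even after multiplication by any exponential, form an
    algebra. From e^Z one obtains in turn, by limits dominated by exponentials, Z,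
    the sine of Z, the sign of Z - c and the indicator of {B_t > c}, hence all
    events generated by B, and all events since these are the generated ones up
    to null sets.

    The rest is Hilbert space theory. If X^n is bounded in L2, replacing Y^n(g) by
    Y(g) changes the pairing with X^n by a null sequence. Hence convergence of the
    S-transforms is convergence of the pairings with the Y(g), which by totality
    is weak convergence; conversely weakly convergent sequences are bounded by a
    gliding hump (L2_uniform_boundedness). Strong convergence is weak convergence
    together with convergence of the norms. Strong convergence of both components
    gives convergence in distribution of the pairs and uniform integrability of
    the squares; conversely, these give convergence of the means of x y and x^2
    (cvg_Ex_small_tails), that is, of the S-transforms and the norms. *)

(** * Real-valued expectations *)

Section Expectation.
Context {R : realType} {d : measure_display} {T : measurableType d}.
Variable P : probability T R.

Definition Int (f : T -> R) := P.-integrable setT (EFin \o f).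
Definition Ex (f : T -> R) : R := \int[P]_w f w.
Definition mea (f : T -> R) := measurable_fun setT f.

Lemma Int_mea f : Int f -> mea f.
Proof. by move=> /measurable_int /measurable_EFinP. Qed.

Lemma EFin_Ex f : Int f -> (\int[P]_w (f w)%:E)%E = (Ex f)%:E.
Proof.
move=> If; rewrite /Ex /Rintegral fineK//.
exact: (integrable_fin_num measurableT If).
Qed.

Lemma expectation_Ex f : Int f -> ('E_P[f] = (Ex f)%:E)%E.
Proof. by move=> If; rewrite unlock EFin_Ex. Qed.

Lemma Int_le f g : mea f -> (forall w, `|f w| <= g w) -> Int g -> Int f.
Proof.
move=> mf fg Ig; apply: (le_integrable measurableT _ _ Ig).
  exact/measurable_EFinP.
by move=> w _ /=; rewrite lee_fin (le_trans (fg w))// ler_norm.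
Qed.

Lemma Int_cst c : Int (fun=> c).
Proof. exact: finite_measure_integrable_cst. Qed.

Lemma IntD f g : Int f -> Int g -> Int (fun w => f w + g w).
Proof. by move=> If Ig; apply: (integrableD measurableT If Ig). Qed.

Lemma IntB f g : Int f -> Int g -> Int (fun w => f w - g w).
Proof. by move=> If Ig; apply: (integrableB measurableT If Ig). Qed.

Lemma IntZ c f : Int f -> Int (fun w => c * f w).
Proof. by move=> If; apply: (integrableZl measurableT c If). Qed.

Lemma Int_norm f : Int f -> Int (fun w => `|f w|).
Proof. by move=> If; apply: (integrable_abse If). Qed.

Lemma Int_sum (I : eqType) (r : seq I) (F : I -> T -> R) :
  (forall i, i \in r -> Int (F i)) -> Int (fun w => \sum_(i <- r) F i w).
Proof.
elim: r => [_|i r IH h].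
  by under [X in Int X]eq_fun do rewrite big_nil; exact: Int_cst.
under [X in Int X]eq_fun do rewrite big_cons.
by apply: IntD; [apply: h; rewrite mem_head|apply: IH => j jr; apply: h; rewrite inE jr orbT].
Qed.

Lemma eq_Ex f g : f =1 g -> Ex f = Ex g.
Proof. by move=> /funext ->. Qed.

Lemma Ex_cst c : Ex (fun=> c) = c.
Proof.
rewrite /Ex [LHS]Rintegral_cst//; have := probability_setT P.
by move=> /= -> /=; rewrite mulr1.
Qed.

Lemma ExD f g : Int f -> Int g -> Ex (fun w => f w + g w) = Ex f + Ex g.
Proof. by move=> If Ig; rewrite /Ex RintegralD. Qed.

Lemma ExB f g : Int f -> Int g -> Ex (fun w => f w - g w) = Ex f - Ex g.
Proof. by move=> If Ig; rewrite /Ex RintegralB. Qed.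

Lemma ExZ c f : Int f -> Ex (fun w => c * f w) = c * Ex f.
Proof. by move=> If; rewrite /Ex RintegralZl. Qed.

Lemma Ex_sum (I : eqType) (r : seq I) (F : I -> T -> R) :
  (forall i, i \in r -> Int (F i)) ->
  Ex (fun w => \sum_(i <- r) F i w) = \sum_(i <- r) Ex (F i).
Proof.
elim: r => [_|i r IH h].
  by rewrite big_nil; under [X in Ex X]eq_fun do rewrite big_nil; exact: Ex_cst.
have hr j : j \in r -> Int (F j) by move=> jr; apply: h; rewrite inE jr orbT.
rewrite big_cons -IH// -ExD//; last exact: Int_sum.
  by under [X in Ex X = _]eq_fun do rewrite big_cons.
by apply: h; rewrite mem_head.
Qed.

Lemma Ex_ge0 f : (forall w, 0 <= f w) -> 0 <= Ex f.
Proof. by move=> f0; apply: Rintegral_ge0. Qed.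

Lemma Ex_le f g : Int f -> Int g -> (forall w, f w <= g w) -> Ex f <= Ex g.
Proof. by move=> If Ig fg; apply: le_Rintegral. Qed.

Lemma Ex_norm f : Int f -> `|Ex f| <= Ex (fun w => `|f w|).
Proof. by move=> If; apply: le_normr_Rintegral. Qed.

Lemma ae_eq_Ex f g : mea f -> mea g -> {ae P, forall w, f w = g w} -> Ex f = Ex g.
Proof.
move=> mf mg fg; rewrite /Ex /Rintegral; congr fine.
apply: ae_eq_integral => //; try exact/measurable_EFinP.
by apply: filterS fg => w /= ->.
Qed.

Lemma ae_eq_Int f g : mea f -> mea g -> {ae P, forall w, f w = g w} -> Int f -> Int g.
Proof.
move=> mf mg fg /integrableP[_ fi]; apply/integrableP; split; first exact/measurable_EFinP.
rewrite (le_lt_trans _ fi)// le_eqVlt; apply/orP; left; apply/eqP.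
apply: ae_eq_integral => //.
- by apply: measurableT_comp => //; exact/measurable_EFinP.
- by apply: measurableT_comp => //; exact/measurable_EFinP.
by apply: filterS fg => w /= ->.
Qed.

(** Integrability and the bound come together, so that a limit whose
    integrability is not known beforehand can be handled with real numbers. *)
Lemma Int_ge0_bounded f c : mea f -> (forall w, 0 <= f w) ->
  (\int[P]_w (f w)%:E <= c%:E)%E -> Int f /\ Ex f <= c.
Proof.
move=> mf f0 fc.
have If : Int f.
  apply/integrableP; split; first exact/measurable_EFinP.
  under eq_integral do rewrite /= ger0_norm//.
  by rewrite (le_lt_trans fc)// ltry.
by split=> //; rewrite -lee_fin -EFin_Ex.
Qed.

Lemma DCT (f_ : nat -> T -> R) f g :
  (forall n, mea (f_ n)) -> mea f -> Int g -> (forall n w, `|f_ n w| <= g w) ->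
  {ae P, forall w, f_ n w @[n --> \oo] --> f w} ->
  Int f /\ Ex (f_ n) @[n --> \oo] --> Ex f.
Proof.
move=> mf_ mf Ig fg fcv.
have [If _ cv] := @dominated_convergence _ _ _ P setT measurableT
  (fun n => EFin \o f_ n) (EFin \o f) (EFin \o g)
  (fun n => (measurable_EFinP _ _).2 (mf_ n)) ((measurable_EFinP _ _).2 mf)
  ltac:(by apply: filterS fcv => w h _; apply: cvg_EFin; [exact: nearW|exact: h]) Ig
  ltac:(by apply: aeW => w n _ /=; rewrite lee_fin; exact: fg).
split=> //.
have Ifn n : Int (f_ n) by exact: Int_le (Ig).
have E g0 : Int g0 -> (\int[P]_(x in setT) (EFin \o g0) x)%E = (Ex g0)%:E := @EFin_Ex g0.
move: cv; rewrite (E _ If).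
rewrite (_ : [sequence _]_n = (fun n => (Ex (f_ n))%:E)); last first.
  by apply/funext => n /=; rewrite (E _ (Ifn n)).
by move/fine_cvg.
Qed.

(** Fatou's lemma in the form in which it produces integrability of an almost
    sure limit. *)
Lemma Fatou (f_ : nat -> T -> R) f c :
  (forall n, Int (f_ n)) -> mea f -> (forall n w, 0 <= f_ n w) ->
  (forall w, 0 <= f w) ->
  {ae P, forall w, f_ n w @[n --> \oo] --> f w} ->
  (forall n, Ex (f_ n) <= c) -> Int f /\ Ex f <= c.
Proof.
move=> If_ mf f_0 f0 fcv fc.
apply: Int_ge0_bounded => //.
have := @fatou _ _ _ P setT measurableT (fun n => EFin \o f_ n)
  (fun n => (measurable_EFinP _ _).2 (Int_mea (If_ n)))
  (fun n w _ => f_0 n w).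
rewrite (_ : (\int[P]_x limn_einf _)%E = (\int[P]_w (f w)%:E)%E); last first.
  apply: ae_eq_integral => //.
  - apply: (emeasurable_fun_cvg (fun n x => einfs ((fun n => EFin \o f_ n) ^~ x) n)).
      by apply: measurable_fun_einfs => n; exact/measurable_EFinP/Int_mea.
    by move=> w _; rewrite limn_einf_lim; exact: is_cvg_einfs.
  - exact/measurable_EFinP.
  apply: filterS fcv => w h _.
  have hE : (EFin \o f_ n) w @[n --> \oo] --> (f w)%:E.
    by apply: cvg_EFin; [exact: nearW|exact: h].
  by rewrite is_cvg_limn_einfE; [exact/cvg_lim|apply/cvg_ex; eexists; exact: hE].
move=> /le_trans; apply.
have hle n : ((\int[P]_x (EFin \o f_ n) x) <= c%:E)%E by rewrite EFin_Ex// lee_fin.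
rewrite limn_einf_lim; apply: lime_le.
  exact: is_cvg_einfs.
apply: nearW => n; apply: le_trans (hle n).
by apply: ereal_inf_lbound; exists n => //=.
Qed.

End Expectation.

(** * Subsequences and almost sure convergence *)

Section Subsequences.
Context {R : realType}.

Lemma cvg_extracted (V : topologicalType) (u : nat -> V) (l : V) (h : nat -> nat) :
  (forall n, (n <= h n)%N) -> u n @[n --> \oo] --> l ->
  u (h n) @[n --> \oo] --> l.
Proof.
move=> hn ul; apply: (cvg_comp h u _ ul).
move=> A [N _ NA]; exists N => // n /= Nn; apply: NA => /=.
exact: leq_trans Nn (hn n).
Qed.

Lemma cvg_eq_near (V : topologicalType) (u v : nat -> V) (l : V) :
  (\forall n \near \oo, u n = v n) -> v n @[n --> \oo] --> l -> u n @[n --> \oo] --> l.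
Proof. by move=> h; apply: cvg_trans; apply: near_eq_cvg; apply: filterS h. Qed.

Lemma cvg_eq_pos (V : topologicalType) (u v : nat -> V) (l : V) :
  (forall n, (0 < n)%N -> u n = v n) -> v n @[n --> \oo] --> l -> u n @[n --> \oo] --> l.
Proof. by move=> h; apply: cvg_eq_near; exists 1%N. Qed.

Lemma cvg_sum_seq (I : eqType) (r : seq I) (u : nat -> I -> R) (l : I -> R) :
  (forall i, i \in r -> u n i @[n --> \oo] --> l i) ->
  \sum_(i <- r) u n i @[n --> \oo] --> \sum_(i <- r) l i.
Proof.
elim: r => [_|i r IH h].
  by rewrite big_nil; under eq_cvg do rewrite big_nil; exact: cvg_cst.
rewrite big_cons; under eq_cvg do rewrite big_cons.
apply: cvgD; first by apply: h; rewrite mem_head.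
by apply: IH => j jr; apply: h; rewrite inE jr orbT.
Qed.

(** Convergences in mean and in probability are used only through this
    principle: inside an arbitrary extraction h one passes to a further
    extraction along which the convergence is almost sure. An extraction is
    encoded as any h with n <= h n, which is what choosing one index beyond
    each n produces. *)
Lemma cvg_of_extractions (u : nat -> R) (l : R) :
  (forall h, (forall n, (n <= h n)%N) ->
    exists k, (forall n, (n <= k n)%N) /\ u (h (k n)) @[n --> \oo] --> l) ->
  u n @[n --> \oo] --> l.
Proof.
move=> H; apply: contrapT => nul.
have [e e0 He] : exists2 e : R, 0 < e & forall N, exists n, (N <= n)%N /\ e <= `|l - u n|.
  apply: contrapT => /forall2NP NH; apply: nul; apply/cvgrPdist_lt => e e0.
  have [/(_ e0)//|/existsNP[N /forallNP HN]] := NH e.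
  exists N => // n /= Nn; rewrite ltNge; apply/negP => le.
  exact: (HN n).
have [h hP] := choice He.
have [k [kn]] := H h (fun n => (hP n).1).
move=> /cvgrPdist_lt /(_ _ e0) [N _ /(_ N)]/=.
by move=> /(_ (leqnn N)); rewrite ltNge (hP (k N)).2.
Qed.

Lemma cvg_of_sub0 (u : nat -> R) (l : R) : u n - l @[n --> \oo] --> 0 -> u n @[n --> \oo] --> l.
Proof.
move=> h; have : u n - l + l @[n --> \oo] --> 0 + l by apply: cvgD => //; exact: cvg_cst.
by rewrite add0r; under eq_cvg do rewrite subrK.
Qed.

Lemma cvg_sqr (u : nat -> R) (l : R) :
  u n @[n --> \oo] --> l -> u n ^+ 2 @[n --> \oo] --> l ^+ 2.
Proof. by move=> h; rewrite expr2; under eq_cvg do rewrite expr2; exact: cvgM. Qed.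

Lemma cvg_sqr0 (u : nat -> R) : u n ^+ 2 @[n --> \oo] --> 0 -> u n @[n --> \oo] --> 0.
Proof.
move=> h; apply/norm_cvg0P.
have -> : (fun n => `|u n|) = (fun n => Num.sqrt (u n ^+ 2)).
  by apply/funext => n; rewrite sqrtr_sqr.
rewrite -[X in _ --> X]sqrtr0.
by apply: continuous_cvg => //; exact: sqrt_continuous.
Qed.

End Subsequences.

Section AlmostSure.
Context {R : realType} {d : measure_display} {T : measurableType d}.
Variable P : probability T R.
Local Notation Int := (Int P).
Local Notation Ex := (Ex P).

(** The sum of the series has finite expectation by monotone convergence,
    hence is almost surely finite. *)
Lemma ae_cvg_series (f_ : nat -> T -> R) C :
  (forall n, Int (f_ n)) -> (forall n w, 0 <= f_ n w) ->
  (forall n, \sum_(0 <= i < n) Ex (f_ i) <= C) ->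
  {ae P, forall w, cvgn (series (fun n => f_ n w))}.
Proof.
move=> If f0 fC.
have mf n : measurable_fun setT (EFin \o f_ n) by exact/measurable_EFinP/Int_mea/If.
have f0' n x : setT x -> (0 <= (EFin \o f_ n) x)%E by rewrite lee_fin.
have := integral_nneseries P measurableT mf f0' => /= E.
have I : P.-integrable setT (fun x => (\sum_(n <oo) (f_ n x)%:E)%E).
  apply/integrableP; split.
    apply: (emeasurable_fun_cvg (fun n x => (\sum_(0 <= i < n) (f_ i x)%:E)%E)).
      by move=> n; apply: emeasurable_sum => i; exact: mf.
    by move=> x _; apply: is_cvg_nneseries => n _ _; rewrite lee_fin.
  under eq_integral => x _.
    rewrite gee0_abs; last by apply: nneseries_ge0 => n _ _; rewrite lee_fin.
    over.
  rewrite E; apply: (@le_lt_trans _ _ C%:E); last exact: ltry.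
  apply: lime_le.
    by apply: is_cvg_nneseries => n _ _; apply: integral_ge0 => x _; exact: f0'.
  apply: nearW => n; under eq_bigr do rewrite EFin_Ex//.
  by rewrite sumEFin lee_fin.
apply: filterS (integrable_ae measurableT I) => w /(_ Logic.I) fin.
apply: nondecreasing_is_cvgn.
  by apply: nondecreasing_series => n _ _; exact: f0.
exists (fine (\sum_(n <oo) (f_ n w)%:E)%E) => _ [n _ <-].
rewrite -lee_fin fineK// /series/= -sumEFin.
by apply: nneseries_lim_ge => k _ _; rewrite lee_fin.
Qed.

(** Choose indices along which the expectations are at most 2^-n; the
    series of the chosen functions then converges almost surely, and its terms
    tend to 0. *)
Lemma ae_extraction (f_ : nat -> T -> R) :
  (forall n, Int (f_ n)) -> (forall n w, 0 <= f_ n w) ->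
  Ex (f_ n) @[n --> \oo] --> 0 ->
  exists k, (forall n, (n <= k n)%N) /\
    {ae P, forall w, f_ (k n) w @[n --> \oo] --> 0}.
Proof.
move=> If f0 /cvgrPdist_lt f0cv.
have H n : exists k, (n <= k)%N /\ Ex (f_ k) <= 2^-1 ^+ n.
  have [|N _ HN] := f0cv (2^-1 ^+ n); first by rewrite exprn_gt0.
  exists (maxn N n); split; first exact: leq_maxr.
  have := HN (maxn N n) (leq_maxl _ _).
  by rewrite sub0r normrN => /ltW; apply: le_trans; exact: ler_norm.
have [k kP] := choice H.
exists k; split; first by move=> n; case: (kP n).
have : {ae P, forall w, cvgn (series (fun n => f_ (k n) w))}.
  apply: (@ae_cvg_series _ 2) => //.
  move=> n; apply: (@le_trans _ _ (\sum_(0 <= i < n) 2^-1 ^+ i)).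
    by apply: ler_sum => i _; exact: (kP i).2.
  have := @geometric_seriesE R 1 2^-1; rewrite /series/= => /(_ _)/(congr1 (@^~ n)).
  under eq_bigr do rewrite mul1r.
  move=> ->; last by rewrite lt_eqF// invf_lt1// ltr1n.
  have : 0 <= 2^-1 ^+ n :> R by rewrite exprn_ge0.
  move: (2^-1 ^+ n) => x x0.
  rewrite mul1r ler_pdivrMr; lra.
by apply: filterS => w; exact: cvg_series_cvg_0.
Qed.

Lemma Ex_eq0 f : Int f -> (forall w, 0 <= f w) -> Ex f = 0 ->
  {ae P, forall w, f w = 0}.
Proof.
move=> If f0 E0.
have : (\int[P]_w `|(f w)%:E| = 0)%E.
  rewrite -[RHS]/(0%R%:E) -E0 -EFin_Ex//; apply: eq_integral => x _.
  by rewrite gee0_abs// lee_fin.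
move=> /(ae_eq_integral_abs _ measurableT _).1 => /(_ _) H.
have := H ((measurable_EFinP _ _).2 (Int_mea If)).
by apply: filterS => w /(_ Logic.I)/= [].
Qed.

(** * Square-integrable functions *)

Definition L2 (f : T -> R) := mea f /\ Int (fun w => f w ^+ 2).

Lemma L2P f : (f \in Lfun P 2%:E) <-> L2 f.
Proof.
split.
  move=> f2; split; last exact: Lfun2_integrable_sqr f2.
  by move: f2; rewrite inE => /andP[]; rewrite inE.
move=> [mf /integrableP[_ fi]].
rewrite inE; apply/andP; split; first by rewrite inE.
rewrite inE/= /finite_norm unlock/=.
apply: poweR_lty.
rewrite (le_lt_trans _ fi)//; apply: ge0_le_integral => //.
- apply/measurable_EFinP.
  apply/(@measurableT_comp _ _ _ _ _ _ (fun x : R => x `^ 2)%R) => //.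
  exact/measurableT_comp.
- apply: measurableT_comp => //; apply/measurable_EFinP.
  exact: measurable_funX.
by move=> t _/=; rewrite lee_fin normrX powR_mulrn.
Qed.

Lemma LnormE f : L2 f -> ('N[P]_2%:E[EFin \o f])%E = (Num.sqrt (Ex (fun w => f w ^+ 2)))%:E.
Proof.
move=> [mf If]; rewrite unlock /=.
rewrite (_ : (\int[P]_x _)%E = (\int[P]_w ((f w ^+ 2)%R)%:E)%E); last first.
  by apply: eq_integral => x _; rewrite powR_mulrn// real_normK// num_real.
by rewrite EFin_Ex// poweR_EFin powR12_sqrt// Ex_ge0// => w; rewrite sqr_ge0.
Qed.

Lemma L2_IntM f g : L2 f -> L2 g -> Int (fun w => f w * g w).
Proof.
move=> [mf If] [mg Ig].
apply: (@Int_le _ _ _ _ _ (fun w => f w ^+ 2 + g w ^+ 2)); last exact: IntD.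
  exact: measurable_funM.
move=> w; rewrite normrM.
have := sqr_ge0 (`|f w| - `|g w|).
have : 0 <= `|f w| ^+ 2 + `|g w| ^+ 2 by rewrite addr_ge0// sqr_ge0.
rewrite -(real_normK (num_real (f w))) -(real_normK (num_real (g w))).
have := normr_ge0 (f w); have := normr_ge0 (g w); nra.
Qed.

Lemma L2_cst c : L2 (fun=> c).
Proof. by split; [exact: measurable_cst|exact: Int_cst]. Qed.

Lemma L2_Int f : L2 f -> Int f.
Proof.
move=> hf; have := L2_IntM hf (L2_cst 1).
by under eq_fun do rewrite mulr1.
Qed.

Lemma L2_le f g : mea f -> (forall w, `|f w| <= `|g w|) -> L2 g -> L2 f.
Proof.
move=> mf fg [mg Ig]; split => //.
apply: (Int_le _ _ Ig); first exact: measurable_funX.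
by move=> w; rewrite ger0_norm ?sqr_ge0// -(real_normK (num_real (f w)))
  -(real_normK (num_real (g w))) lerXn2r ?nnegrE.
Qed.

Lemma L2D f g : L2 f -> L2 g -> L2 (fun w => f w + g w).
Proof.
move=> hf hg; have [mf If] := hf; have [mg Ig] := hg; split; first exact: measurable_funD.
have -> : (fun w => (f w + g w) ^+ 2) = (fun w => f w ^+ 2 + 2 * (f w * g w) + g w ^+ 2).
  by apply/funext => w; ring.
by apply: IntD => //; apply: IntD => //; apply: IntZ; exact: L2_IntM.
Qed.

Lemma L2Z c f : L2 f -> L2 (fun w => c * f w).
Proof.
move=> [mf If]; split; first exact: measurable_funM.
by under eq_fun do rewrite exprMn; exact: IntZ.
Qed.

Lemma L2B f g : L2 f -> L2 g -> L2 (fun w => f w - g w).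
Proof.
move=> hf hg; under eq_fun do rewrite -mulN1r.
by apply: L2D => //; exact: L2Z.
Qed.

Lemma L2_sum (I : Type) (r : seq I) (F : I -> T -> R) :
  (forall i, L2 (F i)) -> L2 (fun w => \sum_(i <- r) F i w).
Proof.
move=> IF; elim: r => [|i r IH].
  by under [X in L2 X]eq_fun do rewrite big_nil; exact: L2_cst.
by under [X in L2 X]eq_fun do rewrite big_cons; exact: L2D.
Qed.

(** The quadratic form x^2 E f^2 + 2xy E fg + y^2 E g^2 is nonnegative;
    evaluate it at (- E fg, E f^2), or let it become linear if E f^2 = 0. *)
Lemma Ex_mul_sqr_le f g : L2 f -> L2 g ->
  (Ex (fun w => f w * g w)) ^+ 2 <= Ex (fun w => f w ^+ 2) * Ex (fun w => g w ^+ 2).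
Proof.
move=> hf hg.
set b := Ex (fun w => f w * g w); set a := Ex (fun w => f w ^+ 2); set c := Ex (fun w => g w ^+ 2).
have If := hf.2; have Ig := hg.2; have Ifg := L2_IntM hf hg.
have H x y : 0 <= x ^+ 2 * a + 2 * x * y * b + y ^+ 2 * c.
  rewrite -!ExZ// -!ExD//; try by [exact: IntZ|apply: IntD; exact: IntZ].
  apply: Ex_ge0 => w; have := sqr_ge0 (x * f w + y * g w).
  by move=> h; apply: le_trans h _; rewrite le_eqVlt; apply/orP; left; apply/eqP; ring.
have a0 : 0 <= a by apply: Ex_ge0 => w; exact: sqr_ge0.
have c0 : 0 <= c by apply: Ex_ge0 => w; exact: sqr_ge0.
have [a00|an0] := eqVneq a 0.
  have [->|b0] := eqVneq b 0; first by rewrite expr0n mulr_ge0.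
  (* for a = 0 this point gives the value -(c+1) + c, which is negative *)
  have := H (- (c + 1) / (2 * b)) 1.
  have -> : 2 * (- (c + 1) / (2 * b)) * 1 * b = - (c + 1) by field.
  rewrite a00; lra.
have ap : 0 < a by rewrite lt_def an0.
have := H (- b) a.
have -> : (- b) ^+ 2 * a + 2 * - b * a * b + a ^+ 2 * c = a * (a * c - b ^+ 2) by ring.
by rewrite pmulr_rge0// subr_ge0.
Qed.

Lemma Ex_sqr_ge f : L2 f -> Ex f ^+ 2 <= Ex (fun w => f w ^+ 2).
Proof.
move=> hf; have := Ex_mul_sqr_le hf (L2_cst 1).
rewrite Ex_cst expr1n mulr1.
by under [X in Ex X ^+ 2 <= _ -> _]eq_fun do rewrite mulr1.
Qed.

End AlmostSure.

(** * From almost sure convergence to convergence in mean *)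

Section Clamp.
Context {R : realType}.

Definition clamp (K y : R) : R := Num.max (- K) (Num.min K y).

Lemma clamp_le K y : 0 <= K -> `|clamp K y| <= K.
Proof.
move=> K0; rewrite /clamp ler_norml.
by rewrite le_max lexx/= ge_max ge_min lexx/= andbT; lra.
Qed.

Lemma clamp_id K y : `|y| <= K -> clamp K y = y.
Proof.
rewrite ler_norml /clamp => /andP[h1 h2].
by rewrite min_r// max_r.
Qed.

Lemma sub_clamp_le K y : 0 <= K -> `|y - clamp K y| <= `|y|.
Proof.
move=> K0; rewrite /clamp.
case: (leP K y) => h1; case: (leP (- K) _) => h2.
- rewrite !ger0_norm; lra.
- lra.
- by rewrite subrr normr0.
- rewrite !ler0_norm; lra.
Qed.

(** The error of truncation is controlled by the second moment: this is how
    L2 bounds are converted into uniform integrability. *)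
Lemma sub_clamp_sqr K y : 0 < K -> `|y - clamp K y| <= K^-1 * y ^+ 2.
Proof.
move=> K0; have [yK|Ky] := leP `|y| K.
  by rewrite clamp_id// subrr normr0 mulr_ge0 ?invr_ge0 ?sqr_ge0 ?ltW.
apply: (le_trans (sub_clamp_le _ (ltW K0))).
rewrite -(real_normK (num_real y)) mulrC ler_pdivlMr// expr2.
by rewrite ler_wpM2l// ltW.
Qed.

Lemma continuous_clamp K : continuous (clamp K).
Proof.
move=> y; apply: (@continuous_max _ _ (cst (- K)) (fun y => Num.min K y)).
  exact: cvg_cst.
apply: (@continuous_min _ _ (cst K) id); first exact: cvg_cst.
exact: cvg_id.
Qed.

Lemma measurable_clamp K : measurable_fun setT (clamp K).
Proof. by apply: continuous_measurable_fun; exact: continuous_clamp. Qed.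

End Clamp.

Section L2Convergence.
Context {R : realType} {d : measure_display} {T : measurableType d}.
Variable P : probability T R.
Local Notation Int := (Int P).
Local Notation Ex := (Ex P).
Local Notation L2 := (L2 P).

Lemma mea_norm (f : T -> R) : mea f -> mea (fun w => `|f w|).
Proof. by move=> mf; apply: (measurableT_comp (@normr_measurable R setT) mf). Qed.

Lemma meaD (f g : T -> R) : mea f -> mea g -> mea (fun w => f w + g w).
Proof. by move=> mf mg; exact: measurable_funD. Qed.

Lemma meaB (f g : T -> R) : mea f -> mea g -> mea (fun w => f w - g w).
Proof. by move=> mf mg; exact: measurable_funB. Qed.

Lemma meaM (f g : T -> R) : mea f -> mea g -> mea (fun w => f w * g w).
Proof. by move=> mf mg; exact: measurable_funM. Qed.

Lemma mea_cst c : mea (fun _ : T => c : R).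
Proof. exact: measurable_cst. Qed.

Lemma mea_sqr (f : T -> R) : mea f -> mea (fun w => f w ^+ 2).
Proof. by move=> mf; exact: measurable_funX. Qed.

Lemma mea_comp (g : R -> R) (f : T -> R) :
  measurable_fun setT g -> mea f -> mea (fun w => g (f w)).
Proof. by move=> mg mf; exact: (measurableT_comp mg mf). Qed.

Lemma mea_cvg (f_ : nat -> T -> R) (f : T -> R) :
  (forall n, mea (f_ n)) -> (forall w, f_ n w @[n --> \oo] --> f w) -> mea f.
Proof. by move=> mf cv; apply: (measurable_fun_cvg mf) => w _; exact: cv. Qed.

Lemma cvg_L2_strongE (Y : nat -> T -> R) (Z : T -> R) :
  (forall n, (0 < n)%N -> L2 (Y n)) -> L2 Z ->
  cvg_L2_strong P Y Z <-> Ex (fun w => (Y n w - Z w) ^+ 2) @[n --> \oo] --> 0.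
Proof.
move=> hY hZ; rewrite /cvg_L2_strong -cvg_shiftS -[X in _ <-> X]cvg_shiftS.
have E n : ('N[P]_2%:E[EFin \o (Y n.+1 \- Z)%R])%E =
    (Num.sqrt (Ex (fun w => (Y n.+1 w - Z w) ^+ 2)))%:E.
  by rewrite LnormE//; apply: L2B => //; exact: hY.
rewrite (_ : [sequence _]_n = (fun n =>
  (Num.sqrt (Ex (fun w => (Y n.+1 w - Z w) ^+ 2)))%:E)); last first.
  by apply/funext => n /=; rewrite E.
have pos n : 0 <= Ex (fun w => (Y n.+1 w - Z w) ^+ 2) by apply: Ex_ge0 => w; exact: sqr_ge0.
split.
  move=> /fine_cvg /= h; rewrite [X in X @ _](_ : _ =
    (fun n => Num.sqrt (Ex (fun w => (Y n.+1 w - Z w) ^+ 2)) ^+ 2)); last first.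
    by apply/funext => n; rewrite sqr_sqrtr.
  by have := cvg_sqr h; rewrite expr0n.
move=> h; apply: cvg_EFin; first exact: nearW.
by rewrite -[X in _ --> X]sqrtr0; apply: continuous_cvg => //; exact: sqrt_continuous.
Qed.

(** A bound C on the second moments makes the sequence uniformly integrable:
    truncating at level K moves every expectation by at most C / K, and the
    truncated functions converge in mean by dominated convergence. *)
Lemma cvg_Ex_of_ae (Y : nat -> T -> R) (Z : T -> R) C :
  (forall n, L2 (Y n)) -> mea Z ->
  {ae P, forall w, Y n w @[n --> \oo] --> Z w} ->
  (forall n, Ex (fun w => Y n w ^+ 2) <= C) ->
  [/\ L2 Z, Ex (fun w => Z w ^+ 2) <= C & Ex (Y n) @[n --> \oo] --> Ex Z].
Proof.
move=> hY mZ cv hC.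
have [IZ2 Z2C] : Int (fun w => Z w ^+ 2) /\ Ex (fun w => Z w ^+ 2) <= C.
  apply: (@Fatou _ _ _ _ (fun n w => Y n w ^+ 2)) => //.
  - by move=> n; exact: (hY n).2.
  - exact: measurable_funX.
  - by move=> n w; exact: sqr_ge0.
  - by move=> w; exact: sqr_ge0.
  - apply: filterS cv => w h.
    exact: cvg_sqr.
have LZ : L2 Z by split.
split=> //.
have C0 : 0 <= C by apply: le_trans Z2C; apply: Ex_ge0 => w; exact: sqr_ge0.
apply/cvgrPdist_lt => e e0.
(* both truncations then cost at most C / K <= e / 4 *)
pose K := (4 * (C + 1)) / e.
have K0 : 0 < K by rewrite /K divr_gt0 ?mulr_gt0// ltr_wpDl.
have cl f : L2 f -> Int (fun w => clamp K (f w)) /\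
    `|Ex f - Ex (fun w => clamp K (f w))| <= K^-1 * Ex (fun w => f w ^+ 2).
  move=> [mf If]; have If1 := L2_Int (conj mf If).
  have mc : mea (fun w => clamp K (f w)) by apply: measurableT_comp => //; exact: measurable_clamp.
  have Ic : Int (fun w => clamp K (f w)).
    apply: (Int_le mc _ (Int_cst P K)) => w; exact/clamp_le/ltW.
  split=> //; rewrite -ExB// -ExZ//.
  apply: (le_trans (Ex_norm (IntB If1 Ic))); apply: Ex_le => //.
  - exact/Int_norm/IntB.
  - exact: IntZ.
  - by move=> w; exact: sub_clamp_sqr.
have [_ /cvgrPdist_lt cvK] : Int (fun w => clamp K (Z w)) /\
    Ex (fun w => clamp K (Y n w)) @[n --> \oo] --> Ex (fun w => clamp K (Z w)).
  apply: (@DCT _ _ _ _ _ _ (fun=> K)).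
  - by move=> n; apply: measurableT_comp (hY n).1; exact: measurable_clamp.
  - by apply: measurableT_comp => //; exact: measurable_clamp.
  - exact: Int_cst.
  - by move=> n w; exact/clamp_le/ltW.
  - apply: filterS cv => w h.
    exact: (continuous_cvg _ (@continuous_clamp _ K _) h).
have e2 : 0 < e / 2 by rewrite divr_gt0.
have [N _ HN] := cvK _ e2.
exists N => // n /= Nn; have := HN n Nn => /= h1.
have [_ h2] := cl _ LZ; have [_ h3] := cl _ (hY n).
have b (f : T -> R) : Ex (fun w => f w ^+ 2) <= C -> K^-1 * Ex (fun w => f w ^+ 2) <= e / 4.
  move=> fC; rewrite mulrC ler_pdivrMr//.
  have -> : e / 4 * K = C + 1 by rewrite /K; field; rewrite gt_eqF.
  by rewrite (le_trans fC)// lerDl.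
have h4 := b _ Z2C; have h5 := b _ (hC n).
have : `|Ex Z - Ex (Y n)| <= `|Ex Z - Ex (fun w => clamp K (Z w))| +
   `|Ex (fun w => clamp K (Z w)) - Ex (fun w => clamp K (Y n w))| +
   `|Ex (Y n) - Ex (fun w => clamp K (Y n w))|.
  rewrite (distrC (Ex (Y n))).
  have -> : Ex Z - Ex (Y n) = (Ex Z - Ex (fun w => clamp K (Z w))) +
   (Ex (fun w => clamp K (Z w)) - Ex (fun w => clamp K (Y n w))) +
   (Ex (fun w => clamp K (Y n w)) - Ex (Y n)) by ring.
  by apply: (le_trans (ler_normD _ _)); rewrite lerD2r ler_normD.
lra.
Qed.

(** If no second moment is lost in the limit, almost sure convergence is
    convergence in mean square. Fatou's lemma is applied to
    2 Y^2 + 2 Z^2 - (Y - Z)^2 >= 0, whose limit is 4 Z^2, along indices where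
    the mean square error stays above e. *)
Lemma cvg_L2_of_ae (Y : nat -> T -> R) (Z : T -> R) (c : nat -> R) (l : R) :
  (forall n, L2 (Y n)) -> L2 Z ->
  {ae P, forall w, Y n w @[n --> \oo] --> Z w} ->
  (forall n, Ex (fun w => Y n w ^+ 2) <= c n) ->
  c n @[n --> \oo] --> l -> l <= Ex (fun w => Z w ^+ 2) ->
  Ex (fun w => (Y n w - Z w) ^+ 2) @[n --> \oo] --> 0.
Proof.
move=> hY LZ cv hc ccv; set EZ := Ex (fun w => Z w ^+ 2) => lEZ.
have hB n := L2B (hY n) LZ.
apply/cvgrPdist_lt => e e0; apply: contrapT => Hn.
have H N : exists n, (N <= n)%N /\ e <= Ex (fun w => (Y n w - Z w) ^+ 2).
  apply: contrapT => /forallNP h; apply: Hn; exists N => // n /= Nn.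
  rewrite sub0r normrN ger0_norm; last by apply: Ex_ge0 => w; exact: sqr_ge0.
  by rewrite ltNge; apply/negP => eE; apply: (h n).
have /cvgrPdist_lt/(_ (e / 4)) := ccv; have e4 : 0 < e / 4 by rewrite divr_gt0.
move=> /(_ e4)[N0 _ HN0].
have [h0 h0P] := choice H; pose h n := h0 (maxn N0 n).
have hn n : (n <= h n)%N by apply: leq_trans (h0P _).1; exact: leq_maxr.
have hN n : (N0 <= h n)%N by apply: leq_trans (h0P _).1; exact: leq_maxl.
have he n : e <= Ex (fun w => (Y (h n) w - Z w) ^+ 2) by exact: (h0P _).2.
have I1 n : Int (fun w => 2 * Y n w ^+ 2 + 2 * Z w ^+ 2).
  by apply: IntD; apply: IntZ; [exact: (hY n).2|exact: LZ.2].
have [] := @Fatou _ _ _ P (fun n w => 2 * Y (h n) w ^+ 2 + 2 * Z w ^+ 2 - (Y (h n) w - Z w) ^+ 2)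
  (fun w => 4 * Z w ^+ 2) (4 * EZ - e / 2).
- by move=> n; apply: IntB => //; exact: (hB _).2.
- by apply: measurable_funM => //; apply: measurable_funX; exact: LZ.1.
- move=> n w; have := sqr_ge0 (Y (h n) w + Z w).
  by move=> h1; apply: (le_trans h1); rewrite le_eqVlt; apply/orP; left; apply/eqP; ring.
- by move=> w; rewrite mulr_ge0// sqr_ge0.
- apply: filterS cv => w /(cvg_extracted hn) hw.
  have -> : 4 * Z w ^+ 2 = 2 * Z w ^+ 2 + 2 * Z w ^+ 2 - (Z w - Z w) ^+ 2 by ring.
  apply: cvgB; last first.
    by apply: cvg_sqr; apply: cvgB => //; exact: cvg_cst.
  apply: cvgD; last exact: cvg_cst.
  by apply: cvgMr; exact: cvg_sqr.
- move=> n; rewrite ExB//; last exact: (hB _).2.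
  rewrite ExD; try by [apply: IntZ; exact: (hY _).2|apply: IntZ; exact: LZ.2].
  rewrite !ExZ; [|exact: LZ.2|exact: (hY _).2].
  have := he n; have := hc (h n); have := HN0 _ (hN n) => /=.
  rewrite -/EZ ltr_distl => /andP[]; lra.
- move=> _; rewrite ExZ; last exact: LZ.2.
  rewrite -/EZ; lra.
Qed.

(** Restates convergence in probability as a convergence of expectations,
    to which ae_extraction applies. *)
Lemma cvg_in_probability_Ex (Y : nat -> T -> R) (Z : T -> R) :
  (forall n, mea (Y n)) -> mea Z -> cvg_in_probability P Y Z ->
  Ex (fun w => Num.min 1 `|Y n w - Z w|) @[n --> \oo] --> 0.
Proof.
move=> mY mZ cv.
have mD n : mea (fun w => `|Y n w - Z w|).
  exact/mea_norm/meaB.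
have mm n : mea (fun w => Num.min 1 `|Y n w - Z w|).
  exact: (measurable_minr (mea_cst 1) (mD n)).
have m0 n w : 0 <= Num.min 1 `|Y n w - Z w| by rewrite le_min ler01 normr_ge0.
have Im n : Int (fun w => Num.min 1 `|Y n w - Z w|).
  apply: (Int_le (mm n) _ (Int_cst P 1)) => w.
  by rewrite ger0_norm// ge_min lexx.
apply/cvgrPdist_lt => e e0.
have e2 : 0 < e / 2 by rewrite divr_gt0.
have := cv _ e2 => /fine_cvgP[_ /cvgrPdist_lt/(_ _ e2)][N _ HN].
exists N => // n /= Nn; have := HN n Nn => /=.
rewrite !sub0r !normrN.
set A := [set w | _].
have mA : measurable A.
  rewrite [A](_ : _ = setT `&` [set w | e / 2 <= `|Y n w - Z w|]); last by rewrite setTI.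
  by apply: (measurable_fun_le (f := fun=> e / 2)) => //; exact: mD.
have IA : Int (fun w => \1_A w).
  by apply: (Int_le _ _ (Int_cst P 1)) => [|w]; [exact: measurable_indic|
    rewrite ger0_norm// indicE; case: (_ \in _)].
have EA : Ex (fun w => \1_A w) = fine (P A).
  by rewrite /Ex /Rintegral integral_indic// setIT.
move=> hA; rewrite ger0_norm; last exact: Ex_ge0.
apply: (@le_lt_trans _ _ (e / 2 + Ex (fun w => \1_A w))).
  rewrite -[X in X + _](Ex_cst P) -ExD//; last exact: Int_cst.
  apply: Ex_le => //; first by apply: IntD => //; exact: Int_cst.
  move=> w; rewrite indicE; case: (boolP (w \in A)) => hw /=.
    by rewrite (@le_trans _ _ 1)// ?ge_min ?lexx// lerDr ltW.
  move: hw; rewrite notin_setE /A /= => /negP; rewrite -ltNge => hw.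
  by rewrite ge_min addr0 (ltW hw) orbT.
by rewrite [ltRHS]splitr ltrD2l EA; apply: le_lt_trans hA; exact: ler_norm.
Qed.

End L2Convergence.

(** * Products of independent variables *)

Import HBNNSimple.
Section Independence.
Context {R : realType} {d : measure_display} {T : measurableType d}.
Variable P : probability T R.
Local Notation Int := (Int P).
Local Notation Ex := (Ex P).
Local Notation L2 := (L2 P).

Lemma ge0_integral_nnsfun_weighted (Y Y' F : T -> R) (c : R) (f : {nnsfun R >-> R}) :
  mea Y -> mea Y' -> mea F -> (forall w, 0 <= F w) -> 0 <= c ->
  (forall A, measurable A ->
     (\int[P]_w (\1_A (Y w) * F w)%:E = P (Y' @^-1` A) * c%:E)%E) ->
  (\int[P]_w (f (Y w) * F w)%:E =
     (\sum_(y \in range f) y%:E * P (Y' @^-1` (f @^-1` [set y]))) * c%:E)%E.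
Proof.
move=> mY mY' mF F0 c0 H.
have mA y : measurable (f @^-1` [set y]) by [].
have e w : (f (Y w) * F w)%:E =
    (\sum_(y \in range f) (y%:E * (\1_(f @^-1` [set y]) (Y w) * F w)%:E))%E.
  rewrite {1}fimfunE fsbig_finite//= [in RHS]fsbig_finite//= mulr_suml -sumEFin.
  by apply: eq_bigr => y _; rewrite -EFinM mulrA.
have m1 y : measurable_fun setT (fun w => (\1_(f @^-1` [set y]) (Y w) * F w)).
  by apply: measurable_funM => //; apply: measurableT_comp => //; exact: measurable_indic.
under eq_integral do rewrite e.
rewrite ge0_integral_fsum//; last 2 first.
- move=> y; apply: measurable_funeM; exact/measurable_EFinP.
- move=> y w _ /=.
  have [y0|y0] := leP 0 y; first by rewrite -EFinM lee_fin !mulr_ge0.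
  rewrite (_ : \1_ _ _ = 0) ?mul0r ?mule0//.
  rewrite indicE; apply/eqP; rewrite pnatr_eq0 eqb0; apply/negP; rewrite inE /= => fy.
  have h : 0 <= f (Y w) by exact: fun_ge0.
  by move: h; rewrite fy leNgt y0.
rewrite ge0_mule_fsuml; last first.
  move=> y; have [y0|y0] := leP 0 y; first by rewrite mule_ge0.
  rewrite preimage_nnfun0//  preimage_set0 measure0 mule0//.
apply: eq_fsbigr => y _.
have [y0|y0] := leP 0 y.
  rewrite ge0_integralZl//; last 2 first.
  - exact/measurable_EFinP.
  - by move=> w _; rewrite lee_fin mulr_ge0.
  by rewrite H// muleA.
rewrite preimage_nnfun0// preimage_set0 measure0 mule0 mul0e.
by apply: integral0_eq => w _; rewrite indic0 mul0r mule0.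
Qed.

(** Change of variable under a weight: if, on indicators, integrating a
    function of Y against F amounts to integrating it against the law of Y' and
    multiplying by c, the same holds for all nonnegative measurable functions,
    by monotone approximation with simple functions. *)
Lemma ge0_integral_weighted (Y Y' F : T -> R) (c : R) (phi : R -> R) :
  mea Y -> mea Y' -> mea F -> (forall w, 0 <= F w) -> 0 <= c ->
  (forall A, measurable A ->
     (\int[P]_w (\1_A (Y w) * F w)%:E = P (Y' @^-1` A) * c%:E)%E) ->
  measurable_fun setT phi -> (forall x, 0 <= phi x) ->
  (\int[P]_w (phi (Y w) * F w)%:E = (\int[P]_w (phi (Y' w))%:E) * c%:E)%E.
Proof.
move=> mY mY' mF F0 c0 H mphi phi0.
have mphiE : measurable_fun [set: R] (EFin \o phi) by exact/measurable_EFinP.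
pose f n := nnsfun_approx measurableT mphiE n.
have fcv x : f n x @[n --> \oo] --> phi x.
  have := @cvg_nnsfun_approx _ _ _ _ measurableT _ mphiE (fun x _ => phi0 x) x Logic.I.
  by move=> /fine_cvg.
have fnd x m n : (m <= n)%N -> f m x <= f n x.
  by move=> mn; have /lefP/(_ x) := @nd_nnsfun_approx _ _ _ _ measurableT _ mphiE _ _ mn.
have key (Z G : T -> R) : mea Z -> mea G -> (forall w, 0 <= G w) ->
   (\int[P]_w (f n (Z w) * G w)%:E @[n --> \oo] --> \int[P]_w (phi (Z w) * G w)%:E)%E.
  move=> mZ mG G0.
  have := @cvg_monotone_convergence _ _ _ P setT measurableT
     (fun n w => (f n (Z w) * G w)%:E).
  rewrite (_ : (\int[P]_w limn _)%E = (\int[P]_w (phi (Z w) * G w)%:E)%E); last first.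
    apply: eq_integral => w _; apply/cvg_lim => //; apply: cvg_EFin; first exact: nearW.
    by apply: cvgMl; exact: fcv.
  apply.
  - move=> n; apply/measurable_EFinP; apply: meaM => //.
    exact: (mea_comp (measurable_funPT (f n))).
  - by move=> n w _; rewrite lee_fin mulr_ge0.
  - by move=> w _ m n mn; rewrite lee_fin ler_wpM2r// fnd.
have h1 := key Y F mY mF F0.
have h2 := key Y' (fun=> 1) mY' (mea_cst _) (fun _ => ler01).
have E n : (\int[P]_w (f n (Y w) * F w)%:E = (\int[P]_w (f n (Y' w) * 1)%:E) * c%:E)%E.
  rewrite (ge0_integral_nnsfun_weighted (f n) mY mY' mF F0 c0 H).
  congr (_ * _)%E.
  rewrite (@ge0_integral_nnsfun_weighted Y' Y' (fun=> 1) 1)//; first by rewrite mule1.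
  - exact: mea_cst.
  move=> A mA; rewrite mule1.
  under eq_integral do rewrite mulr1.
  have mYA : measurable (Y' @^-1` A) by rewrite -[X in measurable X]setTI; exact: mY'.
  by have := @integral_indic _ _ _ P setT measurableT _ mYA; rewrite setIT.
have h3 : ((\int[P]_w (f n (Y' w) * 1)%:E) * c%:E @[n --> \oo] -->
    (\int[P]_w (phi (Y' w) * 1)%:E) * c%:E)%E.
  exact: cvgeZr.
have h4 : (\int[P]_w (f n (Y w) * F w)%:E @[n --> \oo] -->
    (\int[P]_w (phi (Y' w) * 1)%:E) * c%:E)%E.
  by rewrite (_ : (fun n => _) = (fun n => (\int[P]_w (f n (Y' w) * 1)%:E) * c%:E)%E)//; exact/funext.
rewrite (cvg_unique _ h1 h4)//; congr (_ * _)%E.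
by under eq_integral do rewrite mulr1.
Qed.

Lemma prod_indic (I : eqType) (s : seq I) (A : I -> set T) w :
  \prod_(i <- s) \1_(A i) w = \1_(\bigcap_(i in [set` s]) A i) w :> R.
Proof.
rewrite indicE; elim: s => [|i s IH].
  by rewrite big_nil; case: (boolP (w \in _)) => //; rewrite notin_setE => h; exfalso; apply: h.
rewrite big_cons IH indicE -natrM mulnb; congr ((nat_of_bool _)%:R).
apply/andP/idP.
  move=> [/set_mem h1 /set_mem h2]; apply/mem_set => j /=; rewrite inE => /orP[/eqP->//|js].
  exact: h2.
move=> /set_mem h; split; apply/mem_set; first by apply: h => /=; rewrite mem_head.
by move=> j js; apply: h => /=; rewrite inE; apply/orP; right.
Qed.

Lemma mea_prod (I : Type) (s : seq I) (f : I -> T -> R) :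
  (forall i, mea (f i)) -> mea (fun w => \prod_(i <- s) f i w).
Proof.
move=> mf; elim: s => [|i s IH].
  by under [X in mea X]eq_fun do rewrite big_nil; exact: mea_cst.
by under [X in mea X]eq_fun do rewrite big_cons; exact: meaM.
Qed.

Section Product.
Context {I : eqType}.
Variables (D : set I) (Y : I -> T -> R) (X0 : T -> R).
Hypothesis mY : forall i, mea (Y i).
Hypothesis mX0 : mea X0.
Hypothesis indY : mutually_independent P D Y.
Hypothesis lawY : forall i, D i -> same_law P (Y i) X0.

(** Independence is the case where all the factors are indicators. The
    indicators are replaced by general functions one index at a time: s' holds
    the indices already treated, and the remaining factors play the role of the
    weight F in ge0_integral_weighted. *)
Let integral_prod_mixed (s' s : seq I) (phi : I -> R -> R) (A : I -> set R) :
  uniq (s' ++ s) -> (forall i, i \in s' ++ s -> D i) -> (forall i, measurable (A i)) ->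
  (forall i, measurable_fun setT (phi i)) -> (forall i x, 0 <= phi i x) ->
  (forall i, Int (fun w => phi i (X0 w))) ->
  (\int[P]_w (\prod_(i <- s') phi i (Y i w) * \prod_(i <- s) \1_(A i) (Y i w))%:E =
   (\prod_(i <- s') Ex (fun w => phi i (X0 w)) *
    \prod_(i <- s) fine (P (X0 @^-1` A i)))%:E)%E.
Proof.
move=> + + + mphi phi0 Iphi.
have mX0A B : measurable B -> measurable (X0 @^-1` B).
  by move=> mB; rewrite -[X in measurable X]setTI; exact: mX0.
elim: s' s A => [|i s' IH] s A us sD mA.
  under eq_integral do rewrite big_nil mul1r (prod_indic s (fun i => Y i @^-1` A i)).
  rewrite big_nil mul1r.
  have mI : measurable (\bigcap_(i in [set` s]) Y i @^-1` A i).
    apply: fin_bigcap_measurable => // i _.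
    by rewrite -[X in measurable X]setTI; exact: mY.
  have -> := @integral_indic _ _ _ P setT measurableT _ mI; rewrite setIT.
  have Hi i : i \in s -> D i /\ measurable (A i) by move=> si; split; [exact: sD|exact: mA].
  have Hind := @indY s A us Hi.
  transitivity (\prod_(i <- s) P (Y i @^-1` A i))%E; first exact: Hind.
  rewrite -prodEFin big_seq [RHS]big_seq; apply: eq_bigr => i si.
  by rewrite lawY//; [rewrite fineK// fin_num_measure//; exact: mX0A|exact: sD].
have us' : uniq (s' ++ i :: s).
  by move: us; rewrite (perm_uniq (_ : perm_eq _ (s' ++ i :: s)))// perm_sym perm_catC /= perm_cons perm_catC.
have sD' j : j \in s' ++ i :: s -> D j.
  by move=> h; apply: sD; move: h; rewrite /= inE !mem_cat inE orbCA.
have is' : i \notin s by move: us; rewrite /= mem_cat negb_or => /andP[/andP[]].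
pose F w := \prod_(i <- s') phi i (Y i w) * \prod_(i <- s) \1_(A i) (Y i w).
pose c := \prod_(i <- s') Ex (fun w => phi i (X0 w)) *
    \prod_(i <- s) fine (P (X0 @^-1` A i)).
have step := @ge0_integral_weighted (Y i) X0 F c (phi i) (mY i) mX0.
rewrite big_cons -mulrA -/c EFinM -EFin_Ex// -step//.
- by apply: eq_integral => w _; rewrite big_cons mulrA.
- apply: meaM; apply: mea_prod => j; first exact: mea_comp.
  by apply: mea_comp => //; exact: measurable_indic.
- by move=> w; rewrite mulr_ge0// prodr_ge0.
- by rewrite mulr_ge0// prodr_ge0// => j _; [exact: Ex_ge0|rewrite fine_ge0].
move=> B mB.
pose A' j := if j == i then B else A j.
have A'E j : j \in s -> A' j = A j.
  by rewrite /A' => js; case: eqP => // ji; move: is'; rewrite -ji js.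
have A'i : A' i = B by rewrite /A' eqxx.
have mA' j : measurable (A' j) by rewrite /A'; case: ifP.
have := IH (i :: s) A' us' sD' mA'.
rewrite !big_cons A'i.
have -> : \prod_(j <- s) fine (P (X0 @^-1` A' j)) = \prod_(i <- s) fine (P (X0 @^-1` A i)).
  by rewrite big_seq [RHS]big_seq; apply: eq_bigr => j js; rewrite A'E.
move=> h; rewrite -[P (X0 @^-1` B)]fineK; last by rewrite fin_num_measure//; exact: mX0A.
rewrite -EFinM /c mulrCA -h.
apply: eq_integral => w _; rewrite /F big_cons A'i mulrCA; congr (_ * (_ * _))%:E.
by rewrite big_seq [RHS]big_seq; apply: eq_bigr => j js; rewrite A'E.
Qed.

Lemma Ex_prod_indep (s : seq I) (phi : I -> R -> R) :
  uniq s -> (forall i, i \in s -> D i) ->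
  (forall i, measurable_fun setT (phi i)) -> (forall i x, 0 <= phi i x) ->
  (forall i, Int (fun w => phi i (X0 w))) ->
  Int (fun w => \prod_(i <- s) phi i (Y i w)) /\
  Ex (fun w => \prod_(i <- s) phi i (Y i w)) = \prod_(i <- s) Ex (fun w => phi i (X0 w)).
Proof.
move=> us sD mphi phi0 Iphi.
have := @integral_prod_mixed s [::] phi (fun=> setT); rewrite cats0 => /(_ us sD) H.
have {}H := H (fun=> measurableT) mphi phi0 Iphi.
have E : (\int[P]_w (\prod_(i <- s) phi i (Y i w))%:E =
   (\prod_(i <- s) Ex (fun w => phi i (X0 w)))%:E)%E.
  rewrite big_nil mulr1 in H; rewrite -H.
  by apply: eq_integral => w _; rewrite big_nil mulr1.
have m : mea (fun w => \prod_(i <- s) phi i (Y i w)).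
  by apply: mea_prod => j; exact: mea_comp.
have [| |Ip _] := @Int_ge0_bounded _ _ _ P _ (\prod_(i <- s) Ex (fun w => phi i (X0 w))) m.
- by move=> w; exact: prodr_ge0.
- by rewrite E.
by split=> //; apply/EFin_inj; rewrite -E EFin_Ex.
Qed.

End Product.

Lemma Ex_same_law (Y X0 : T -> R) (phi : R -> R) : mea Y -> mea X0 -> same_law P Y X0 ->
  measurable_fun setT phi -> (forall x, 0 <= phi x) -> Int (fun w => phi (X0 w)) ->
  Int (fun w => phi (Y w)) /\ Ex (fun w => phi (Y w)) = Ex (fun w => phi (X0 w)).
Proof.
move=> mY mX0 law mphi phi0 I0.
have E : (\int[P]_w (phi (Y w))%:E = (Ex (fun w => phi (X0 w)))%:E)%E.
  have := @ge0_integral_weighted Y X0 (fun=> 1) 1 phi mY mX0 (mea_cst _) (fun _ => ler01) ler01.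
  rewrite mule1 EFin_Ex// => <- //.
    by apply: eq_integral => w _; rewrite mulr1.
  move=> A mA; rewrite mule1 -law//.
  under eq_integral do rewrite mulr1.
  have mYA : measurable (Y @^-1` A) by rewrite -[X in measurable X]setTI; exact: mY.
  by have := @integral_indic _ _ _ P setT measurableT _ mYA; rewrite setIT.
have [||Ip _] := @Int_ge0_bounded _ _ _ P _ (Ex (fun w => phi (X0 w))) (mea_comp mphi mY).
- by [].
- by rewrite E.
by split=> //; apply/EFin_inj; rewrite -E EFin_Ex.
Qed.

End Independence.

(** * The deterministic limit of a product of small perturbations *)

Section WickProducts.
Context {R : realType}.

(** Mean value theorem for z |-> ln z - (z - 1) + (z - 1)^2 / 2, whose
    derivative is (z - 1)^2 / z. *)
Lemma ln_Taylor2 (x : R) : `|x| <= 2^-1 ->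
  `|ln (1 + x) - x + 2^-1 * x ^+ 2| <= 2 * `|x| * x ^+ 2.
Proof.
rewrite ler_norml => /andP[x1 x2].
pose f z : R := ln z - (z - 1) + 2^-1 * (z - 1) ^+ 2.
pose df z : R := z^-1 - 1 + (z - 1).
have fd (z : R) : 0 < z -> is_derive z 1 f (df z).
  move=> z0; have ? := is_derive1_ln z0.
  apply: is_derive_eq; rewrite /df /GRing.scale/= !subr0 !mulr1.
  by field; rewrite gt_eqF.
have fc (a b : R) : 0 < a -> {within `[a, b], continuous f}.
  move=> a0; apply: derivable_within_continuous => z; rewrite in_itv/= => /andP[az _].
  by have [] := fd z (lt_le_trans a0 az).
have f1 : f 1 = 0 by rewrite /f ln1 subrr expr0n/= mulr0 subr0 addr0.
have fx : f (1 + x) = ln (1 + x) - x + 2^-1 * x ^+ 2.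
  by rewrite /f (_ : 1 + x - 1 = x)//; ring.
rewrite -fx.
have dfb (c : R) : 2^-1 <= c -> `|c - 1| <= `|x| -> `|df c| <= 2 * x ^+ 2.
  move=> c2 cx; have c0 : 0 < c by lra.
  have -> : df c = c^-1 * (c - 1) ^+ 2 by rewrite /df; field; rewrite gt_eqF.
  rewrite normrM normrX gtr0_norm ?invr_gt0//.
  rewrite -(real_normK (num_real x)); apply: ler_pM => //.
  - by rewrite invr_ge0 ltW.
  - by rewrite invf_ple ?posrE.
  - by rewrite lerXn2r ?nnegrE.
have [x0|x0|x0] := ltrgtP 0 x.
- have [|z||c] := @MVT _ f df 1 (1 + x); first by rewrite ltrDl.
  + by rewrite in_itv/= => /andP[z1 _]; apply: fd; lra.
  + by apply: fc.
  + rewrite in_itv/= => /andP[c1 c2]; rewrite f1 subr0 => ->.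
    rewrite normrM (_ : 1 + x - 1 = x); last by ring.
    rewrite mulrAC ler_wpM2r//; apply: dfb; first lra.
    by rewrite !gtr0_norm//; lra.
- have [|z||c] := @MVT _ f df (1 + x) 1; first by rewrite gtrDl.
  + by rewrite in_itv/= => /andP[z1 _]; apply: fd; lra.
  + by apply: fc; lra.
  + rewrite in_itv/= => /andP[c1 c2]; rewrite f1 sub0r => /(congr1 -%R); rewrite opprK => ->.
    rewrite normrN normrM (_ : 1 - (1 + x) = - x); last by ring.
    rewrite normrN mulrAC ler_wpM2r//; apply: dfb; first lra.
    by rewrite !ltr0_norm//; lra.
by rewrite -x0 addr0 f1 normr0 mulr0 mul0r.
Qed.

Lemma prod_expR_ln (s : seq nat) (x : nat -> R) : (forall i, i \in s -> 0 < 1 + x i) ->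
  \prod_(i <- s) (1 + x i) = expR (\sum_(i <- s) ln (1 + x i)).
Proof.
elim: s => [|i s IH] h; first by rewrite !big_nil expR0.
rewrite !big_cons expRD lnK ?posrE; last by apply: h; rewrite mem_head.
by rewrite IH// => j js; apply: h; rewrite inE js orbT.
Qed.

(** The logarithm of the product is the sum of the x i minus half the sum of
    their squares, up to an error of max |x i| times the sum of the squares. The
    bound dn on the squares makes this error vanish, and makes all factors
    eventually positive, so that passing to positive parts changes nothing. *)
Lemma cvg_wick_product (r : nat -> seq nat) (x : nat -> nat -> R) (dn : nat -> R) (S Q : R) :
  (forall n i, i \in r n -> x n i ^+ 2 <= dn n) ->
  dn n @[n --> \oo] --> 0 ->
  \sum_(i <- r n) x n i @[n --> \oo] --> S ->
  \sum_(i <- r n) x n i ^+ 2 @[n --> \oo] --> Q ->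
  \prod_(i <- r n) (1 + x n i) @[n --> \oo] --> expR (S - 2^-1 * Q) /\
  \prod_(i <- r n) Num.max 0 (1 + x n i) @[n --> \oo] --> expR (S - 2^-1 * Q).
Proof.
move=> xd d0 Scv Qcv.
have sd0 : Num.sqrt (dn n) @[n --> \oo] --> 0.
  by rewrite -[X in _ --> X]sqrtr0; apply: continuous_cvg => //; exact: sqrt_continuous.
have half : \forall n \near \oo, forall i, i \in r n -> `|x n i| <= 2^-1 /\ `|x n i| <= Num.sqrt (dn n).
  have h : \forall n \near \oo, `|0 - Num.sqrt (dn n)| < 2^-1.
    by move/cvgrPdist_lt : sd0; apply.
  apply: filterS h => n; rewrite sub0r normrN ger0_norm ?sqrtr_ge0// => h i ir.
  have hx : `|x n i| <= Num.sqrt (dn n).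
    by rewrite -sqrtr_sqr; apply: ler_wsqrtr; exact: xd.
  by split=> //; apply: ltW; apply: le_lt_trans h.
have pos : \forall n \near \oo, forall i, i \in r n -> 0 < 1 + x n i.
  apply: filterS half => n h i ir; have [] := h i ir.
  by rewrite ler_norml => /andP[h1 _] _; lra.
have L : \sum_(i <- r n) ln (1 + x n i) @[n --> \oo] --> S - 2^-1 * Q.
  have diff : \sum_(i <- r n) ln (1 + x n i) -
      (\sum_(i <- r n) x n i - 2^-1 * \sum_(i <- r n) x n i ^+ 2) @[n --> \oo] --> 0.
    apply/norm_cvg0P.
    apply: (@squeeze_cvgr _ _ _ _ (fun=> 0) (fun n => 2 * Num.sqrt (dn n) * \sum_(i <- r n) x n i ^+ 2)).
    - apply: filterS half => n h; rewrite normr_ge0/=.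
      rewrite mulr_sumr -sumrB -sumrB mulr_sumr.
      apply: (le_trans (ler_norm_sum _ _ _)).
      rewrite big_seq [leRHS]big_seq; apply: ler_sum => i ir; have [h1 h2] := h i ir.
      rewrite opprB addrA addrAC; apply: (le_trans (ln_Taylor2 h1)).
      by rewrite ler_wpM2r ?sqr_ge0// ler_wpM2l.
    - exact: cvg_cst.
    - rewrite -[X in _ --> X](mul0r Q); apply: cvgM => //.
      by rewrite -[X in _ --> X](mulr0 2); apply: cvgMr.
  have Q2 : 2^-1 * \sum_(i <- r n) x n i ^+ 2 @[n --> \oo] --> 2^-1 * Q by apply: cvgMr.
  have : \sum_(i <- r n) ln (1 + x n i) -
      (\sum_(i <- r n) x n i - 2^-1 * \sum_(i <- r n) x n i ^+ 2) +
      (\sum_(i <- r n) x n i - 2^-1 * \sum_(i <- r n) x n i ^+ 2) @[n --> \oo] -->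
      0 + (S - 2^-1 * Q) by apply: cvgD => //; exact: cvgB.
  by rewrite add0r; under eq_cvg do rewrite subrK.
have E : \prod_(i <- r n) (1 + x n i) @[n --> \oo] --> expR (S - 2^-1 * Q).
  have : expR (\sum_(i <- r n) ln (1 + x n i)) @[n --> \oo] --> expR (S - 2^-1 * Q).
    by apply: continuous_cvg L; exact: continuous_expR.
  by apply: cvg_eq_near; apply: filterS pos => n h; rewrite prod_expR_ln.
split=> //; move: E; apply: cvg_eq_near; apply: filterS pos => n h.
by rewrite big_seq [RHS]big_seq; apply: eq_bigr => i ir; rewrite max_r// ltW// h.
Qed.

End WickProducts.

(** * Linear combinations of indicators of intervals starting at zero *)

Section StepFunctions.
Context {R : realType}.
Implicit Type s : seq (R * R).

(** The square of the L2 norm of span_indic s; see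
    integral_span_indic_sqr. *)
Definition norm2 s : R :=
  \sum_(p <- s) \sum_(p' <- s) p.1 * p'.1 * Num.min p.2 p'.2.
Definition span_bound s : R := \sum_(p <- s) `|p.1|.
(** An upper bound for the times in s that needs no case distinction on the
    list. *)
Definition span_end s : R := \sum_(p <- s) p.2.
Definition nonneg_times s := forall p, p \in s -> 0 <= p.2.

Lemma nonneg_times_cons p s : nonneg_times (p :: s) -> 0 <= p.2 /\ nonneg_times s.
Proof.
by move=> h; split=> [|q qs]; apply: h; rewrite inE ?eqxx// qs orbT.
Qed.

Lemma nonneg_times_cat s s' : nonneg_times s -> nonneg_times s' -> nonneg_times (s ++ s').
Proof. by move=> h h' p; rewrite mem_cat => /orP[/h|/h']. Qed.

Definition scale_span (c : R) (s : seq (R * R)) := [seq (c * p.1, p.2) | p <- s].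

Lemma norm2_scale c s : norm2 (scale_span c s) = c ^+ 2 * norm2 s.
Proof.
rewrite /norm2 big_map mulr_sumr; apply: eq_bigr => p _.
by rewrite big_map mulr_sumr; apply: eq_bigr => p' _ /=; ring.
Qed.

Lemma nonneg_times_scale c s : nonneg_times s -> nonneg_times (scale_span c s).
Proof. by move=> h p /mapP[q qs ->] /=; exact: h. Qed.

Lemma span_indic_cat s s' x : span_indic (s ++ s') x = span_indic s x + span_indic s' x.
Proof. by rewrite /span_indic big_cat. Qed.

Lemma span_indic_scale c s x : span_indic (scale_span c s) x = c * span_indic s x.
Proof. by rewrite /span_indic big_map mulr_sumr; apply: eq_bigr => p _ /=; rewrite mulrA. Qed.

Lemma span_integral_cat d (T : measurableType d) (B : R -> T -> R) s s' w :
  span_integral B (s ++ s') w = span_integral B s w + span_integral B s' w.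
Proof. by rewrite /span_integral big_cat. Qed.

Lemma span_integral_scale d (T : measurableType d) (B : R -> T -> R) c s w :
  span_integral B (scale_span c s) w = c * span_integral B s w.
Proof. by rewrite /span_integral big_map mulr_sumr; apply: eq_bigr => p _ /=; rewrite mulrA. Qed.

Lemma span_end_ge0 s : nonneg_times s -> 0 <= span_end s.
Proof. by move=> h; rewrite /span_end big_seq sumr_ge0. Qed.

Lemma le_span_end s p : nonneg_times s -> p \in s -> p.2 <= span_end s.
Proof.
move=> + ps; rewrite /span_end; elim: s ps => // q s IH; rewrite inE big_cons.
move=> /orP[/eqP ->|ps] /nonneg_times_cons[q0 h].
  by rewrite lerDl; exact: span_end_ge0.
by rewrite (le_trans (IH ps h))// lerDr.
Qed.

Lemma span_indic_bound s x : `|span_indic s x| <= span_bound s.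
Proof.
apply: (le_trans (ler_norm_sum _ _ _)); apply: ler_sum => p _.
rewrite normrM indicE; case: (_ \in _); rewrite ?normr1 ?normr0 ?mulr1 ?mulr0//.
Qed.

Lemma span_indic_sqr_le s x : span_indic s x ^+ 2 <= span_bound s ^+ 2.
Proof.
rewrite -(real_normK (num_real (span_indic s x))) lerXn2r ?nnegrE ?span_indic_bound//.
by apply: sumr_ge0.
Qed.

Lemma span_indic_sqr s x : span_indic s x ^+ 2 =
  \sum_(p <- s) \sum_(p' <- s) p.1 * p'.1 * \1_(`]0, Num.min p.2 p'.2]) x.
Proof.
rewrite expr2 /span_indic mulr_suml; apply: eq_bigr => p _.
rewrite mulr_sumr; apply: eq_bigr => p' _.
rewrite mulrACA; congr (_ * _).
rewrite !indicE -natrM mulnb; congr ((nat_of_bool _)%:R).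
apply/andP/idP.
  move=> [/set_mem + /set_mem]; rewrite /= !in_itv/= => /andP[h1 h2] /andP[_ h3].
  by apply/mem_set; rewrite /= in_itv/= h1 le_min h2 h3.
move=> /set_mem; rewrite /= in_itv/= le_min => /and3P[h1 h2 h3].
by split; apply/mem_set; rewrite /= in_itv/= h1.
Qed.

(** The indices i >= 1 with i / n <= t. *)
Definition walk_range (t : R) (n : nat) : seq nat := index_iota 1 (Num.truncn (n%:R * t)).+1.

Lemma mem_walk_range t n i : 0 <= t -> (0 < n)%N ->
  (i \in walk_range t n) = (0 < i%:R / n%:R :> R) && (i%:R / n%:R <= t).
Proof.
move=> t0 n0; rewrite /walk_range mem_index_iota ltnS.
rewrite truncn_ge_nat ?mulr_ge0//.
rewrite ler_pdivrMr ?ltr0n// [n%:R * _]mulrC; congr (_ && _).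
by rewrite pmulr_lgt0 ?invr_gt0 ltr0n.
Qed.

Lemma size_walk_range t n : size (walk_range t n) = Num.truncn (n%:R * t).
Proof. by rewrite size_iota subSS subn0. Qed.

Lemma sum_walk_range (V : nmodType) (t t' : R) n (F : nat -> V) : 0 <= t -> t <= t' -> (0 < n)%N ->
  \sum_(i <- walk_range t n) F i =
  \sum_(i <- walk_range t' n | (0 < i%:R / n%:R :> R) && (i%:R / n%:R <= t)) F i.
Proof.
move=> t0 tt' n0; rewrite -[RHS]big_filter.
have -> : walk_range t n = [seq i <- walk_range t' n | (0 < i%:R / n%:R :> R) && (i%:R / n%:R <= t)].
  apply: (irr_sorted_eq ltn_trans ltnn); first exact: iota_ltn_sorted.
    by apply: sorted_filter; [exact: ltn_trans|exact: iota_ltn_sorted].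
  move=> i; rewrite mem_filter !mem_walk_range//; last exact: le_trans tt'.
  by apply/idP/andP => [/andP[-> h]|[]//]; rewrite h (le_trans h tt').
by [].
Qed.

Lemma sum_indic_walk_range (t t' : R) n (F : nat -> R) : 0 <= t -> t <= t' -> (0 < n)%N ->
  \sum_(i <- walk_range t' n) \1_(`]0, t]) (i%:R / n%:R) * F i =
  \sum_(i <- walk_range t n) F i.
Proof.
move=> t0 tt' n0; rewrite (sum_walk_range _ t0 tt' n0) [RHS]big_mkcond; apply: eq_bigr => i _.
rewrite indicE.
have -> : (i%:R / n%:R \in [set` `]0, t]]) = (0 < i%:R / n%:R :> R) && (i%:R / n%:R <= t).
  by apply/idP/idP => [/set_mem|h]; [|apply/mem_set]; rewrite /= in_itv.
by case: ifP => _; rewrite ?mul1r ?mul0r.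
Qed.

Lemma cvg_truncn_ratio (t : R) : 0 <= t ->
  (Num.truncn (n%:R * t))%:R / n%:R @[n --> \oo] --> t.
Proof.
move=> t0; apply/cvgrPdist_lt => e e0.
exists (Num.truncn e^-1).+1 => // n /= hn.
have n0 : 0 < n%:R :> R by rewrite ltr0n; apply: leq_trans hn.
have en : e^-1 < n%:R by apply: (lt_le_trans (truncnS_gt _)); rewrite ler_nat.
have nt : 0 <= n%:R * t by rewrite mulr_ge0.
have /andP[h1 h2] := truncn_itv nt.
have -> : t - (Num.truncn (n%:R * t))%:R / n%:R = (n%:R * t - (Num.truncn (n%:R * t))%:R) / n%:R.
  by field; rewrite gt_eqF.
rewrite ger0_norm; last by rewrite divr_ge0 ?ler0n// subr_ge0.
rewrite ltr_pdivrMr// (@lt_trans _ _ 1)//; first by rewrite ltrBlDl -natr1 in h2 *.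
by move: en; rewrite invf_plt ?posrE// -div1r ltr_pdivrMr.
Qed.

(** Expanding the square reduces the Riemann sum to counting the grid points
    in ]0, t] for t the minimum of two times of s, and there are
    truncn (n t) of them. *)
Lemma cvg_riemann_norm2 s : nonneg_times s ->
  \sum_(i <- walk_range (span_end s) n) n%:R^-1 * span_indic s (i%:R / n%:R) ^+ 2
    @[n --> \oo] --> norm2 s.
Proof.
move=> s0; rewrite /norm2.
have E n : (0 < n)%N ->
   \sum_(i <- walk_range (span_end s) n) n%:R^-1 * span_indic s (i%:R / n%:R) ^+ 2 =
   \sum_(p <- s) \sum_(p' <- s) p.1 * p'.1 * ((Num.truncn (n%:R * Num.min p.2 p'.2))%:R / n%:R).
  move=> n0; under eq_bigr do rewrite span_indic_sqr mulr_sumr.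
  rewrite exchange_big big_seq [RHS]big_seq; apply: eq_bigr => p ps.
  under eq_bigr do rewrite mulr_sumr.
  rewrite exchange_big big_seq [RHS]big_seq; apply: eq_bigr => p' ps'.
  transitivity (\sum_(i <- walk_range (span_end s) n) \1_(`]0, Num.min p.2 p'.2]) (i%:R / n%:R) * (p.1 * p'.1 * n%:R^-1)).
    by apply: eq_bigr => i _; ring.
  rewrite sum_indic_walk_range//; last 2 first.
  - by rewrite le_min !s0.
  - by rewrite ge_min le_span_end.
  rewrite big_const_seq count_predT size_walk_range iter_addr_0 -mulr_natr; ring.
apply: cvg_eq_pos E _.
have cv (p : R) : 0 <= p -> (Num.truncn (n%:R * p))%:R / n%:R @[n --> \oo] --> p by exact: cvg_truncn_ratio.
apply: cvg_sum_seq => p ps; apply: cvg_sum_seq => p' ps'.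
by apply: cvgMr; apply: cv; rewrite le_min !s0.
Qed.

End StepFunctions.

(** * A law of large numbers for the squares of the steps *)

Section RandomWalk.
Context {R : realType} {d : measure_display} {T : measurableType d}.
Variable P : probability T R.
Local Notation Int := (Int P).
Local Notation Ex := (Ex P).
Local Notation L2 := (L2 P).

Lemma Ex_sqr_sum_orthogonal (I : eqType) (r : seq I) (Z : I -> T -> R) (a : I -> R) c :
  uniq r -> (forall i, L2 (Z i)) ->
  (forall i j, i \in r -> j \in r -> i != j -> Ex (fun w => Z i w * Z j w) = 0) ->
  (forall i, i \in r -> Ex (fun w => Z i w ^+ 2) <= c) ->
  Ex (fun w => (\sum_(i <- r) a i * Z i w) ^+ 2) <= \sum_(i <- r) a i ^+ 2 * c.
Proof.
move=> + LZ; elim: r => [_ _ _|i r IH].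
  rewrite big_nil; under [X in Ex X]eq_fun do rewrite big_nil expr0n/=.
  by rewrite Ex_cst.
move=> /= /andP[ir ur] orth cZ.
have LS : L2 (fun w => \sum_(j <- r) a j * Z j w) by apply: L2_sum => j; exact: L2Z.
have IS := L2_IntM (LZ i) LS.
have E0 : Ex (fun w => Z i w * \sum_(j <- r) a j * Z j w) = 0.
  under [X in Ex X = _]eq_fun do rewrite mulr_sumr.
  rewrite Ex_sum; last first.
    by move=> j _; apply: L2_IntM => //; exact: L2Z.
  rewrite big_seq big1// => j jr.
  under [X in Ex X = _]eq_fun do rewrite mulrCA.
  rewrite ExZ; last exact: L2_IntM.
  by rewrite orth ?mulr0// ?mem_head ?inE ?jr ?orbT//; apply: contraNneq ir => ->.
have -> : (fun w => (\sum_(j <- i :: r) a j * Z j w) ^+ 2) =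
  (fun w => a i ^+ 2 * Z i w ^+ 2 + 2 * a i * (Z i w * \sum_(j <- r) a j * Z j w) +
     (\sum_(j <- r) a j * Z j w) ^+ 2).
  by apply/funext => w; rewrite big_cons; ring.
have Ii := (LZ i).2.
rewrite ExD; [|by apply: IntD; exact: IntZ|exact: LS.2].
rewrite ExD; [|exact: IntZ|exact: IntZ].
rewrite !ExZ// E0 mulr0 addr0 big_cons; apply: lerD.
  by rewrite ler_wpM2l ?sqr_ge0// cZ// mem_head.
apply: IH => // [j k jr kr|j jr]; first by apply: orth; rewrite inE ?jr ?kr orbT.
by apply: cZ; rewrite inE jr orbT.
Qed.

(** The square is split at level k into a bounded part, whose fluctuations
    are controlled by orthogonality, and a rest that is small in mean. *)
Definition sq_low (k x : R) := Num.min (x ^+ 2) k.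
Definition sq_high (k x : R) := x ^+ 2 - sq_low k x.

Lemma measurable_sq_low k : measurable_fun setT (sq_low k).
Proof.
by apply: measurable_minr; [exact: measurable_funX|exact: measurable_cst].
Qed.

Lemma sq_low_ge0 k x : 0 <= k -> 0 <= sq_low k x.
Proof. by move=> k0; rewrite le_min sqr_ge0. Qed.

Lemma sq_low_le k x : sq_low k x <= k.
Proof. by rewrite ge_min lexx orbT. Qed.

Lemma sq_high_ge0 k x : 0 <= sq_high k x.
Proof. by rewrite subr_ge0 ge_min lexx. Qed.

Lemma measurable_sq_high k : measurable_fun setT (sq_high k).
Proof. by apply: measurable_funB; [exact: measurable_funX|exact: measurable_sq_low]. Qed.

Lemma sq_split k x : x ^+ 2 = sq_low k x + sq_high k x.
Proof. by rewrite /sq_high addrC subrK. Qed.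

Variables (B : R -> T -> R) (xi0 : T -> R) (xi : nat -> nat -> T -> R).
Hypothesis mB : forall t, mea (B t).
Hypothesis xi0_L2 : L2 xi0.
Hypothesis xi0_mean : Ex xi0 = 0.
Hypothesis xi0_sqr : Ex (fun w => xi0 w ^+ 2) = 1.
Hypothesis mxi : forall n i, mea (xi n i).
Hypothesis xi_indep : forall n : nat, (0 < n)%N ->
  mutually_independent P [set i : nat | (0 < i)%N] (xi n).
Hypothesis xi_law : forall n i : nat, (0 < n)%N -> (0 < i)%N -> same_law P (xi n i) xi0.
Hypothesis walk_cvg : forall t : R, 0 <= t ->
  cvg_in_probability P (fun n => scaled_walk n (xi n) t) (B t).

(* The level n^(1/4) tends to infinity while its square is small against n. *)
Let cut n : R := Num.sqrt (Num.sqrt n%:R).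

Let cut_ge0 n : 0 <= cut n. Proof. exact: sqrtr_ge0. Qed.

Let cut_sqr n : cut n ^+ 2 = Num.sqrt n%:R.
Proof. by rewrite sqr_sqrtr ?sqrtr_ge0. Qed.

Lemma cvg_invr_sqrt : (Num.sqrt n%:R)^-1 @[n --> \oo] --> (0 : R).
Proof.
have -> : (fun n => (Num.sqrt n%:R)^-1) = (fun n => Num.sqrt (n%:R^-1)) :> (nat -> R).
  by apply/funext => n; rewrite sqrtrV.
rewrite -[X in _ --> X]sqrtr0; apply: continuous_cvg; first exact: sqrt_continuous.
rewrite -(cvg_shiftS _ (nbhs (0:R))).
exact: cvg_harmonic.
Qed.

Let cut_ratio n : (0 < n)%N -> n%:R^-1 * cut n ^+ 2 = (Num.sqrt n%:R)^-1.
Proof.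
move=> n0; rewrite cut_sqr.
have n0' : 0 < n%:R :> R by rewrite ltr0n.
have s0 : 0 < Num.sqrt n%:R :> R by rewrite sqrtr_gt0.
have e : n%:R = Num.sqrt n%:R ^+ 2 :> R by rewrite sqr_sqrtr// ltW.
by rewrite [X in X^-1 * _]e; field; rewrite gt_eqF.
Qed.

Lemma Ex_sq_high_cvg0 : Ex (fun w => sq_high (cut n) (xi0 w)) @[n --> \oo] --> 0.
Proof.
have [_] : Int (fun=> 0) /\ Ex (fun w => sq_high (cut n) (xi0 w)) @[n --> \oo] --> Ex (fun=> 0).
  apply: (@DCT _ _ _ P _ _ (fun w => xi0 w ^+ 2)).
  - by move=> n; apply: mea_comp xi0_L2.1; exact: measurable_sq_high.
  - exact: mea_cst.
  - exact: xi0_L2.2.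
  - move=> n w; rewrite ger0_norm ?sq_high_ge0// gerBl; exact: sq_low_ge0.
  apply: aeW => w; apply: cvg_eq_near (cvg_cst 0).
  exists (Num.truncn ((xi0 w ^+ 2 ^+ 2) ^+ 2)).+1 => // n /= hn.
  have hx : (xi0 w ^+ 2 ^+ 2) ^+ 2 <= n%:R.
    by apply: (le_trans (ltW (truncnS_gt _))); rewrite ler_nat.
  rewrite /sq_high /sq_low min_l ?subrr// /cut.
  rewrite -[leLHS]ger0_norm ?sqr_ge0// -sqrtr_sqr; apply: ler_wsqrtr.
  by rewrite -[leLHS]ger0_norm ?sqr_ge0// -sqrtr_sqr; exact: ler_wsqrtr.
by rewrite Ex_cst.
Qed.

Section FixedStepFunction.
Variable s : seq (R * R).
Hypothesis s0 : nonneg_times s.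

Let rng n := walk_range (span_end s) n.
(** With x_i = wick_coef n i * xi n i the discrete Wick exponential of the
    step function encoded by s is the product of the 1 + x_i, and the candidate
    limit is wick_limit. *)
Definition wick_coef n i : R := (Num.sqrt n%:R)^-1 * span_indic s (i%:R / n%:R).
Definition wick_prod n (w : T) := \prod_(i <- rng n) (1 + wick_coef n i * xi n i w).
Definition wick_limit (w : T) := expR (span_integral B s w - 2^-1 * norm2 s).

Let rng_gt0 n i : i \in rng n -> (0 < i)%N.
Proof. by rewrite mem_index_iota => /andP[]. Qed.

Let rng_uniq n : uniq (rng n). Proof. exact: iota_uniq. Qed.

Let size_rng_ratio n : (0 < n)%N -> n%:R^-1 * (size (rng n))%:R <= span_end s.
Proof.
move=> n0; rewrite size_walk_range mulrC ler_pdivrMr ?ltr0n// mulrC.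
by rewrite truncn_le mulr_ge0// span_end_ge0.
Qed.

Lemma wick_coef_sqr n i : wick_coef n i ^+ 2 = n%:R^-1 * span_indic s (i%:R / n%:R) ^+ 2.
Proof. by rewrite exprMn exprVn sqr_sqrtr. Qed.

Let one_plus_sqr c : Int (fun w => (1 + c * xi0 w) ^+ 2) /\
  Ex (fun w => (1 + c * xi0 w) ^+ 2) = 1 + c ^+ 2.
Proof.
have L : L2 (fun w => 1 + c * xi0 w) by apply: L2D; [exact: L2_cst|exact: L2Z].
split; first exact: L.2.
have -> : (fun w => (1 + c * xi0 w) ^+ 2) = (fun w => 1 + (2 * c) * xi0 w + c ^+ 2 * xi0 w ^+ 2).
  by apply/funext => w; ring.
have I1 := L2_Int xi0_L2; have I2 := xi0_L2.2.
rewrite ExD; [|by apply: IntD; [exact: Int_cst|exact: IntZ]|exact: IntZ].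
rewrite ExD; [|exact: Int_cst|exact: IntZ].
by rewrite !ExZ// xi0_mean xi0_sqr Ex_cst mulr0 mulr1 addr0.
Qed.

(** By independence the second moment is the product of the
    1 + (wick_coef n i)^2, and 1 + u <= e^u. *)
Lemma wick_prod_L2 n : (0 < n)%N -> L2 (wick_prod n) /\
  Ex (fun w => wick_prod n w ^+ 2) <=
    expR (\sum_(i <- rng n) n%:R^-1 * span_indic s (i%:R / n%:R) ^+ 2).
Proof.
move=> n0.
have [|i|i y|i|] := @Ex_prod_indep _ _ _ P _ _ (xi n) xi0 (mxi n) xi0_L2.1 (xi_indep n0)
  (fun i i0 => xi_law n0 i0) (rng n) (fun i y => (1 + wick_coef n i * y) ^+ 2) (rng_uniq n).
- exact: rng_gt0.
- apply: measurable_funX; apply: measurable_funD => //; exact: measurable_funM.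
- exact: sqr_ge0.
- exact: (one_plus_sqr _).1.
have E : (fun w => \prod_(i <- rng n) (1 + wick_coef n i * xi n i w) ^+ 2) =
   (fun w => wick_prod n w ^+ 2).
  by apply/funext => w; rewrite prodrXl.
rewrite E => I1 ->; split.
  split=> //; apply: mea_prod => i; apply: meaD; first exact: mea_cst.
  by apply: meaM => //; exact: mea_cst.
rewrite expR_sum; apply: ler_prod => i _.
rewrite (one_plus_sqr _).2 addr_ge0 ?sqr_ge0//= wick_coef_sqr.
exact: expR_ge1Dx.
Qed.

(** The mean of the limit must be bounded from below, while Ex_prod_indep
    concerns nonnegative factors only. Taking positive parts keeps the limit and
    can only raise the mean 1 of each factor. *)
Definition wick_prod_pos n (w : T) :=
  \prod_(i <- rng n) Num.max 0 (1 + wick_coef n i * xi n i w).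

Lemma wick_prod_pos_L2 n : (0 < n)%N ->
  [/\ L2 (wick_prod_pos n),
   Ex (fun w => wick_prod_pos n w ^+ 2) <=
    expR (\sum_(i <- rng n) n%:R^-1 * span_indic s (i%:R / n%:R) ^+ 2) &
   1 <= Ex (wick_prod_pos n)].
Proof.
move=> n0; have [LW EW] := wick_prod_L2 n0.
have mm c : measurable_fun [set: R] (fun y => Num.max 0 (1 + c * y)).
  apply: measurable_maxr; first exact: measurable_cst.
  by apply: measurable_funD => //; exact: measurable_funM.
have mW : mea (wick_prod_pos n).
  by apply: mea_prod => i; exact: mea_comp (mm _) (mxi n i).
have le w : `|wick_prod_pos n w| <= `|wick_prod n w|.
  rewrite !normr_prod; apply: ler_prod => i _; rewrite normr_ge0/=.
  rewrite ger0_norm ?le_max ?lexx// ge_max normr_ge0/=; exact: ler_norm.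
have LP := L2_le mW le LW.
split=> //.
  apply: le_trans EW; apply: Ex_le; [exact: LP.2|exact: LW.2|] => w.
  by rewrite -(real_normK (num_real (wick_prod_pos n w)))
    -(real_normK (num_real (wick_prod n w))) lerXn2r ?nnegrE.
have Imax c : Int (fun w => Num.max 0 (1 + c * xi0 w)).
  have I1 : Int (fun w => `|1 + c * xi0 w|).
    apply: Int_norm; apply: IntD; first exact: Int_cst.
    by apply: IntZ; exact: L2_Int.
  apply: Int_le I1; first exact: mea_comp (mm c) xi0_L2.1.
  move=> w; rewrite ger0_norm ?le_max ?lexx// ge_max normr_ge0/=; exact: ler_norm.
have [|i|i y|i|] := @Ex_prod_indep _ _ _ P _ _ (xi n) xi0 (mxi n) xi0_L2.1 (xi_indep n0)
  (fun i i0 => xi_law n0 i0) (rng n) (fun i y => Num.max 0 (1 + wick_coef n i * y)) (rng_uniq n).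
- exact: rng_gt0.
- exact: mm.
- by rewrite le_max lexx.
- exact: Imax.
move=> _ ->; have h1 : \prod_(i <- rng n) (1 : R) = 1 by rewrite big1.
rewrite -[leLHS]h1; apply: ler_prod => i _; rewrite ler01/=.
have I1 := L2_Int xi0_L2.
have E1 : Ex (fun w => 1 + wick_coef n i * xi0 w) = 1.
  by rewrite ExD ?ExZ ?xi0_mean ?Ex_cst ?mulr0 ?addr0//; [exact: Int_cst|exact: IntZ].
rewrite -[leLHS]E1; apply: Ex_le => //; first by apply: IntD; [exact: Int_cst|exact: IntZ].
by move=> w; rewrite le_max lexx orbT.
Qed.

Let m n := Ex (fun w => sq_low (cut n) (xi0 w)).
(** The three errors low_dev, high_sum and walk_dev are nonnegative, tend to 0
    in mean, and when they tend to 0 at a point w the products converge at w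
    (cvg_wick_prod_pointwise). *)
Definition low_dev n (w : T) :=
  (\sum_(i <- rng n) n%:R^-1 * span_indic s (i%:R / n%:R) ^+ 2 * (sq_low (cut n) (xi n i w) - m n)) ^+ 2.
Definition high_sum n (w : T) :=
  \sum_(i <- rng n) (n%:R^-1 * span_bound s ^+ 2) * sq_high (cut n) (xi n i w).
Definition walk_dev n (w : T) :=
  \sum_(p <- s) Num.min 1 `|scaled_walk n (xi n) p.2 w - B p.2 w|.

Let mean n : 0 <= m n <= cut n.
Proof.
apply/andP; split; first by apply: Ex_ge0 => w; exact: sq_low_ge0.
rewrite -[leRHS](Ex_cst P); apply: Ex_le; [|exact: Int_cst|by move=> w; exact: sq_low_le].
apply: (Int_le _ _ (Int_cst P (cut n))).
  by apply: mea_comp xi0_L2.1; exact: measurable_sq_low.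
by move=> w; rewrite ger0_norm ?sq_low_ge0// sq_low_le.
Qed.

(** The centred truncated squares are orthogonal and bounded by cut n, so the
    mean of low_dev is of order n * (cut n / n)^2. *)
Lemma low_dev_cvg0 : (forall n, (0 < n)%N -> Int (low_dev n)) /\
  Ex (low_dev n) @[n --> \oo] --> 0.
Proof.
pose Z n i w := sq_low (cut n) (xi n i w) - m n.
have Zb n i w : `|Z n i w| <= cut n.
  have := sq_low_ge0 (xi n i w) (cut_ge0 n); have := sq_low_le (cut n) (xi n i w).
  have /andP[] := mean n; rewrite ler_norml /Z => ? ? ? ?; apply/andP; split; lra.
have mS n i : mea (fun w => sq_low (cut n) (xi n i w)).
  by apply: mea_comp => //; exact: measurable_sq_low.
have LZ n i : L2 (Z n i).
  apply: (L2_le _ _ (L2_cst P (cut n))); first by apply: meaB => //; exact: mea_cst.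
  by move=> w; rewrite [leRHS]ger0_norm.
have LS n : L2 (fun w => \sum_(i <- rng n) n%:R^-1 * span_indic s (i%:R / n%:R) ^+ 2 * Z n i w).
  by apply: L2_sum => i; exact: L2Z.
split=> [n n0|]; first exact: (LS n).2.
have bound n : (0 < n)%N -> Ex (low_dev n) <= span_end s * span_bound s ^+ 4 * (Num.sqrt n%:R)^-1.
  move=> n0; apply: (le_trans (@Ex_sqr_sum_orthogonal _ (rng n) (Z n)
      (fun i => n%:R^-1 * span_indic s (i%:R / n%:R) ^+ 2) (cut n ^+ 2) _ (LZ n) _ _)).
  - exact: rng_uniq.
  - move=> i j ir jr ij.
    have Il k : Int (fun w => sq_low (cut n) (xi n k w)).
      apply: (Int_le (mS n k) _ (Int_cst P (cut n))) => w.
      by rewrite ger0_norm ?sq_low_ge0// sq_low_le.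
    have El k : k \in rng n -> Ex (fun w => sq_low (cut n) (xi n k w)) = m n.
      move=> kr; apply: (@Ex_same_law _ _ _ P (xi n k) xi0 (sq_low (cut n)) _ _ _ _ _ _).2 => //.
      + exact: xi0_L2.1.
      + exact: xi_law n0 (rng_gt0 kr).
      + exact: measurable_sq_low.
      + by move=> x; exact: sq_low_ge0.
      apply: (Int_le _ _ (Int_cst P (cut n))).
        by apply: mea_comp xi0_L2.1; exact: measurable_sq_low.
      by move=> w; rewrite ger0_norm ?sq_low_ge0// sq_low_le.
    have [||k|k y|k|] := @Ex_prod_indep _ _ _ P _ _ (xi n) xi0 (mxi n) xi0_L2.1 (xi_indep n0)
      (fun i i0 => xi_law n0 i0) [:: i; j] (fun _ => sq_low (cut n)).
    + by rewrite /= inE ij.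
    + by move=> k; rewrite !inE => /orP[] /eqP ->; apply: rng_gt0; eassumption.
    + exact: measurable_sq_low.
    + exact: sq_low_ge0.
    + apply: (Int_le _ _ (Int_cst P (cut n))).
        by apply: mea_comp xi0_L2.1; exact: measurable_sq_low.
      by move=> w; rewrite ger0_norm ?sq_low_ge0// sq_low_le.
    rewrite big_cons big_seq1 -/(m n).
    under [X in Int X -> _]eq_fun do rewrite big_cons big_seq1.
    under [X in _ -> Ex X = _ -> _]eq_fun do rewrite big_cons big_seq1.
    move=> I2 E2.
    have -> : (fun w => Z n i w * Z n j w) = (fun w =>
      sq_low (cut n) (xi n i w) * sq_low (cut n) (xi n j w)
      - (m n * (sq_low (cut n) (xi n i w) + sq_low (cut n) (xi n j w)) - m n * m n)).
      by apply/funext => w; rewrite /Z; ring.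
    have I3 := IntD (Il i) (Il j).
    rewrite ExB//; last by apply: IntB; [exact: IntZ|exact: Int_cst].
    rewrite ExB; [|exact: IntZ|exact: Int_cst].
    by rewrite ExZ// ExD// !El// Ex_cst E2; ring.
  - move=> i _; rewrite -[leRHS](Ex_cst P); apply: Ex_le; [exact: (LZ n i).2|exact: Int_cst|].
    by move=> w; rewrite -(real_normK (num_real (Z n i w))) lerXn2r ?nnegrE.
  apply: (@le_trans _ _ (\sum_(i <- rng n) (n%:R^-1 * span_bound s ^+ 2) ^+ 2 * cut n ^+ 2)).
    apply: ler_sum => i _; rewrite ler_wpM2r ?sqr_ge0//.
    have hb : n%:R^-1 * span_indic s (i%:R / n%:R) ^+ 2 <= n%:R^-1 * span_bound s ^+ 2.
      by rewrite ler_wpM2l ?invr_ge0 ?span_indic_sqr_le.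
    by rewrite lerXn2r ?nnegrE// mulr_ge0 ?invr_ge0// sqr_ge0.
  rewrite big_const_seq count_predT iter_addr_0 -[_ *+ size _]mulr_natr.
  have -> : (n%:R^-1 * span_bound s ^+ 2) ^+ 2 * cut n ^+ 2 * (size (rng n))%:R =
    (n%:R^-1 * (size (rng n))%:R) * (span_bound s ^+ 4 * (n%:R^-1 * cut n ^+ 2)) by ring.
  rewrite cut_ratio// -[leRHS]mulrA ler_wpM2r ?size_rng_ratio//.
  by rewrite mulr_ge0 ?invr_ge0 ?sqrtr_ge0// exprn_even_ge0.
apply: (@squeeze_cvgr _ _ _ _ (fun=> 0)
   (fun n => span_end s * span_bound s ^+ 4 * (Num.sqrt n%:R)^-1)).
- exists 1%N => // n /= n0; rewrite bound// andbT; apply: Ex_ge0 => w; exact: sqr_ge0.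
- exact: cvg_cst.
- rewrite -[X in _ --> X](mulr0 (span_end s * span_bound s ^+ 4)).
  by apply: cvgMr; exact: cvg_invr_sqrt.
Qed.

Lemma high_sum_cvg0 : (forall n, (0 < n)%N -> Int (high_sum n)) /\
  Ex (high_sum n) @[n --> \oo] --> 0.
Proof.
have I0 n : Int (fun w => sq_high (cut n) (xi0 w)).
  apply: Int_le xi0_L2.2; first by apply: mea_comp xi0_L2.1; exact: measurable_sq_high.
  by move=> w; rewrite ger0_norm ?sq_high_ge0// gerBl; exact: sq_low_ge0.
have Ih n i : (0 < n)%N -> i \in rng n -> Int (fun w => sq_high (cut n) (xi n i w)) /\
   Ex (fun w => sq_high (cut n) (xi n i w)) = Ex (fun w => sq_high (cut n) (xi0 w)).
  move=> n0 ir; apply: Ex_same_law => //.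
  - exact: xi0_L2.1.
  - exact: xi_law n0 (rng_gt0 ir).
  - exact: measurable_sq_high.
  - by move=> x; exact: sq_high_ge0.
have Is n i : (0 < n)%N -> i \in rng n ->
    Int (fun w => (n%:R^-1 * span_bound s ^+ 2) * sq_high (cut n) (xi n i w)).
  by move=> n0 ir; apply: IntZ; exact: (Ih n i n0 ir).1.
split=> [n n0|]; first by apply: Int_sum => i ir; exact: Is.
apply: (@squeeze_cvgr _ _ _ _ (fun=> 0)
   (fun n => span_end s * span_bound s ^+ 2 * Ex (fun w => sq_high (cut n) (xi0 w)))).
- exists 1%N => // n /= n0; apply/andP; split.
    by apply: Ex_ge0 => w; apply: sumr_ge0 => i _; rewrite mulr_ge0 ?sq_high_ge0// mulr_ge0 ?invr_ge0// sqr_ge0.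
  rewrite /high_sum Ex_sum; last by move=> i ir; exact: Is.
  rewrite (eq_big_seq (fun=> n%:R^-1 * span_bound s ^+ 2 * Ex (fun w => sq_high (cut n) (xi0 w)))); last first.
    by move=> i ir; have [I1 E1] := Ih n i n0 ir; rewrite ExZ// E1.
  rewrite big_const_seq count_predT iter_addr_0 -[_ *+ size _]mulr_natr.
  rewrite [leLHS](_ : _ = (n%:R^-1 * (size (rng n))%:R) * (span_bound s ^+ 2 * Ex (fun w => sq_high (cut n) (xi0 w)))); last by ring.
  rewrite -[leRHS]mulrA ler_wpM2r ?size_rng_ratio// mulr_ge0 ?sqr_ge0//.
  by apply: Ex_ge0 => w; exact: sq_high_ge0.
- exact: cvg_cst.
- rewrite -[X in _ --> X](mulr0 (span_end s * span_bound s ^+ 2)).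
  by apply: cvgMr; exact: Ex_sq_high_cvg0.
Qed.

Lemma mea_scaled_walk n t : mea (scaled_walk n (xi n) t).
Proof.
apply: meaM; first exact: mea_cst.
by apply: measurable_sum => i; exact: mxi.
Qed.

Lemma walk_dev_cvg0 : (forall n, Int (walk_dev n)) /\
  Ex (walk_dev n) @[n --> \oo] --> 0.
Proof.
have I1 n t : Int (fun w => Num.min 1 `|scaled_walk n (xi n) t w - B t w|).
  apply: (Int_le _ _ (Int_cst P 1)).
    apply: (measurable_minr (mea_cst 1)); apply: mea_norm; apply: meaB => //.
    exact: mea_scaled_walk.
  by move=> w; rewrite ger0_norm ?le_min ?ler01 ?normr_ge0// ge_min lexx.
split=> [n|]; first by apply: Int_sum.
have -> : (fun n => Ex (walk_dev n)) = (fun n =>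
  \sum_(p <- s) Ex (fun w => Num.min 1 `|scaled_walk n (xi n) p.2 w - B p.2 w|)).
  by apply/funext => n; rewrite Ex_sum.
have z : \sum_(p <- s) (0 : R) = 0 by rewrite big1.
rewrite -[X in _ --> X]z.
apply: cvg_sum_seq => p ps.
apply: cvg_in_probability_Ex => //; first by move=> n; exact: mea_scaled_walk.
by apply: walk_cvg; exact: s0.
Qed.

End FixedStepFunction.
End RandomWalk.

(** * Mean square convergence of discrete Wick exponentials *)

Section WickLimit.
Context {R : realType} {d : measure_display} {T : measurableType d}.
Variable P : probability T R.
Local Notation Int := (Int P).
Local Notation Ex := (Ex P).
Local Notation L2 := (L2 P).

Variables (B : R -> T -> R) (xi0 : T -> R) (xi : nat -> nat -> T -> R).
Hypothesis mB : forall t, mea (B t).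
Hypothesis xi0_L2 : L2 xi0.
Hypothesis xi0_mean : Ex xi0 = 0.
Hypothesis xi0_sqr : Ex (fun w => xi0 w ^+ 2) = 1.
Hypothesis mxi : forall n i, mea (xi n i).
Hypothesis xi_indep : forall n : nat, (0 < n)%N ->
  mutually_independent P [set i : nat | (0 < i)%N] (xi n).
Hypothesis xi_law : forall n i : nat, (0 < n)%N -> (0 < i)%N -> same_law P (xi n i) xi0.
Hypothesis walk_cvg : forall t : R, 0 <= t ->
  cvg_in_probability P (fun n => scaled_walk n (xi n) t) (B t).

Let cut n : R := Num.sqrt (Num.sqrt n%:R).

Lemma ler_term_sum (I : eqType) (r : seq I) (F : I -> R) i :
  (forall j, 0 <= F j) -> i \in r -> F i <= \sum_(j <- r) F j.
Proof. by move=> F0 ir; rewrite (big_rem i)//= lerDl sumr_ge0. Qed.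

Lemma cvg_min1 (u : nat -> R) : Num.min 1 `|u n| @[n --> \oo] --> 0 -> u n @[n --> \oo] --> 0.
Proof.
move=> /cvgrPdist_lt h; apply/cvgrPdist_lt => e e0.
have e1 : 0 < Num.min e 1 by rewrite lt_min e0 ltr01.
apply: filterS (h _ e1) => n; rewrite !sub0r !normrN.
rewrite ger0_norm; last by rewrite le_min ler01 normr_ge0.
rewrite lt_min !gt_min => /andP[/orP[|//] h1 h2].
by move: h2; rewrite ltxx/= => h2; apply: lt_trans h1.
Qed.

Section FixedStepFunction.
Variable s : seq (R * R).
Hypothesis s0 : nonneg_times s.

Let rng n := walk_range (span_end s) n.

Lemma sum_wick_coef n w : (0 < n)%N ->
  \sum_(i <- rng n) wick_coef s n i * xi n i w =
  \sum_(p <- s) p.1 * scaled_walk n (xi n) p.2 w.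
Proof.
move=> n0; rewrite /wick_coef /span_indic.
under eq_bigr do rewrite mulr_sumr mulr_suml.
rewrite exchange_big big_seq [RHS]big_seq; apply: eq_bigr => p ps.
rewrite /scaled_walk mulrCA -[index_iota _ _]/(walk_range p.2 n).
rewrite -(sum_indic_walk_range _ (s0 ps) (le_span_end s0 ps) n0) !mulr_sumr.
by apply: eq_bigr => i _; ring.
Qed.

(** The sum of the x_i is a linear combination of values of the walk, and
    the sum of the x_i^2 is close to the Riemann sum of span_indic s ^ 2. The
    largest x_i^2 is at most its truncated part, of order cut n / n, plus
    high_sum. *)
Lemma cvg_wick_prod_pointwise (h : nat -> nat) w :
  (forall n, (0 < h n)%N) -> (forall n, (n <= h n)%N) ->
  low_dev P xi0 xi s (h n) w @[n --> \oo] --> 0 ->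
  high_sum xi s (h n) w @[n --> \oo] --> 0 ->
  walk_dev B xi s (h n) w @[n --> \oo] --> 0 ->
  wick_prod xi s (h n) w @[n --> \oo] --> wick_limit B s w /\
  wick_prod_pos xi s (h n) w @[n --> \oo] --> wick_limit B s w.
Proof.
move=> h0 hn low high walk.
have hsum n i : 0 <= n%:R^-1 * span_bound s ^+ 2 * sq_high (cut n) (xi n i w).
  by rewrite mulr_ge0 ?sq_high_ge0// mulr_ge0 ?invr_ge0// sqr_ge0.
have gM x := span_indic_sqr_le s x.
have cut0 n : 0 <= cut n by exact: sqrtr_ge0.
apply: (@cvg_wick_product _ (fun n => rng (h n)) (fun n i => wick_coef s (h n) i * xi (h n) i w)
  (fun n => span_bound s ^+ 2 * ((h n)%:R^-1 * cut (h n)) + high_sum xi s (h n) w)).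
- move=> n i ir; rewrite exprMn wick_coef_sqr (sq_split (cut (h n)) (xi _ _ _)) mulrDr.
  apply: lerD.
    rewrite -mulrA mulrCA; apply: ler_pM => //.
    + exact: sqr_ge0.
    + by rewrite mulr_ge0 ?invr_ge0// sq_low_ge0.
    + by rewrite ler_wpM2l ?invr_ge0// sq_low_le.
  apply: le_trans (ler_term_sum (hsum (h n)) ir).
  by rewrite ler_wpM2r ?sq_high_ge0// ler_wpM2l ?invr_ge0.
- rewrite -[X in _ --> X](addr0 0); apply: cvgD => //.
  rewrite -[X in _ --> X](mulr0 (span_bound s ^+ 2)); apply: cvgMr.
  apply: (cvg_extracted (u := fun n => n%:R^-1 * cut n) hn).
  apply: (@squeeze_cvgr _ _ _ _ (fun=> 0) (fun n => n%:R^-1 + (Num.sqrt n%:R)^-1)).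
  + exists 1%N => // n /= n0; rewrite mulr_ge0 ?invr_ge0//=.
    (* cut n / n <= (1 + cut n ^ 2) / n = 1 / n + 1 / sqrt n *)
    have c1 : cut n <= 1 + cut n ^+ 2 by have := sqr_ge0 (cut n - 1); have := cut0 n; nra.
    apply: (@le_trans _ _ (n%:R^-1 * (1 + cut n ^+ 2))); first by rewrite ler_wpM2l ?invr_ge0.
    rewrite mulrDr mulr1 lerD2l /cut sqr_sqrtr ?sqrtr_ge0//.
    have n0' : 0 < n%:R :> R by rewrite ltr0n.
    have sn0 : 0 < Num.sqrt n%:R :> R by rewrite sqrtr_gt0.
    have e : n%:R = Num.sqrt n%:R ^+ 2 :> R by rewrite sqr_sqrtr// ltW.
    rewrite [X in X^-1 * _]e le_eqVlt; apply/orP; left; apply/eqP.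
    by field; rewrite gt_eqF.
  + exact: cvg_cst.
  + rewrite -[X in _ --> X](addr0 0); apply: cvgD; last exact: cvg_invr_sqrt.
    by rewrite -(cvg_shiftS _ (nbhs (0:R))); exact: cvg_harmonic.
- have E : \sum_(p <- s) p.1 * scaled_walk (h n) (xi (h n)) p.2 w @[n --> \oo] --> span_integral B s w.
    apply: cvg_sum_seq => p ps; apply: cvgMr.
    apply: cvg_of_sub0; apply: cvg_min1.
    apply: (@squeeze_cvgr _ _ _ _ (fun=> 0) (fun n => walk_dev B xi s (h n) w)) => //.
      apply: nearW => n; apply/andP; split; first by rewrite le_min ler01 normr_ge0.
      apply: (@ler_term_sum _ s (fun p => Num.min 1 `|scaled_walk (h n) (xi (h n)) p.2 w - B p.2 w|)) => //.
    exact: cvg_cst.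
  by move: E; apply: cvg_eq_near; apply: nearW => n; rewrite sum_wick_coef.
- pose G n i := n%:R^-1 * span_indic s (i%:R / n%:R) ^+ 2.
  pose mm n := Ex (fun w => sq_low (cut n) (xi0 w)).
  have Gcv : \sum_(i <- rng (h n)) G (h n) i @[n --> \oo] --> norm2 s.
    by apply: (cvg_extracted (u := fun n => \sum_(i <- rng n) G n i) hn); exact: cvg_riemann_norm2.
  have mcv : mm (h n) @[n --> \oo] --> (1 : R).
    apply: (cvg_extracted (u := mm) hn).
    have -> : mm = (fun n => 1 - Ex (fun w => sq_high (cut n) (xi0 w))).
      apply/funext => n.
      have Il : Int (fun w => sq_low (cut n) (xi0 w)).
        apply: (Int_le _ _ (Int_cst P (cut n))).
          by apply: mea_comp xi0_L2.1; exact: measurable_sq_low.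
        by move=> v; rewrite ger0_norm ?sq_low_ge0// sq_low_le.
      rewrite [X in _ - X]ExB ?xi0_sqr//; last exact: xi0_L2.2.
      by rewrite /mm; ring.
    rewrite -[X in _ --> X](subr0 1); apply: cvgB; first exact: cvg_cst.
    exact: Ex_sq_high_cvg0.
  have lowcv : \sum_(i <- rng (h n)) G (h n) i * (sq_low (cut (h n)) (xi (h n) i w) - mm (h n)) @[n --> \oo] --> 0.
    exact: cvg_sqr0.
  have highcv : \sum_(i <- rng (h n)) G (h n) i * sq_high (cut (h n)) (xi (h n) i w) @[n --> \oo] --> 0.
    apply: (@squeeze_cvgr _ _ _ _ (fun=> 0) (fun n => high_sum xi s (h n) w)) => //; last exact: cvg_cst.
    apply: nearW => n; apply/andP; split.
      by apply: sumr_ge0 => i _; rewrite mulr_ge0 ?sq_high_ge0// mulr_ge0 ?invr_ge0// sqr_ge0.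
    by apply: ler_sum => i _; rewrite ler_wpM2r ?sq_high_ge0// ler_wpM2l ?invr_ge0.
  have : \sum_(i <- rng (h n)) G (h n) i * (sq_low (cut (h n)) (xi (h n) i w) - mm (h n)) +
      mm (h n) * \sum_(i <- rng (h n)) G (h n) i +
      \sum_(i <- rng (h n)) G (h n) i * sq_high (cut (h n)) (xi (h n) i w) @[n --> \oo]
       --> 0 + 1 * norm2 s + 0.
    by apply: cvgD => //; apply: cvgD => //; exact: cvgM.
  rewrite add0r mul1r addr0; apply: cvg_eq_near; apply: nearW => n.
  rewrite mulr_sumr -!big_split/=; apply: eq_bigr => i _.
  by rewrite exprMn wick_coef_sqr -/(G _ _) (sq_split (cut (h n)) (xi _ _ _)); ring.
Qed.

Lemma wick_prod_extraction (h : nat -> nat) : (forall n, (n <= h n)%N) ->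
  exists k, [/\ forall n, (n <= k n)%N, forall n, (0 < h (k n))%N,
    {ae P, forall w, wick_prod xi s (h (k n)) w @[n --> \oo] --> wick_limit B s w} &
    {ae P, forall w, wick_prod_pos xi s (h (k n)) w @[n --> \oo] --> wick_limit B s w}].
Proof.
move=> hn.
have [I1 E1] := @low_dev_cvg0 _ _ _ P xi0 xi xi0_L2 mxi xi_indep xi_law s s0.
have [I2 E2] := @high_sum_cvg0 _ _ _ P xi0 xi xi0_L2 mxi xi_law s s0.
have [I3 E3] := @walk_dev_cvg0 _ _ _ P B xi mB mxi walk_cvg s s0.
pose f n w := low_dev P xi0 xi s n w + high_sum xi s n w + walk_dev B xi s n w.
pose h1 n := h n.+1.
have h1n n : (n <= h1 n)%N by apply: leq_trans (hn n.+1).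
have h10 n : (0 < h1 n)%N by apply: leq_trans (hn n.+1).
have l0 n w : 0 <= low_dev P xi0 xi s n w by exact: sqr_ge0.
have hi0 n w : 0 <= high_sum xi s n w.
  by apply: sumr_ge0 => i _; rewrite mulr_ge0 ?sq_high_ge0// mulr_ge0 ?invr_ge0// sqr_ge0.
have w0 n w : 0 <= walk_dev B xi s n w.
  by apply: sumr_ge0 => i _; rewrite le_min ler01 normr_ge0.
have [||| k [kn kcv]] := @ae_extraction _ _ _ P (fun n => f (h1 n)).
- by move=> n; apply: IntD => //; apply: IntD; [exact: I1|exact: I2].
- by move=> n w; rewrite addr_ge0// addr_ge0.
- apply: (cvg_extracted (u := fun n => Ex (f n)) h1n).
  apply: (cvg_eq_pos (v := fun n => Ex (low_dev P xi0 xi s n) + Ex (high_sum xi s n) + Ex (walk_dev B xi s n))).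
    move=> n n0; rewrite ExD//; last by apply: IntD; [exact: I1|exact: I2].
    by rewrite ExD//; [exact: I1|exact: I2].
  rewrite -[X in _ --> X](addr0 0); apply: cvgD => //.
  by rewrite -[X in _ --> X](addr0 0); apply: cvgD.
have H : {ae P, forall w,
   wick_prod xi s (h1 (k n)) w @[n --> \oo] --> wick_limit B s w /\
   wick_prod_pos xi s (h1 (k n)) w @[n --> \oo] --> wick_limit B s w}.
  apply: filterS kcv => w fcv.
  have sq (g : nat -> R) : (forall n, 0 <= g n) -> (forall n, g n <= f (h1 (k n)) w) ->
      g n @[n --> \oo] --> 0.
    move=> g0 gf; apply: (@squeeze_cvgr _ _ _ _ (fun=> 0) (fun n => f (h1 (k n)) w)) => //.
      by apply: nearW => n; rewrite g0 gf.
    exact: cvg_cst.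
  apply: (@cvg_wick_prod_pointwise (fun n => h1 (k n))) => //.
  - by move=> n; exact: leq_trans (kn n) (h1n _).
  - by apply: sq => // n; rewrite /f -addrA lerDl addr_ge0.
  - by apply: sq => // n; rewrite /f addrAC lerDr addr_ge0.
  - by apply: sq => // n; rewrite /f lerDr addr_ge0.
exists (fun n => (k n).+1); split => //.
- by move=> n; apply: leq_trans (kn n) _.
- by move=> n; exact: h10.
- by apply: filterS H => w [].
- by apply: filterS H => w [].
Qed.

End FixedStepFunction.

Lemma mea_span_integral s : mea (span_integral B s).
Proof. by apply: measurable_sum => p; apply: meaM => //; exact: mea_cst. Qed.

Lemma mea_wick_limit s : mea (wick_limit B s).
Proof.
apply: mea_comp; first exact: measurable_expR.
by apply: meaB; [exact: mea_span_integral|exact: mea_cst].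
Qed.

Let riemann (s : seq (R * R)) n := \sum_(i <- walk_range (span_end s) n) n%:R^-1 * span_indic s (i%:R / n%:R) ^+ 2.

Let cvg_exp_riemann s : nonneg_times s -> expR (riemann s n) @[n --> \oo] --> expR (norm2 s).
Proof.
by move=> s0; apply: continuous_cvg; [exact: continuous_expR|exact: cvg_riemann_norm2].
Qed.

Let exp_riemann_bound s : nonneg_times s -> exists C, forall n, expR (riemann s n) <= C.
Proof.
move=> s0; have /cvg_seq_bounded [M [Mr HM]] : cvgn (fun n => expR (riemann s n)).
  by apply/cvg_ex; eexists; exact: cvg_exp_riemann.
exists (M + 1) => n; apply: le_trans (ler_norm _) _; apply: HM => //.
by rewrite ltrDl.
Qed.

(** The positive parts are bounded in L2 and have mean at least 1, and both
    properties pass to the almost sure limit. *)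
Let wick_limit_Ex s : nonneg_times s -> L2 (wick_limit B s) /\ 1 <= Ex (wick_limit B s).
Proof.
move=> s0; have [C HC] := exp_riemann_bound s0.
have [k [kn k0 _ cv]] := wick_prod_extraction s0 (h := id) (fun n => leqnn n).
have WP n := @wick_prod_pos_L2 _ _ _ P xi0 xi xi0_L2 xi0_mean xi0_sqr mxi xi_indep xi_law s (k n) (k0 n).
have [L _ E] := @cvg_Ex_of_ae _ _ _ P (fun n => wick_prod_pos xi s (k n)) (wick_limit B s) C
  (fun n => let: And3 a _ _ := WP n in a) (mea_wick_limit s) cv
  (fun n => let: And3 _ b _ := WP n in le_trans b (HC _)).
split=> //; rewrite -(cvg_lim _ E)//; apply: limr_ge; first by apply/cvg_ex; eexists; exact: E.
by apply: nearW => n; case: (WP n).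
Qed.

Lemma wick_limit_L2 s : nonneg_times s -> L2 (wick_limit B s).
Proof. by move=> /wick_limit_Ex []. Qed.

(** Squaring doubles the exponent: the square of the exponential of s is
    e^(norm2 s) times the exponential of 2 s, whose mean is at least 1. *)
Lemma Ex_wick_limit_sqr_ge s : nonneg_times s ->
  expR (norm2 s) <= Ex (fun w => wick_limit B s w ^+ 2).
Proof.
move=> s0; have s20 := nonneg_times_scale (c := 2) s0.
have [L2s E1] := wick_limit_Ex s20.
have -> : (fun w => wick_limit B s w ^+ 2) =
    (fun w => expR (norm2 s) * wick_limit B (scale_span 2 s) w).
  apply/funext => w; rewrite /wick_limit -expRM_natl -expRD span_integral_scale norm2_scale.
  by congr expR; field.
rewrite ExZ; last exact: L2_Int.
by rewrite ler_peMr// expR_ge0.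
Qed.

(** Along extractions the convergence is almost sure, and the second moments
    are at most e^(Riemann sum), which tends to e^(norm2 s), at most the second
    moment of the limit: no mass is lost. *)
Theorem wick_prod_cvg_L2 s : nonneg_times s ->
  Ex (fun w => (wick_prod xi s n w - wick_limit B s w) ^+ 2) @[n --> \oo] --> 0.
Proof.
move=> s0; apply: cvg_of_extractions => h hn.
have [k [kn k0 cv _]] := wick_prod_extraction s0 hn.
exists k; split=> //.
have WP n := @wick_prod_L2 _ _ _ P xi0 xi xi0_L2 xi0_mean xi0_sqr mxi xi_indep xi_law s (h (k n)) (k0 n).
apply: (@cvg_L2_of_ae _ _ _ P _ _ (fun n => expR (riemann s (h (k n)))) (expR (norm2 s))) => //.
- by move=> n; exact: (WP n).1.
- exact: wick_limit_L2.
- by move=> n; exact: (WP n).2.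
- apply: (cvg_extracted (u := fun n => expR (riemann s n)) (h := fun n => h (k n))).
    by move=> n; exact: leq_trans (kn n) (hn _).
  exact: cvg_exp_riemann.
- exact: Ex_wick_limit_sqr_ge.
Qed.

Lemma expR_span_integral_L2 s : nonneg_times s -> L2 (fun w => expR (span_integral B s w)).
Proof.
move=> s0; have := L2Z (expR (2^-1 * norm2 s)) (wick_limit_L2 s0).
by congr L2; apply/funext => w; rewrite /wick_limit -expRD addrC subrK.
Qed.

Lemma Ex_wick_limit_sqr_le s : nonneg_times s ->
  Ex (fun w => wick_limit B s w ^+ 2) <= expR (norm2 s).
Proof.
move=> s0; apply/ler_addgt0Pr => e e0.
have /cvgrPdist_lt/(_ _ e0) [N _ HN] := cvg_exp_riemann s0.
have [|k [kn k0 cv _]] := wick_prod_extraction s0 (h := fun n => maxn N n).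
  by move=> n; exact: leq_maxr.
have WP n := @wick_prod_L2 _ _ _ P xi0 xi xi0_L2 xi0_mean xi0_sqr mxi xi_indep xi_law s (maxn N (k n)) (k0 n).
have [||||] := @cvg_Ex_of_ae _ _ _ P (fun n => wick_prod xi s (maxn N (k n))) (wick_limit B s) (expR (norm2 s) + e).
- by move=> n; exact: (WP n).1.
- exact: mea_wick_limit.
- exact: cv.
- move=> n; apply: (le_trans (WP n).2).
  have := HN (maxn N (k n)) (leq_maxl _ _) => /=.
  rewrite ltr_distl => /andP[h _]; rewrite /riemann in h; lra.
by [].
Qed.

(** The square of the exponential of s / 2 is a constant times
    e^(span_integral s), so the second moment bound of the limit bounds the
    exponential moment. *)
Lemma Ex_expR_span_integral s : nonneg_times s ->
  Ex (fun w => expR (span_integral B s w)) <= expR (2^-1 * norm2 s).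
Proof.
move=> s0; have h0 := nonneg_times_scale (c := 2^-1) s0.
have := Ex_wick_limit_sqr_le h0.
have -> : (fun w => wick_limit B (scale_span 2^-1 s) w ^+ 2) =
    (fun w => expR (- (4^-1 * norm2 s)) * expR (span_integral B s w)).
  apply/funext => w; rewrite /wick_limit -expRM_natl -expRD span_integral_scale norm2_scale.
  by congr expR; field.
rewrite ExZ; last exact/L2_Int/expR_span_integral_L2.
rewrite expRN ler_pdivrMl ?expR_gt0// -expRD norm2_scale.
by move=> /le_trans; apply; rewrite ler_expR le_eqVlt; apply/orP; left; apply/eqP; field.
Qed.

(** Bernoulli's inequality (1 + x/4)^4 <= e^x suffices for this constant. *)
Lemma sqr_le_cosh (x : R) : x ^+ 2 <= 2 * (expR x + expR (- x) - 2).
Proof.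
wlog x0 : x / 0 <= x.
  move=> H; have [/H//|/ltW x0] := leP 0 x.
  by rewrite -sqrrN; have := H (- x); rewrite opprK oppr_ge0 [expR x + _]addrC; apply.
pose y := 4^-1 * x; have -> : x = 4%:R * y by rewrite /y; field.
have y0 : 0 <= y by rewrite mulr_ge0.
have e4 (z : R) : -1 <= z -> (1 + z) ^+ 4 <= expR (4%:R * z).
  move=> z1; rewrite expRM_natl lerXn2r ?nnegrE ?expR_ge0 ?expR_ge1Dx//; lra.
have h1 := e4 y (le_trans (ltW (ltrN10 _)) y0).
have [y1|y1] := leP y 1.
  have := e4 (- y); rewrite mulrN lerN2 => /(_ y1) h2.
  have : 0 <= y ^+ 2 by exact: sqr_ge0.
  have : 0 <= y ^+ 4 by rewrite exprn_ge0.
  have E : (1 + y) ^+ 4 + (1 - y) ^+ 4 = 2 + 12 * y ^+ 2 + 2 * y ^+ 4 by ring.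
  have -> : (4 * y) ^+ 2 = 16 * y ^+ 2 by ring.
  lra.
have h2 := expR_ge0 (- (4 * y)).
have E : (1 + y) ^+ 4 = 1 + 4 * y + 6 * y ^+ 2 + 4 * y ^+ 3 + y ^+ 4 by ring.
have h3 : y ^+ 2 <= y ^+ 3 by rewrite [leRHS]exprSr ler_peMr ?sqr_ge0// ltW.
have h4 : 0 <= y ^+ 4 by rewrite exprn_ge0.
have -> : (4 * y) ^+ 2 = 16 * y ^+ 2 by ring.
have : 0 <= y ^+ 2 by exact: sqr_ge0.
lra.
Qed.

(** What matters is that the bound vanishes with norm2 s: it makes
    s |-> span_integral B s continuous, hence the Wiener integral of a step
    function unique. *)
Lemma Ex_span_integral_sqr s : nonneg_times s -> L2 (span_integral B s) /\
  Ex (fun w => span_integral B s w ^+ 2) <= 4 * (expR (2^-1 * norm2 s) - 1).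
Proof.
move=> s0; have n0 := nonneg_times_scale (c := -1) s0.
have e1 := L2_Int (expR_span_integral_L2 s0); have e2 := L2_Int (expR_span_integral_L2 n0).
have E1 := Ex_expR_span_integral s0; have E2 := Ex_expR_span_integral n0.
rewrite norm2_scale sqrrN expr1n mul1r in E2.
have I0 : Int (fun w => expR (span_integral B s w) + expR (span_integral B (scale_span (-1) s) w) - 2).
  by apply: IntB; [exact: IntD|exact: Int_cst].
have I := IntZ 2 I0.
have le w : span_integral B s w ^+ 2 <=
    2 * (expR (span_integral B s w) + expR (span_integral B (scale_span (-1) s) w) - 2).
  by rewrite span_integral_scale mulN1r; exact: sqr_le_cosh.
have L : L2 (span_integral B s).
  split; first exact: mea_span_integral.
  apply: Int_le I; first exact/mea_sqr/mea_span_integral.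
  by move=> w; rewrite ger0_norm ?sqr_ge0.
split=> //; apply: (le_trans (Ex_le L.2 I le)).
rewrite ExZ// ExB; [|exact: IntD|exact: Int_cst].
rewrite ExD// Ex_cst; lra.
Qed.

End WickLimit.

(** * Approximating the sign by exponentials *)

Section SignApproximation.
Context {R : realType}.

Lemma series_exp_coeff_le (x : R) N : 0 <= x -> series (exp_coeff x) N <= expR x.
Proof.
move=> x0; apply: nondecreasing_cvgn_le; last exact: is_cvg_series_exp_coeff.
by apply: nondecreasing_series => n _ _; exact: exp_coeff_ge0.
Qed.

Lemma series_sin_coeff_le (x : R) N : `|series (sin_coeff x) N| <= expR `|x|.
Proof.
apply: (le_trans _ (series_exp_coeff_le N (normr_ge0 x))).
apply: (le_trans (ler_norm_sum _ _ _)); apply: ler_sum => k _.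
rewrite /sin_coeff /exp_coeff /= !normrM normfV !normrX normr_nat.
rewrite [`|k`!%:R|]ger0_norm// ler_wpM2r ?invr_ge0// ler_piMl ?exprn_ge0//.
by rewrite normrN1 expr1n mulr1; case: odd.
Qed.

Lemma cvg_series_sin (x : R) : series (sin_coeff x) n @[n --> \oo] --> sin x.
Proof. by rewrite unlock; exact: is_cvg_series_sin_coeff. Qed.

(** A polynomial that maps [-1, 1] into itself and pushes every nonzero point
    towards its sign. *)
Definition sharpen (x : R) := 2^-1 * (3 * x - x ^+ 3).

Lemma sharpen_norm x : `|x| <= 1 -> `|sharpen x| <= 1.
Proof.
rewrite !ler_norml => /andP[h1 h2]; rewrite /sharpen; apply/andP; split.
  have : 0 <= (1 + x) ^+ 2 * (2 - x) by rewrite mulr_ge0 ?sqr_ge0//; lra.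
  have -> : (1 + x) ^+ 2 * (2 - x) = 2 + 3 * x - x ^+ 3 by ring.
  lra.
have : 0 <= (1 - x) ^+ 2 * (2 + x) by rewrite mulr_ge0 ?sqr_ge0//; lra.
have -> : (1 - x) ^+ 2 * (2 + x) = 2 - 3 * x + x ^+ 3 by ring.
lra.
Qed.

Lemma iter_sharpen_norm k x : `|x| <= 1 -> `|iter k sharpen x| <= 1.
Proof. by move=> x1; elim: k => //= k; exact: sharpen_norm. Qed.

Lemma iter_sharpenN k x : iter k sharpen (- x) = - iter k sharpen x.
Proof. by elim: k => //= k ->; rewrite /sharpen; ring. Qed.

(** On ]0, 1] the iterates increase, and 1 - sharpen z is 1 - z multiplied by
    a factor at most 1 - z / 2, so the distance to 1 decreases
    geometrically. *)
Lemma cvg_iter_sharpen x : `|x| <= 1 -> iter k sharpen x @[k --> \oo] --> Num.sg x.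
Proof.
have pos y : 0 < y -> y <= 1 -> iter k sharpen y @[k --> \oo] --> (1 : R).
  move=> y0 y1.
  have key k : y <= iter k sharpen y <= 1 /\ 1 - iter k sharpen y <= (1 - 2^-1 * y) ^+ k.
    elim: k => [|k /= [/andP[]]]; first by rewrite /= lexx y1 expr0; split=> //; lra.
    move: (iter k sharpen y) => z yz z1 h.
    have E1 : sharpen z - z = 2^-1 * z * (1 - z ^+ 2) by rewrite /sharpen; field.
    have E2 : 1 - sharpen z = (1 - z) * (1 - 2^-1 * (z + z ^+ 2)) by rewrite /sharpen; field.
    have z2 : z ^+ 2 <= 1 by rewrite expr_le1//; lra.
    have z20 := sqr_ge0 z.
    have h1 : 0 <= sharpen z - z by rewrite E1 !mulr_ge0//; lra.
    have h2 : 0 <= 1 - sharpen z by rewrite E2 mulr_ge0//; lra.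
    split; first by apply/andP; split; lra.
    by rewrite E2 [leRHS]exprSr; apply: ler_pM => //; lra.
  apply/cvgrPdist_le => e e0.
  have /cvgrPdist_le/(_ _ e0) : (1 - 2^-1 * y) ^+ k @[k --> \oo] --> (0 : R).
    by apply: cvg_expr; rewrite ger0_norm; lra.
  apply: filterS => k; rewrite sub0r normrN => h.
  have [/andP[h1 h2] h3] := key k; rewrite ger0_norm; last lra.
  by apply: le_trans h3 (le_trans (ler_norm _) h).
have [x0|x0|<-] := ltrgtP 0 x => x1.
- by rewrite gtr0_sg//; apply: pos => //; rewrite -(gtr0_norm x0).
- rewrite ltr0_sg//; have -> : (fun k => iter k sharpen x) = (fun k => - iter k sharpen (- x)).
    by apply/funext => k; rewrite iter_sharpenN opprK.
  by apply: cvgN; apply: pos; rewrite ?oppr_gt0// -(ltr0_norm x0).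
- rewrite sgr0; apply: cvg_eq_near (cvg_cst 0); apply: nearW => k.
  by elim: k => //= k ->; rewrite /sharpen expr0n/=; ring.
Qed.

Lemma sg_sin_near (x : R) : \forall n \near \oo, Num.sg (sin (n%:R^-1 * x)) = Num.sg x.
Proof.
have pos y : 0 < y -> \forall n \near \oo, Num.sg (sin (n%:R^-1 * y)) = Num.sg y :> R.
  move=> y0; exists (Num.truncn y).+1 => // n /= hn.
  have n0 : 0 < n%:R :> R by rewrite ltr0n; apply: leq_trans hn.
  have yn : y < n%:R by apply: lt_le_trans (truncnS_gt _) _; rewrite ler_nat.
  rewrite !gtr0_sg//; apply: sin2_gt0; rewrite mulr_gt0 ?invr_gt0//= mulrC ltr_pdivrMr//; lra.
have [x0|x0|<-] := ltrgtP 0 x.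
- exact: pos.
- have := pos (- x); rewrite oppr_gt0 => /(_ x0); apply: filterS => n.
  by rewrite mulrN sinN !sgrN => /oppr_inj.
- by apply: nearW => n; rewrite mulr0 sin0.
Qed.

Lemma expR_sub1_bounds (x : R) : x <= expR x - 1 <= x * expR x.
Proof.
apply/andP; split; first by have := expR_ge1Dx x; lra.
have := expR_ge1Dx (- x); rewrite expRN -(ler_pM2r (expR_gt0 x)) mulVf ?expR_eq0//; lra.
Qed.

Lemma cvg_difference_quotient (y : R) : n%:R * (expR (n%:R^-1 * y) - 1) @[n --> \oo] --> y.
Proof.
apply: (@squeeze_cvgr _ _ _ _ (fun=> y) (fun n => y * expR (n%:R^-1 * y))).
- exists 1%N => // n /= n0; have n0' : 0 < n%:R :> R by rewrite ltr0n.
  have /andP[h1 h2] := expR_sub1_bounds (n%:R^-1 * y); apply/andP; split.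
    by rewrite -ler_pdivrMl.
  rewrite -ler_pdivlMl//; by rewrite mulrA.
- exact: cvg_cst.
- suff : y * expR (n%:R^-1 * y) @[n --> \oo] --> y * expR 0 by rewrite expR0 mulr1.
  apply: cvgMr; apply: continuous_cvg; first exact: continuous_expR.
  rewrite -[X in _ --> X](mul0r y); apply: cvgMl.
  by rewrite -(cvg_shiftS _ (nbhs (0:R))); exact: cvg_harmonic.
Qed.

(** The domination needed to differentiate t |-> e^(t y) at 0 while staying
    among exponentials of y. *)
Lemma difference_quotient_le (y : R) n :
  `|n%:R * (expR (n%:R^-1 * y) - 1)| <= expR (2 * y) + expR (- 2 * y).
Proof.
have e0 z : 0 <= expR z :> R by exact: expR_ge0.
case: n => [|n]; first by rewrite mul0r normr0 addr_ge0.
have n0 : 0 < n.+1%:R :> R by rewrite ltr0n.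
have n1 : n.+1%:R^-1 <= 1 :> R by rewrite invf_le1// ler1n.
have /andP[h1 h2] := expR_sub1_bounds (n.+1%:R^-1 * y).
have a1 : y <= n.+1%:R * (expR (n.+1%:R^-1 * y) - 1) by rewrite -ler_pdivrMl.
have a2 : n.+1%:R * (expR (n.+1%:R^-1 * y) - 1) <= y * expR (n.+1%:R^-1 * y).
  by rewrite -ler_pdivlMl// mulrA.
have g1 z : z <= expR z :> R by have := expR_ge1Dx z; lra.
have [y0|y0] := leP 0 y.
  rewrite ger0_norm; last exact: le_trans a1.
  apply: (le_trans a2); apply: (@le_trans _ _ (expR y * expR y)).
    by apply: ler_pM => //; rewrite ler_expR ler_piMl.
  by rewrite -expRD (_ : y + y = 2 * y) ?lerDl//; ring.
rewrite ler0_norm; last first.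
  by apply: (le_trans a2); rewrite nmulr_rle0.
have : - y <= expR (- y) by [].
have : expR (- y) <= expR (-2 * y) by rewrite ler_expR; lra.
have := e0 (2 * y); lra.
Qed.

End SignApproximation.

(** * Totality of the exponentials *)

Section Totality.
Context {R : realType} {d : measure_display} {T : measurableType d}.
Variable P : probability T R.
Local Notation L2 := (L2 P).
Variable B : R -> T -> R.
Hypothesis mB : forall t, mea (B t).
Local Notation Z := (span_integral B).
Hypothesis F_generated : (measurable : set (set T)) =
  null_completion P (sigma_of [set t : R | 0 <= t] B).

Variable L : set (T -> R).
Hypothesis L_L2 : forall f, L f -> L2 f.
Hypothesis L_lin : forall a f g, L f -> L g -> L (fun w => a * f w + g w).
Hypothesis L_dom : forall (f_ : nat -> T -> R) f g, (forall k, L (f_ k)) -> mea f -> L2 g ->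
  (forall k w, `|f_ k w| <= `|g w|) ->
  {ae P, forall w, f_ k w @[k --> \oo] --> f w} -> L f.
Hypothesis L_exp : forall s, nonneg_times s -> L (fun w => expR (Z s w)).

Let L_0 : L (fun=> 0).
Proof.
have h : nonneg_times ([::] : seq (R * R)) by [].
have := L_lin (-1) (L_exp h) (L_exp h).
by congr L; apply/funext => w; rewrite mulN1r addNr.
Qed.

Let L_Z a f : L f -> L (fun w => a * f w).
Proof. by move=> Lf; have := L_lin a Lf L_0; congr L; apply/funext => w; rewrite addr0. Qed.

Let L_D f g : L f -> L g -> L (fun w => f w + g w).
Proof. by move=> Lf Lg; have := L_lin 1 Lf Lg; congr L; apply/funext => w; rewrite mul1r. Qed.

Let L_sum (I : eqType) (r : seq I) (F : I -> T -> R) : (forall i, i \in r -> L (F i)) ->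
  L (fun w => \sum_(i <- r) F i w).
Proof.
elim: r => [_|i r IH h].
  by under [X in L X]eq_fun do rewrite big_nil; exact: L_0.
under [X in L X]eq_fun do rewrite big_cons.
by apply: L_D; [apply: h; rewrite mem_head|apply: IH => j jr; apply: h; rewrite inE jr orbT].
Qed.

(** W stays in L after multiplication by every exponential. Products of W with
    functions dominated by exponentials are then dominated by elements of L,
    hence by square-integrable functions, which is what L_dom asks for. *)
Definition tilted (W : T -> R) := forall s, nonneg_times s -> L (fun w => W w * expR (Z s w)).

(** Multipliers form an algebra that is closed under limits dominated by
    exponentials (multiplier_lim). It contains e^Z, hence Z as a derivative
    at 0, hence sin (h Z + c) as a power series, hence the sign of Z - c through
    the iterates of sharpen followed by h -> 0, hence the indicator of
    {B t > c}. *)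
Definition multiplier (F : T -> R) := mea F /\ forall W, tilted W -> tilted (fun w => W w * F w).

Let mZ s : mea (Z s).
Proof. by apply: measurable_sum => p; apply: meaM => //; exact: mea_cst. Qed.

Let tilted_mea W : tilted W -> mea W.
Proof.
move=> /(_ [::]) h; have /h /L_L2 [] : nonneg_times ([::] : seq (R * R)) by [].
by under [X in mea X -> _]eq_fun do rewrite /span_integral big_nil expR0 mulr1.
Qed.

Lemma multiplier_exp s : nonneg_times s -> multiplier (fun w => expR (Z s w)).
Proof.
move=> s0; split; first by apply: mea_comp => //; exact: measurable_expR.
move=> W SW s' s0'; have := SW _ (nonneg_times_cat s0 s0'); congr L.
by apply/funext => w; rewrite span_integral_cat expRD mulrA.
Qed.

Lemma multiplier_cst c : multiplier (fun=> c).
Proof.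
split; first exact: mea_cst.
by move=> W SW s s0; have := L_Z c (SW s s0); congr L; apply/funext => w; rewrite mulrCA mulrA.
Qed.

Lemma multiplierD F G : multiplier F -> multiplier G -> multiplier (fun w => F w + G w).
Proof.
move=> [mF hF] [mG hG]; split; first exact: meaD.
move=> W SW s s0; have := L_D (hF W SW s s0) (hG W SW s s0).
by congr L; apply/funext => w; rewrite mulrDr mulrDl.
Qed.

Lemma multiplierM F G : multiplier F -> multiplier G -> multiplier (fun w => F w * G w).
Proof.
move=> [mF hF] [mG hG]; split; first exact: meaM.
by move=> W SW s s0; have := hG _ (hF W SW) s s0; congr L; apply/funext => w; rewrite mulrA.
Qed.

Lemma multiplierX F k : multiplier F -> multiplier (fun w => F w ^+ k).
Proof.
move=> hF; elim: k => [|k IH]; first by under [X in multiplier X]eq_fun do rewrite expr0; exact: multiplier_cst.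
by under [X in multiplier X]eq_fun do rewrite exprS; exact: multiplierM.
Qed.

Lemma multiplier_sum (I : Type) (r : seq I) (F : I -> T -> R) :
  (forall i, multiplier (F i)) -> multiplier (fun w => \sum_(i <- r) F i w).
Proof.
move=> h; elim: r => [|i r IH].
  by under [X in multiplier X]eq_fun do rewrite big_nil; exact: multiplier_cst.
by under [X in multiplier X]eq_fun do rewrite big_cons; exact: multiplierD.
Qed.

Lemma multiplier_lim (F_ : nat -> T -> R) F s1 s2 C :
  nonneg_times s1 -> nonneg_times s2 -> 0 <= C ->
  (forall k, multiplier (F_ k)) ->
  (forall k w, `|F_ k w| <= C * (expR (Z s1 w) + expR (Z s2 w))) ->
  (forall w, F_ k w @[k --> \oo] --> F w) -> multiplier F.
Proof.
move=> s10 s20 C0 mF bF cF.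
have mF0 : mea F by apply: (mea_cvg (f_ := F_)) => // k; exact: (mF k).1.
split=> // W SW s s0.
pose g w := C * (W w * expR (Z (s1 ++ s) w) + W w * expR (Z (s2 ++ s) w)).
apply: (L_dom (f_ := fun k w => W w * F_ k w * expR (Z s w)) (g := g)).
- by move=> k; exact: (mF k).2.
- apply: meaM; first by apply: meaM => //; exact: tilted_mea.
  by apply: mea_comp => //; exact: measurable_expR.
- by apply: L2Z; apply: L2D; apply: L_L2; apply: SW; exact: nonneg_times_cat.
- move=> k w; rewrite /g !span_integral_cat !expRD.
  have -> : C * (W w * (expR (Z s1 w) * expR (Z s w)) + W w * (expR (Z s2 w) * expR (Z s w))) =
    W w * (C * (expR (Z s1 w) + expR (Z s2 w))) * expR (Z s w) by ring.
  rewrite !normrM; apply: ler_wpM2r => //; apply: ler_wpM2l => //.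
  by rewrite -normrM [leRHS]ger0_norm// mulr_ge0// addr_ge0// expR_ge0.
- by apply: aeW => w; apply: cvgMl; apply: cvgMr; exact: cF.
Qed.

Lemma multiplier_bounded_lim (F_ : nat -> T -> R) F C :
  0 <= C -> (forall k, multiplier (F_ k)) -> (forall k w, `|F_ k w| <= C) ->
  (forall w, F_ k w @[k --> \oo] --> F w) -> multiplier F.
Proof.
move=> C0 mF bF cF; apply: (@multiplier_lim F_ F [::] [::] C) => // k w.
by rewrite /span_integral big_nil expR0 (le_trans (bF k w))// ler_peMr// lerDl.
Qed.

Lemma multiplier_span s : nonneg_times s -> multiplier (Z s).
Proof.
move=> s0; apply: (@multiplier_lim (fun k w => k%:R * (expR (k%:R^-1 * Z s w) - 1)) _
  (scale_span 2 s) (scale_span (-2) s) 1) => //.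
- exact: nonneg_times_scale.
- exact: nonneg_times_scale.
- move=> k; apply: multiplierM; first exact: multiplier_cst.
  apply: multiplierD; last exact: multiplier_cst.
  by have := multiplier_exp (nonneg_times_scale (c := k%:R^-1) s0); under eq_fun do rewrite span_integral_scale.
- by move=> k w; rewrite mul1r !span_integral_scale; exact: difference_quotient_le.
- by move=> w; exact: cvg_difference_quotient.
Qed.

Lemma multiplier_sin s h c : nonneg_times s -> multiplier (fun w => sin (h * Z s w + c)).
Proof.
move=> s0; apply: (@multiplier_lim (fun k w => series (sin_coeff (h * Z s w + c)) k) _
  (scale_span h s) (scale_span (- h) s) (expR `|c|)) => //.
- exact: nonneg_times_scale.
- exact: nonneg_times_scale.
- move=> N; apply: multiplier_sum => k; rewrite /sin_coeff /=.
  apply: multiplierM; last exact: multiplier_cst.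
  apply: multiplierM; first exact: multiplier_cst.
  apply: multiplierX; apply: multiplierD; last exact: multiplier_cst.
  by apply: multiplierM; [exact: multiplier_cst|exact: multiplier_span].
- move=> k w; rewrite !span_integral_scale; apply: (le_trans (series_sin_coeff_le _ _)).
  move: (Z s w) => z; rewrite mulNr; apply: (@le_trans _ _ (expR (`|h * z| + `|c|))).
    by rewrite ler_expR ler_normD.
  rewrite expRD mulrC ler_wpM2l ?expR_ge0//.
  by case: (ger0P (h * z)) => _; [rewrite lerDl|rewrite lerDr]; exact: expR_ge0.
- by move=> w; exact: cvg_series_sin.
Qed.

Lemma multiplier_sg s c : nonneg_times s -> multiplier (fun w => Num.sg (Z s w - c)).
Proof.
move=> s0.
have sg1 (x : R) : `|Num.sg x| <= 1 by rewrite normr_sg; case: (x != 0).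
apply: (@multiplier_bounded_lim (fun n w => Num.sg (sin (n%:R^-1 * (Z s w - c)))) _ 1) => //; last first.
  move=> w; apply: cvg_eq_near (cvg_cst _); exact: sg_sin_near.
move=> n; apply: (@multiplier_bounded_lim (fun k w => iter k sharpen (sin (n%:R^-1 * (Z s w - c)))) _ 1) => //.
- elim=> [|k IH] /=.
    by under eq_fun do rewrite mulrBr; exact: multiplier_sin.
  rewrite /sharpen; apply: multiplierM; first exact: multiplier_cst.
  apply: multiplierD; first by apply: multiplierM => //; exact: multiplier_cst.
  under eq_fun do rewrite -mulN1r; apply: multiplierM; first exact: multiplier_cst.
  exact: multiplierX.
- by move=> k w; apply: iter_sharpen_norm; exact: sin_max.
- by move=> w; apply: cvg_iter_sharpen; exact: sin_max.
Qed.

Let good (A : set T) := multiplier (\1_A).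

Let goodC A : good A -> good (~` A).
Proof.
move=> gA; have := multiplierD (multiplier_cst 1) (multiplierM (multiplier_cst (-1)) gA).
congr multiplier; apply/funext => w; rewrite indicC mulN1r /=.
by rewrite indicE; case: (_ \in _); rewrite /= ?subrr ?subr0.
Qed.

Let good_bigcup (A : nat -> set T) : (forall n, good (A n)) -> good (\bigcup_n A n).
Proof.
move=> gA.
have gC n : multiplier (fun w => \prod_(i < n) (1 - \1_(A i) w)).
  elim: n => [|n IH].
    by under [X in multiplier X]eq_fun do rewrite big_ord0; exact: multiplier_cst.
  under [X in multiplier X]eq_fun do rewrite big_ord_recr/=.
  apply: multiplierM => //; apply: multiplierD; first exact: multiplier_cst.
  under eq_fun do rewrite -mulN1r.
  by apply: multiplierM; [exact: multiplier_cst|exact: gA].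
apply: (@multiplier_bounded_lim (fun n w => 1 - \prod_(i < n) (1 - \1_(A i) w)) _ 1) => //.
- move=> n; apply: multiplierD; first exact: multiplier_cst.
  under eq_fun do rewrite -mulN1r.
  by apply: multiplierM; [exact: multiplier_cst|exact: gC].
- move=> n w; have : 0 <= \prod_(i < n) (1 - \1_(A i) w : R) <= 1.
    apply/andP; split.
      by apply: prodr_ge0 => i _; rewrite indicE; case: (_ \in _); rewrite /= ?subrr ?subr0.
    by apply: prodr_ile1 => i _; rewrite indicE; case: (_ \in _); rewrite /= ?subrr ?subr0 ?lexx ?ler01.
  by move=> /andP[h1 h2]; rewrite ler_norml; apply/andP; split; lra.
move=> w; apply: cvg_eq_near (cvg_cst _).
case: (pselect ((\bigcup_n A n) w)) => [Aw|nAw].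
  have [k _ Akw] := Aw; exists k.+1 => // n /= kn.
  rewrite indicE mem_set//= (bigD1 (Ordinal kn))//= indicE mem_set//= subrr mul0r subr0//.
apply: nearW => n; rewrite [in RHS]indicE memNset//= big1 ?subrr// => i _.
by rewrite indicE memNset ?subr0// => Aiw; apply: nAw; exists i.
Qed.

Let good_ray t c : 0 <= t -> good (B t @^-1` `]c, +oo[).
Proof.
move=> t0; have s0 : nonneg_times [:: (1, t)] by move=> p; rewrite inE => /eqP ->.
have g := multiplier_sg c s0.
(* the indicator of the positive reals is (sg^2 + sg) / 2 *)
have := multiplierM (multiplier_cst 2^-1) (multiplierD (multiplierX 2 g) g).
congr multiplier; apply/funext => w.
rewrite /span_integral big_seq1 mul1r indicE.
have [h|h|h] := ltrgtP 0 (B t w - c).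
- rewrite gtr0_sg// mem_set/=; first by field.
  by rewrite in_itv/= andbT -subr_gt0.
- rewrite ltr0_sg// memNset/=; first by field.
  by rewrite in_itv/= andbT -subr_gt0 => h'; move: (lt_trans h h'); rewrite ltxx.
- rewrite -h sgr0 memNset/=; first by rewrite expr0n/=; ring.
  by rewrite in_itv/= andbT -subr_gt0 -h ltxx.
Qed.

(** Multiplicativity makes this a sigma-algebra directly: an intersection
    corresponds to a product of indicators. *)
Let good_sigma_algebra : sigma_algebra setT good.
Proof.
split.
- rewrite /good indic0; exact: multiplier_cst.
- by move=> A gA; rewrite setTD; exact: goodC.
- by move=> A gA; exact: good_bigcup.
Qed.

Let good_preimage t U : 0 <= t -> measurable U -> good (B t @^-1` U).
Proof.
move=> t0.
suff : (@measurable _ R) `<=` [set U | good (B t @^-1` U)] by apply.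
rewrite [X in X `<=` _]RGenOInfty.measurableE; apply: smallest_sub.
  have [g0 gC gU] := good_sigma_algebra; split => /=.
  - by rewrite preimage_set0.
  - by move=> A gA; rewrite setTD preimage_setC -setTD; exact: gC.
  - by move=> A gA; rewrite preimage_bigcup; exact: gU.
by move=> _ [c ->]; exact: good_ray.
Qed.

Let good_generated A : sigma_of [set t : R | 0 <= t] B A -> good A.
Proof.
apply: smallest_sub; first exact: good_sigma_algebra.
by move=> _ [t t0 [U mU <-]]; rewrite setTI; exact: good_preimage.
Qed.

Let L_indic A : measurable A -> L (\1_A).
Proof.
move=> mA; have := mA; rewrite {1}F_generated => -[C [N [gC gN PN0 CN]]].
have LC : L (\1_C).
  have t1 : tilted (fun=> 1).
    by move=> s s0; under eq_fun do rewrite mul1r; exact: L_exp.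
  have h : nonneg_times ([::] : seq (R * R)) by [].
  have := (good_generated gC).2 _ t1 _ h; congr L.
  by apply/funext => w; rewrite /span_integral big_nil expR0 mulr1 mul1r.
apply: (L_dom (f_ := fun=> \1_C) (g := \1_C)) => //.
- exact: measurable_indic.
- exact: L_L2.
exists N; split => //.
  by rewrite F_generated; exists N, N; split=> //; rewrite setDv setU0.
move=> w /= h; apply: CN; apply: contrapT => h'; apply: h.
apply: cvg_eq_near (cvg_cst _); apply: nearW => _.
rewrite !indicE; congr (_%:R); congr nat_of_bool; apply/idP/idP => /set_mem ww; apply/mem_set.
  by apply: contrapT => nA; apply: h'; right.
by apply: contrapT => nC; apply: h'; left.
Qed.

(** Indicators of events generated by B are multipliers, hence in L. Null sets
    are absorbed by the almost sure limit in L_dom, and every square-integrable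
    function is reached through simple functions dominated by it. *)
Theorem exponentials_total V : L2 V -> L V.
Proof.
have pos U : L2 U -> (forall w, 0 <= U w) -> L U.
  move=> LU U0; have mU : measurable_fun setT (EFin \o U) by exact/measurable_EFinP/LU.1.
  pose f n := nnsfun_approx measurableT mU n.
  have fcv w : f n w @[n --> \oo] --> U w.
    have := @cvg_nnsfun_approx _ _ _ _ measurableT _ mU (fun x _ => U0 x) w Logic.I.
    by move=> /fine_cvg.
  apply: (L_dom (f_ := fun n => f n) (g := U)) => //; last by apply: aeW.
  - move=> n; have -> : (f n : T -> R) = fun w => \sum_(y \in range (f n)) (y * \1_(f n @^-1` [set y]) w).
      by apply/funext => w; rewrite {1}fimfunE.
    under eq_fun do rewrite fsbig_finite//=.
    apply: L_sum => y _; apply: L_Z; apply: L_indic.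
    by [].
  - exact: LU.1.
  - move=> n w; rewrite !ger0_norm//.
    rewrite -(cvg_lim _ (fcv w))//; apply: nondecreasing_cvgn_le.
      move=> m1 m2 m12.
      by have /lefP/(_ w) := @nd_nnsfun_approx _ _ _ _ measurableT _ mU _ _ m12.
    by apply/cvg_ex; eexists; exact: fcv.
move=> LV.
have m0 : mea (fun w => Num.max (V w) 0) by apply: measurable_maxr LV.1 _; exact: mea_cst.
have m1 : mea (fun w => Num.max (- V w) 0).
  by apply: measurable_maxr; [exact: measurableT_comp LV.1|exact: mea_cst].
have L0 : L2 (fun w => Num.max (V w) 0).
  apply: (L2_le m0 _ LV) => w; rewrite ger0_norm ?le_max ?lexx ?orbT// ge_max normr_ge0 andbT.
  exact: ler_norm.
have L1 : L2 (fun w => Num.max (- V w) 0).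
  apply: (L2_le m1 _ LV) => w; rewrite ger0_norm ?le_max ?lexx ?orbT// ge_max normr_ge0 andbT.
  by rewrite -normrN; exact: ler_norm.
have := L_lin (-1) (pos _ L1 (fun w => _)) (pos _ L0 (fun w => _)).
have nn x : 0 <= Num.max x 0 :> R by rewrite le_max lexx orbT.
move=> /(_ (fun w => nn _) (fun w => nn _)); congr L; apply/funext => w.
by case: (leP (V w) 0) => h1; case: (leP (- V w) 0) => h2; lra.
Qed.

End Totality.

(** * Uniform boundedness in mean square *)

Section UniformBoundedness.
Context {R : realType} {d : measure_display} {T : measurableType d}.
Variable P : probability T R.
Local Notation Int := (Int P).
Local Notation Ex := (Ex P).
Local Notation L2 := (L2 P).

Definition nrm (f : T -> R) : R := Num.sqrt (Ex (fun w => f w ^+ 2)).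

Lemma Ex_sqr_ge0 (f : T -> R) : 0 <= Ex (fun w => f w ^+ 2).
Proof. by apply: Ex_ge0 => w; exact: sqr_ge0. Qed.

Lemma nrm_sqr f : nrm f ^+ 2 = Ex (fun w => f w ^+ 2).
Proof. by rewrite sqr_sqrtr// Ex_sqr_ge0. Qed.

Lemma nrm_ge0 f : 0 <= nrm f. Proof. exact: sqrtr_ge0. Qed.

Lemma Ex_mul_le_nrm f g : L2 f -> L2 g -> `|Ex (fun w => f w * g w)| <= nrm f * nrm g.
Proof.
move=> hf hg; rewrite -sqrtr_sqr -sqrtrM ?Ex_sqr_ge0//.
by apply: ler_wsqrtr; exact: (Ex_mul_sqr_le hf hg).
Qed.

Lemma nrmD f g : L2 f -> L2 g -> nrm (fun w => f w + g w) <= nrm f + nrm g.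
Proof.
move=> hf hg; rewrite -(@ler_pXn2r _ 2)// ?nnegrE ?nrm_ge0 ?addr_ge0 ?nrm_ge0//.
rewrite nrm_sqr.
have -> : (fun w => (f w + g w) ^+ 2) = (fun w => f w ^+ 2 + 2 * (f w * g w) + g w ^+ 2).
  by apply/funext => w; ring.
have If := hf.2; have Ig := hg.2; have Ifg := L2_IntM hf hg.
rewrite ExD//; last by apply: IntD => //; exact: IntZ.
rewrite ExD//; last exact: IntZ.
rewrite ExZ// -!nrm_sqr.
have := le_trans (ler_norm _) (Ex_mul_le_nrm hf hg); lra.
Qed.

Lemma nrmZ c f : L2 f -> nrm (fun w => c * f w) = `|c| * nrm f.
Proof.
move=> hf; rewrite /nrm; under [X in Ex X]eq_fun do rewrite exprMn.
by rewrite (ExZ _ hf.2) sqrtrM ?sqr_ge0// sqrtr_sqr.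
Qed.

Lemma Ex_norm_le_nrm f : L2 f -> Ex (fun w => `|f w|) <= nrm f.
Proof.
move=> hf; have hn : L2 (fun w => `|f w|).
  by apply: (L2_le _ _ hf) => [|w]; [exact/mea_norm/hf.1|rewrite normr_id].
have := Ex_sqr_ge hn; have -> : (fun w => `|f w| ^+ 2) = (fun w => f w ^+ 2).
  by apply/funext => w; rewrite real_normK// num_real.
by rewrite -nrm_sqr ler_pXn2r// ?nnegrE ?nrm_ge0// Ex_ge0.
Qed.

Lemma mea_lim_esup (x : nat -> T -> R) : (forall k, mea (x k)) ->
  mea (fun w => fine (limn_esup (fun k => (x k w)%:E))).
Proof.
move=> mx; apply: (measurableT_comp (@fine_measurable R setT measurableT)).
apply: (measurable_fun_limn_esup (f := fun k w => (x k w)%:E)) => k.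
by apply/measurable_EFinP; exact: mx.
Qed.

(** Completeness of L2 for sequences with geometric increments, together with
    the distance from each term to the limit. *)
Lemma L2_geometric_limit (x : nat -> T -> R) :
  (forall k, L2 (x k)) -> (forall k, nrm (fun w => x k.+1 w - x k w) <= 3^-1 ^+ k) ->
  exists2 V, L2 V & forall k, nrm (fun w => V w - x k w) <= 3 / 2 * 3^-1 ^+ k.
Proof.
move=> Lx hx.
have Ld k l : L2 (fun w => x k w - x l w) by exact: L2B.
have p3 k : 0 <= 3^-1 ^+ k :> R by rewrite exprn_ge0.
have part m n : nrm (fun w => x (m + n)%N w - x m w) <= 3 / 2 * 3^-1 ^+ m * (1 - 3^-1 ^+ n).
  elim: n => [|n IH].
    rewrite addn0; under [X in nrm X]eq_fun do rewrite subrr -(mul0r 0).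
    by rewrite nrmZ ?normr0 ?mul0r ?expr0 ?subrr ?mulr0//; exact: L2_cst.
  have -> : (fun w => x (m + n.+1)%N w - x m w) =
     (fun w => (x (m + n)%N.+1 w - x (m + n)%N w) + (x (m + n)%N w - x m w)).
    by apply/funext => w; rewrite addnS; ring.
  apply: (le_trans (nrmD (Ld _ _) (Ld _ _))); apply: (le_trans (lerD (hx _) IH)).
  rewrite exprD exprSr; move: (p3 m) (p3 n); set u := _ ^+ m; set v := _ ^+ n => u0 v0.
  by rewrite le_eqVlt; apply/orP; left; apply/eqP; field.
have acv : {ae P, forall w, cvgn (series (fun n => `|x n.+1 w - x n w|))}.
  apply: (@ae_cvg_series _ _ _ P (fun n w => `|x n.+1 w - x n w|) 2).
  - by move=> n; apply: Int_norm; exact/L2_Int/Ld.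
  - by [].
  - move=> n; apply: (@le_trans _ _ (\sum_(0 <= i < n) 3^-1 ^+ i)).
      by apply: ler_sum => i _; apply: le_trans (Ex_norm_le_nrm (Ld _ _)) (hx i).
    have key m : \sum_(0 <= i < m) 3^-1 ^+ i = 3 / 2 * (1 - 3^-1 ^+ m) :> R.
      elim: m => [|m IH]; first by rewrite big_nil expr0 subrr mulr0.
      by rewrite big_nat_recr//= IH exprSr; field.
    by rewrite key; have := p3 n; lra.
pose V w := fine (limn_esup (fun k => (x k w)%:E)).
have mV : mea V by apply: mea_lim_esup => k; exact: (Lx k).1.
have xV : {ae P, forall w, x n w @[n --> \oo] --> V w}.
  apply: filterS acv => w /normed_cvg sc.
  have xE : (fun n => x n w) = (fun n => series (fun n => x n.+1 w - x n w) n + x 0%N w).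
    by apply/funext => n; rewrite /series/= telescope_sumr// subrK.
  have cx : cvgn (fun n => x n w).
    by rewrite xE; apply: is_cvgD => //; exact: is_cvg_cst.
  have cE : (x n w)%:E @[n --> \oo] --> (limn (fun n => x n w))%:E.
    by apply: cvg_EFin; [exact: nearW|exact: cx].
  rewrite /V is_cvg_limn_esupE; last by apply/cvg_ex; eexists; exact: cE.
  by rewrite (cvg_lim _ cE).
have key k : L2 (fun w => V w - x k w) /\ nrm (fun w => V w - x k w) <= 3 / 2 * 3^-1 ^+ k.
  have [|||||| IV EV] := @Fatou _ _ _ P (fun n w => (x (k + n)%N w - x k w) ^+ 2)
    (fun w => (V w - x k w) ^+ 2) ((3 / 2 * 3^-1 ^+ k) ^+ 2).
  - by move=> n; exact: (Ld _ _).2.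
  - by apply: mea_sqr; apply: meaB => //; exact: (Lx k).1.
  - by move=> n w; exact: sqr_ge0.
  - by move=> w; exact: sqr_ge0.
  - apply: filterS xV => w h; apply: cvg_sqr; apply: cvgB; last exact: cvg_cst.
    by apply: (cvg_extracted (u := fun n => x n w)) h => n; exact: leq_addl.
  - move=> n; rewrite -nrm_sqr lerXn2r ?nnegrE ?nrm_ge0 ?mulr_ge0//.
    apply: (le_trans (part k n)); rewrite ler_piMr ?mulr_ge0//.
  split; first by split=> //; apply: meaB => //; exact: (Lx k).1.
  by rewrite -(@ler_pXn2r _ 2)// ?nnegrE ?nrm_ge0 ?mulr_ge0// nrm_sqr.
exists V => [|k]; last exact: (key k).2.
by have := L2D (key 0%N).1 (Lx 0%N); congr L2; apply/funext => w; rewrite subrK.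
Qed.

(** Gliding hump. If the norms are unbounded, choose U k among the X n with
    norm at least 2 * 3^k * (k + 1) and move at stage k by 3^-k in the direction of
    U k, with the sign that adds to the pairing with U k. All later moves
    together have length at most 3^-k / 2, so they cancel at most half of the hump
    created at stage k, and the pairings of the limit with the U k are
    unbounded. *)
Theorem L2_uniform_boundedness (X : nat -> T -> R) : (forall n, L2 (X n)) ->
  (forall V, L2 V -> exists C, forall n, `|Ex (fun w => X n w * V w)| <= C) ->
  exists C, forall n, Ex (fun w => X n w ^+ 2) <= C.
Proof.
move=> LX bX; apply: contrapT => /forallNP nb.
have H k : exists n, 2 * 3 ^+ k * k.+1%:R <= nrm (X n).
  have /existsNP[n /negP] := nb ((2 * 3 ^+ k * k.+1%:R) ^+ 2).
  rewrite -ltNge => h; exists n.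
  rewrite -(@ler_pXn2r _ 2)// ?nnegrE ?nrm_ge0 ?mulr_ge0 ?exprn_ge0//.
  by rewrite nrm_sqr ltW.
have [N HN] := choice H.
pose U k := X (N k).
have nuU k : 0 < nrm (U k).
  by apply: lt_le_trans (HN k); rewrite !mulr_gt0 ?exprn_gt0// ltr0n.
pose stp k (y : T -> R) : T -> R := fun w => y w +
  ((if 0 <= Ex (fun w => U k w * y w) then 1 else -1) * 3^-1 ^+ k / nrm (U k)) * U k w.
pose x := fix x k := if k is k'.+1 then stp k' (x k') else (fun=> 0).
have Lx k : L2 (x k).
  elim: k => [|k IH] /=; first exact: L2_cst.
  exact: (L2D IH (L2Z _ (LX _))).
have p3 k : 0 < 3^-1 ^+ k :> R by rewrite exprn_gt0.
have hx k : nrm (fun w => x k.+1 w - x k w) <= 3^-1 ^+ k.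
  rewrite /= /stp; under [X in nrm X]eq_fun do rewrite addrAC subrr add0r.
  rewrite nrmZ; last exact: LX.
  rewrite -[nrm (X _)]/(nrm (U k)).
  have -> : `|(if 0 <= Ex (fun w => U k w * x k w) then 1 else -1) * 3^-1 ^+ k / nrm (U k)| =
      3^-1 ^+ k / nrm (U k).
    rewrite !normrM normfV (gtr0_norm (p3 k)) (gtr0_norm (nuU k)).
    by case: ifP => _; rewrite ?normrN normr1 mul1r.
  by rewrite divfK// gt_eqF.
have big k : 3^-1 ^+ k * nrm (U k) <= `|Ex (fun w => U k w * x k.+1 w)|.
  rewrite /= /stp; set c := (if _ then _ else _).
  have -> : (fun w => U k w * (x k w + c * 3^-1 ^+ k / nrm (U k) * U k w)) =
    (fun w => U k w * x k w + c * 3^-1 ^+ k / nrm (U k) * U k w ^+ 2).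
    by apply/funext => w; ring.
  have IU := (LX (N k)).2.
  rewrite ExD; [|exact: (L2_IntM (LX _) (Lx _))|exact: IntZ].
  rewrite ExZ// -nrm_sqr -[nrm (X (N k))]/(nrm (U k)).
  have -> : c * 3^-1 ^+ k / nrm (U k) * nrm (U k) ^+ 2 = c * (3^-1 ^+ k * nrm (U k)).
    by field; rewrite gt_eqF.
  have q0 : 0 <= 3^-1 ^+ k * nrm (U k) by rewrite mulr_ge0 ?nrm_ge0// ltW.
  rewrite /c; case: (leP 0 (Ex _)) => h.
    by rewrite mul1r ger0_norm ?addr_ge0// lerDr.
  by rewrite mulN1r ler0_norm; lra.
have [V LV HV] := L2_geometric_limit Lx hx.
have [C HC] := bX _ LV.
have fin k : k.+1%:R <= C.
  have Ld := L2B LV (Lx k.+1).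
  have h1 := Ex_mul_le_nrm (LX (N k)) Ld.
  have E : Ex (fun w => U k w * V w) =
     Ex (fun w => U k w * x k.+1 w) + Ex (fun w => U k w * (V w - x k.+1 w)).
    rewrite -ExD; [|exact: (L2_IntM (LX _) (Lx _))|exact: (L2_IntM (LX _) Ld)].
    by apply: eq_Ex => w; ring.
  have h2 : nrm (U k) * nrm (fun w => V w - x k.+1 w) <= nrm (U k) * (3 / 2 * 3^-1 ^+ k.+1).
    by rewrite ler_wpM2l ?nrm_ge0.
  have h3 : nrm (U k) * (3 / 2 * 3^-1 ^+ k.+1) = 2^-1 * (3^-1 ^+ k * nrm (U k)).
    by rewrite exprSr; field.
  have h4 : `|Ex (fun w => U k w * x k.+1 w)| <= `|Ex (fun w => U k w * V w)| +
     `|Ex (fun w => U k w * (V w - x k.+1 w))|.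
    by rewrite E -[X in `|X| <= _](addrK (Ex (fun w => U k w * (V w - x k.+1 w)))) ler_normB.
  have h5 : k.+1%:R <= 2^-1 * (3^-1 ^+ k * nrm (U k)).
    have := HN k; rewrite -/(U k) => h.
    apply: (@le_trans _ _ (2^-1 * (3^-1 ^+ k * (2 * 3 ^+ k * k.+1%:R)))).
      have e : 3^-1 ^+ k * 3 ^+ k = 1 :> R by rewrite -exprMn mulVf ?expr1n// pnatr_eq0.
      have -> : 2^-1 * (3^-1 ^+ k * (2 * 3 ^+ k * k.+1%:R)) = (3^-1 ^+ k * 3 ^+ k) * k.+1%:R :> R by field.
      by rewrite e mul1r.
    by rewrite ler_wpM2l// ler_wpM2l// ltW.
  have := HC (N k); have := big k; rewrite -/(U k).
  move: h1; rewrite -/(U k); lra.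
have := fin (Num.truncn C); rewrite leNgt truncnS_gt//.
Qed.

End UniformBoundedness.

(** * Wiener integrals of step functions *)

Section StepFunctionsAsSpans.
Context {R : realType}.
Implicit Type s : seq (R * R).

(** On positive arguments ]b, c] is the difference of ]0, c+] and ]0, b+],
    where + denotes the positive part. The value at 0 is lost, which affects
    neither integrals over the half-line nor the grid i / n with i >= 1. *)
Lemma step_function_span (g : R -> R) : step_functions g ->
  exists s, nonneg_times s /\ forall x, 0 < x -> g x = span_indic s x.
Proof.
move=> [m [_ [a [b [c ->]]]]].
suff : forall r : seq 'I_m, exists s, nonneg_times s /\ forall x, 0 < x ->
    \sum_(j <- r) a j * \1_(`]b j, c j]) x = span_indic s x by apply.
elim=> [|j r [s [s0 sE]]].
  by exists [::]; split=> // x _; rewrite /span_indic !big_nil.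
pose u := if b j < c j then [:: (a j, Num.max 0 (c j)); (- a j, Num.max 0 (b j))] else [::].
exists (u ++ s); split.
  apply: nonneg_times_cat => // p; rewrite /u; case: ifP => // _.
  by rewrite !inE => /orP[] /eqP -> /=; rewrite le_max lexx.
move=> x x0; rewrite big_cons span_indic_cat sE//; congr (_ + _).
have i1 (t : R) : \1_(`]0, t]) x = (x <= t)%R%:R :> R.
  rewrite indicE; congr (_%:R); congr nat_of_bool.
  by apply/idP/idP => [/set_mem|h]; [|apply/mem_set]; rewrite /= in_itv/= x0.
have i2 : \1_(`]b j, c j]) x = ((b j < x)%R && (x <= c j)%R)%:R :> R.
  rewrite indicE; congr (_%:R); congr nat_of_bool.
  by apply/idP/idP => [/set_mem|h]; [|apply/mem_set]; rewrite /= in_itv/=.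
rewrite i2 /u; case: (ltP (b j) (c j)) => bc.
  rewrite /span_indic big_cons big_seq1 /= !i1 !le_max (leNgt x 0) x0/=.
  rewrite mulNr -mulrBr; congr (_ * _).
  case: (leP x (b j)) => xb /=; last by rewrite subr0.
  by rewrite (le_trans xb (ltW bc)) subrr.
rewrite /span_indic big_nil; case: (ltP (b j) x) => bx /=; last by rewrite mulr0.
by rewrite leNgt (le_lt_trans bc bx) mulr0.
Qed.

Local Notation mu := (@lebesgue_measure R).

Lemma integral_span_indic_sqr s : nonneg_times s ->
  mu.-integrable `[0%R, +oo[ (EFin \o (fun x => span_indic s x ^+ 2)) /\
  (\int[mu]_(x in `[0%R, +oo[) (span_indic s x ^+ 2)%:E = (norm2 s)%:E)%E.
Proof.
move=> s0.
have I1 c t : mu.-integrable `[0%R, +oo[ (fun x => (c * \1_(`]0, t]) x)%:E).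
  have mD : measurable (`[0%R, +oo[ : set R) by [].
  have I0 : mu.-integrable `[0%R, +oo[ (fun x => (\1_(`]0, t]) x)%:E).
    apply: (@integrableS _ _ _ mu setT) => //; exact: integrable_indic_itv.
  rewrite (_ : (fun x => (c * \1_(`]0, t]) x)%:E) = (fun x => c%:E * (\1_(`]0, t]) x)%:E)%E).
    by apply: integrableZl; [exact: measurable_itv|exact: I0].
  by apply/funext => x; rewrite EFinM.
have E1 c t : 0 <= t -> (\int[mu]_(x in `[0%R, +oo[) (c * \1_(`]0, t]) x)%:E = (c * t)%:E)%E.
  move=> t0; rewrite (_ : (fun x => _) = (fun x => c%:E * (\1_(`]0, t]) x)%:E)%E); last first.
    by apply/funext => x; rewrite EFinM.
  rewrite integralZl//; last first.
    by apply: (@integrableS _ _ _ mu setT) => //; exact: integrable_indic_itv.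
  rewrite integral_indic// EFinM; congr (_ * _)%E.
  rewrite (_ : _ `&` _ = `]0, t]%classic); last first.
    apply/seteqP; split => x /= []; rewrite ?in_itv//= => /andP[x0 xt].
    by rewrite x0 xt ltW.
  apply: (etrans (lebesgue_measure_itv `]0%R, t])) => /=; rewrite lte_fin.
  case: (ltP 0 t) => h; first by rewrite sube0.
  by congr EFin; apply/eqP; rewrite eq_le t0 h.
pose F p x := \sum_(p' <- s) p.1 * p'.1 * \1_(`]0, Num.min p.2 p'.2]) x.
have FE x : (span_indic s x ^+ 2)%:E =
    (\sum_(p <- s) \sum_(p' <- s) (p.1 * p'.1 * \1_(`]0, Num.min p.2 p'.2]) x)%:E)%E.
  by rewrite span_indic_sqr -sumEFin; apply: eq_bigr => p _; rewrite -sumEFin.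
have I2 (p : R * R) : mu.-integrable `[0%R, +oo[
    (fun x => \sum_(p' <- s) (p.1 * p'.1 * \1_(`]0, Num.min p.2 p'.2]) x)%:E)%E.
  by apply: integrable_sum => // p' _; exact: I1.
split.
  rewrite (_ : EFin \o _ = (fun x => \sum_(p <- s) \sum_(p' <- s)
    (p.1 * p'.1 * \1_(`]0, Num.min p.2 p'.2]) x)%:E)%E); last by apply/funext => x /=; rewrite FE.
  by apply: integrable_sum => // p _; exact: I2.
under eq_integral do rewrite FE.
rewrite integral_sum//.
rewrite /norm2 -sumEFin big_seq [RHS]big_seq; apply: eq_bigr => p ps.
rewrite integral_sum//.
rewrite -sumEFin big_seq [RHS]big_seq; apply: eq_bigr => p' ps'.
by rewrite E1// le_min !s0.
Qed.

Lemma measurable_span_indic s : measurable_fun setT (span_indic s).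
Proof.
apply: measurable_sum => p; apply: measurable_funM; first exact: measurable_cst.
exact: measurable_indic.
Qed.

Lemma measurable_step_function (g : R -> R) : step_functions g -> measurable_fun setT g.
Proof.
move=> [m [_ [a [b [c ->]]]]]; apply: measurable_sum => j.
by apply: measurable_funM; [exact: measurable_cst|exact: measurable_indic].
Qed.

Lemma integral_halfline_sqr (f h : R -> R) : measurable_fun setT f -> measurable_fun setT h ->
  (forall x, 0 < x -> f x = h x) ->
  (\int[mu]_(x in `[0%R, +oo[) (f x ^+ 2)%:E = \int[mu]_(x in `[0%R, +oo[) (h x ^+ 2)%:E)%E.
Proof.
move=> mf mh fh.
have m (k : R -> R) (D : set R) : measurable_fun setT k -> measurable_fun D (fun x => (k x ^+ 2)%:E).
  by move=> mk; apply/measurable_EFinP; apply: measurable_funX; exact: measurable_funTS.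
rewrite -!integral_itv_obnd_cbnd; [|exact: m|exact: m].
by apply: eq_integral => x; rewrite inE /= in_itv/= andbT => x0; rewrite fh.
Qed.

End StepFunctionsAsSpans.

Section WienerIntegral.
Context {R : realType} {d : measure_display} {T : measurableType d}.
Variable P : probability T R.
Local Notation Int := (Int P).
Local Notation Ex := (Ex P).
Local Notation L2 := (L2 P).
Variable B : R -> T -> R.
Hypothesis span_sqr : forall s, nonneg_times s -> L2 (span_integral B s) /\
  Ex (fun w => span_integral B s w ^+ 2) <= 4 * (expR (2^-1 * norm2 s) - 1).

Variables (g : R -> R) (s : seq (R * R)).
Hypothesis gstep : step_functions g.
Hypothesis s0 : nonneg_times s.
Hypothesis gs : forall x, 0 < x -> g x = span_indic s x.

Let mg := measurable_step_function gstep.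
Local Notation mu := (@lebesgue_measure R).

Lemma integral_step_sqr :
  (\int[mu]_(x in `[0%R, +oo[) (g x ^+ 2)%:E = (norm2 s)%:E)%E.
Proof.
rewrite -(integral_span_indic_sqr s0).2.
by apply: integral_halfline_sqr => //; exact: measurable_span_indic.
Qed.

(** The constant sequence s approximates g. *)
Let span_isW : is_wiener_integral P B g (span_integral B s).
Proof.
split.
- split; first exact: measurable_funTS.
  by rewrite integral_step_sqr ltry.
- by apply/L2P; exact: (span_sqr s0).1.
exists (fun=> s); split=> //.
- apply: cvg_near_cst; apply: nearW => k.
  have -> : (\int[mu]_(x in `[0%R, +oo[) ((span_indic s x - g x) ^+ 2)%:E =
     \int[mu]_(x in `[0%R, +oo[) ((cst (0 : R)) x ^+ 2)%:E)%E.
    apply: (integral_halfline_sqr (f := fun x => span_indic s x - g x)).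
    - by apply: measurable_funB => //; exact: measurable_span_indic.
    - exact: measurable_cst.
    - by move=> x x0; rewrite gs// subrr.
  by apply: integral0_eq => x _; rewrite expr0n.
- apply/cvg_L2_strongE => //; [by move=> n _; exact: (span_sqr s0).1|exact: (span_sqr s0).1|].
  under [X in X @ _]eq_fun do under eq_Ex do rewrite subrr expr0n/=.
  by under [X in X @ _]eq_fun do rewrite Ex_cst; exact: cvg_cst.
Qed.

(** Two approximating sequences differ by spans of small norm2, whose images are
    small in mean square by span_sqr. *)
Let isW_unique Y : is_wiener_integral P B g Y -> {ae P, forall w, Y w = span_integral B s w}.
Proof.
move=> [_ /L2P LY [sk [sk0 gcv ccv]]].
have LZ := (span_sqr s0).1.
have LZk k : L2 (span_integral B (sk k)) by apply: (span_sqr _).1; exact: sk0.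
pose u k := sk k ++ scale_span (-1) s.
have u0 k : nonneg_times (u k).
  by apply: nonneg_times_cat; [exact: sk0|exact: nonneg_times_scale].
have uZ k w : span_integral B (u k) w = span_integral B (sk k) w - span_integral B s w.
  by rewrite -(mulN1r (span_integral B s w)) -span_integral_scale /span_integral big_cat.
have un k : (\int[mu]_(x in `[0%R, +oo[) ((span_indic (sk k) x - g x) ^+ 2)%:E = (norm2 (u k))%:E)%E.
  rewrite -(integral_span_indic_sqr (u0 k)).2.
  apply: (integral_halfline_sqr (f := fun x => span_indic (sk k) x - g x)).
  - by apply: measurable_funB => //; exact: measurable_span_indic.
  - exact: measurable_span_indic.
  - by move=> x x0; rewrite span_indic_cat span_indic_scale gs// mulN1r.
have u_0 : norm2 (u k) @[k --> \oo] --> 0.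
  have : (norm2 (u k))%:E @[k --> \oo] --> 0%E by under eq_cvg do rewrite -un.
  by move=> /fine_cvg.
have c1 : 4 * (expR (2^-1 * norm2 (u k)) - 1) @[k --> \oo] --> 0.
  have : 4 * (expR (2^-1 * norm2 (u k)) - 1) @[k --> \oo] --> 4 * (expR (2^-1 * 0) - 1).
    apply: cvgMr; apply: cvgB; last exact: cvg_cst.
    by apply: continuous_cvg; [exact: continuous_expR|exact: cvgMr].
  by rewrite mulr0 expR0 subrr mulr0.
have c2 := (cvg_L2_strongE (fun n _ => LZk n) LY).1 ccv.
have LYZ := L2B LY LZ.
have E0 : Ex (fun w => (Y w - span_integral B s w) ^+ 2) = 0.
  apply/eqP; rewrite eq_le; apply/andP; split; last by apply: Ex_ge0 => w; exact: sqr_ge0.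
  have lim : 2 * (4 * (expR (2^-1 * norm2 (u k)) - 1)) +
     2 * Ex (fun w => (span_integral B (sk k) w - Y w) ^+ 2) @[k --> \oo] --> (2 * 0 + 2 * 0 : R).
    by apply: cvgD; exact: cvgMr.
  rewrite mulr0 addr0 in lim; rewrite -(cvg_lim _ lim)//.
  apply: limr_ge; first by apply/cvg_ex; eexists; exact: lim.
  apply: nearW => k.
  have L1 := L2B (LZk k) LZ; have L2' := L2B (LZk k) LY.
  have [_ b] := span_sqr (u0 k).
  apply: (@le_trans _ _ (2 * Ex (fun w => span_integral B (u k) w ^+ 2) +
     2 * Ex (fun w => (span_integral B (sk k) w - Y w) ^+ 2))); last by rewrite lerD2r ler_wpM2l.
  have -> : (fun w => span_integral B (u k) w ^+ 2) = (fun w => (span_integral B (sk k) w - span_integral B s w) ^+ 2).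
    by apply/funext => w; rewrite uZ.
  rewrite -!ExZ; [|exact: L2'.2|exact: L1.2].
  rewrite -ExD; [|apply: IntZ; exact: L1.2|apply: IntZ; exact: L2'.2].
  apply: Ex_le; [exact: LYZ.2|by apply: IntD; apply: IntZ; [exact: L1.2|exact: L2'.2]|].
  move=> w; have := sqr_ge0 ((span_integral B (sk k) w - span_integral B s w) + (span_integral B (sk k) w - Y w)).
  nra.
have := Ex_eq0 LYZ.2 (fun w => sqr_ge0 _) E0.
by apply: filterS => w /eqP; rewrite sqrf_eq0 subr_eq0 => /eqP.
Qed.

Lemma wiener_integral_span :
  wiener_integral P B g \in Lfun P 2%:E /\
  {ae P, forall w, wiener_integral P B g w = span_integral B s w}.
Proof.
have h : is_wiener_integral P B g (wiener_integral P B g).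
  by rewrite /wiener_integral; case: xgetP => [y -> //|/(_ (span_integral B s)) []]; exact: span_isW.
by split; [case: h|exact: isW_unique].
Qed.

Lemma wick_exp_limit : mea (wick_exp P B g) /\
  {ae P, forall w, wick_exp P B g w = wick_limit B s w}.
Proof.
have [/L2P LW aeW] := wiener_integral_span.
split.
  apply: mea_comp; first exact: measurable_expR.
  by apply: meaB; [exact: LW.1|exact: mea_cst].
apply: filterS aeW => w ww; rewrite /wick_exp /wick_limit ww; congr (expR (_ - _ * _)).
by rewrite /Rintegral integral_step_sqr.
Qed.

(** A step function vanishes beyond span_end s, so the partial products are
    eventually constant. *)
Lemma discrete_wick_exp_prod n (x : nat -> T -> R) w : (0 < n)%N ->
  discrete_wick_exp n x (grid g n) w =
  \prod_(i <- walk_range (span_end s) n) (1 + wick_coef s n i * x i w).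
Proof.
move=> n0; apply/cvg_lim => //; apply: cvg_near_cst.
pose N := Num.truncn (n%:R * span_end s).
exists N => // M /= NM.
have e0 := span_end_ge0 s0.
rewrite (big_cat_nat (n := N.+1))//= [X in _ * X]big_nat_cond [X in _ * X]big1 ?mulr1; last first.
  move=> i; rewrite andbT => /andP[Ni _].
  have i0 : (0 < i)%N by apply: leq_trans Ni.
  have x0 : 0 < i%:R / n%:R :> R by rewrite divr_gt0 ?ltr0n.
  rewrite /grid gs// /span_indic big_seq big1 ?mulr0 ?mul0r ?addr0// => p ps.
  rewrite indicE memNset ?mulr0//= in_itv/= => /andP[_ h].
  have := le_trans h (le_span_end s0 ps).
  rewrite ler_pdivrMr ?ltr0n// mulrC -truncn_ge_nat ?mulr_ge0// -/N.
  by rewrite leqNgt Ni.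
rewrite /walk_range -/N big_nat_cond [RHS]big_nat_cond; apply: eq_bigr => i.
rewrite andbT => /andP[i0 _]; rewrite /grid /wick_coef gs//.
by rewrite divr_gt0 ?ltr0n.
Qed.

End WienerIntegral.

(** * Uniform integrability and convergence in distribution *)

Section Tails.
Context {R : realType} {d : measure_display} {T : measurableType d}.
Variable P : probability T R.
Local Notation Int := (Int P).
Local Notation Ex := (Ex P).
Local Notation L2 := (L2 P).

Definition tail_part (K x : R) : R := if K < x ^+ 2 then x ^+ 2 else 0.
Definition tail (K : R) (f : T -> R) : R := Ex (fun w => tail_part K (f w)).

Lemma tail_part_ge0 K x : 0 <= tail_part K x.
Proof. by rewrite /tail_part; case: ifP => // _; exact: sqr_ge0. Qed.

Lemma tail_part_le K x : tail_part K x <= x ^+ 2.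
Proof. by rewrite /tail_part; case: ifP => // _; exact: sqr_ge0. Qed.

Lemma tail_part_anti K K' x : K <= K' -> tail_part K' x <= tail_part K x.
Proof.
rewrite /tail_part => KK'; case: ifP => h; first by rewrite (le_lt_trans KK' h).
by case: ifP => // _; exact: sqr_ge0.
Qed.

Lemma mea_tail_part K (f : T -> R) : mea f -> mea (fun w => tail_part K (f w)).
Proof.
move=> mf; apply: measurable_fun_ifT.
- apply: measurable_fun_ltr; [exact: mea_cst|exact: mea_sqr].
- exact: mea_sqr.
- exact: mea_cst.
Qed.

Lemma Int_tail_part K f : L2 f -> Int (fun w => tail_part K (f w)).
Proof.
move=> [mf If]; apply: (Int_le (mea_tail_part K mf) _ If) => w.
by rewrite ger0_norm ?tail_part_ge0// tail_part_le.
Qed.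

Lemma tail_ge0 K f : 0 <= tail K f.
Proof. by apply: Ex_ge0 => w; exact: tail_part_ge0. Qed.

Lemma tail_anti K K' f : L2 f -> K <= K' -> tail K' f <= tail K f.
Proof.
by move=> Lf KK'; apply: Ex_le => [||w]; [exact: Int_tail_part|exact: Int_tail_part|exact: tail_part_anti].
Qed.

Lemma tail_small f e : L2 f -> 0 < e -> exists K0, forall K, K0 <= K -> tail K f <= e.
Proof.
move=> Lf e0.
have [_] : Int (fun=> 0) /\ Ex (fun w => tail_part k%:R (f w)) @[k --> \oo] --> Ex (fun=> 0).
  apply: (@DCT _ _ _ P _ _ (fun w => f w ^+ 2)).
  - by move=> k; apply: mea_tail_part; exact: Lf.1.
  - exact: mea_cst.
  - exact: Lf.2.
  - by move=> k w; rewrite ger0_norm ?tail_part_ge0// tail_part_le.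
  apply: aeW => w; apply: cvg_eq_near (cvg_cst 0).
  exists (Num.truncn (f w ^+ 2)).+1 => // k /= hk.
  rewrite /tail_part ltNge (_ : f w ^+ 2 <= k%:R)//.
  by apply: (le_trans (ltW (truncnS_gt _))); rewrite ler_nat.
rewrite Ex_cst => /cvgrPdist_le/(_ _ e0) [N _ /(_ N (leqnn N))] /=.
rewrite sub0r normrN => h; exists N%:R => K NK.
apply: (le_trans (tail_anti Lf NK)); exact: le_trans (ler_norm _) h.
Qed.

(** Uniform integrability of the squares, with real expectations; see
    uniformly_integrableP. *)
Definition small_tails (X : nat -> T -> R) := forall e, 0 < e ->
  exists K0, forall K, K0 <= K -> forall n, (0 < n)%N -> tail K (X n) <= e.

(** Where x^2 > K, either x^2 <= 4 z^2, so that z^2 > K / 4 and the tail of Z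
    controls x^2, or |x| <= 2 |x - z|. Finitely many indices are treated
    separately. *)
Lemma small_tails_L2 (X : nat -> T -> R) (Z : T -> R) :
  (forall n, (0 < n)%N -> L2 (X n)) -> L2 Z ->
  Ex (fun w => (X n w - Z w) ^+ 2) @[n --> \oo] --> 0 -> small_tails X.
Proof.
move=> LX LZ cv e e0.
have e8 : 0 < e / 8 by rewrite divr_gt0.
have [K1 HK1] := tail_small LZ e8.
have /cvgrPdist_le/(_ _ e8) [N _ HN] := cv.
have [K2 HK2] : exists K2, forall K, K2 <= K -> forall n, (n < N)%N -> (0 < n)%N -> tail K (X n) <= e.
  elim: {HN} N => [|N [K2 HK2]]; first by exists 0.
  case: (posnP N) => [->|N0]; first by exists 0 => K _ [|n].
  have [K3 HK3] := tail_small (LX N N0) e0.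
  exists (Num.max K2 K3) => K; rewrite ge_max => /andP[h2 h3] n; rewrite ltnS leq_eqVlt => /orP[/eqP -> _|nN n0].
    exact: HK3.
  exact: HK2.
exists (Num.max K2 (4 * K1)) => K; rewrite ge_max => /andP[h2 h3] n n0.
have [nN|Nn] := ltnP n N; first exact: HK2.
have h : Ex (fun w => (X n w - Z w) ^+ 2) <= e / 8.
  by have := HN n Nn; rewrite /= sub0r normrN; apply: le_trans; exact: ler_norm.
have hZ : tail (4^-1 * K) Z <= e / 8 by apply: HK1; lra.
have LD := L2B (LX n n0) LZ.
have It := Int_tail_part (4^-1 * K) LZ.
apply: (@le_trans _ _ (4 * Ex (fun w => (X n w - Z w) ^+ 2) + 4 * tail (4^-1 * K) Z)); last lra.
rewrite -!ExZ//; last exact: LD.2.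
rewrite -ExD; [|apply: IntZ; exact: LD.2|exact: IntZ].
apply: Ex_le; [exact/Int_tail_part/LX|by apply: IntD; apply: IntZ => //; exact: LD.2|].
move=> w; move: (X n w) (Z w) => x z; rewrite {1}/tail_part; case: ifP => [Kx|_]; last first.
  by rewrite addr_ge0// mulr_ge0 ?sqr_ge0 ?tail_part_ge0.
have [xz|zx] := leP (x ^+ 2) (4 * z ^+ 2).
  have -> : tail_part (4^-1 * K) z = z ^+ 2 by rewrite /tail_part ifT//; lra.
  by have := sqr_ge0 (x - z); lra.
have t0 := tail_part_ge0 (4^-1 * K) z.
suff : x ^+ 2 <= 4 * (x - z) ^+ 2 by lra.
have zx' : `|2 * z| <= `|x|.
  rewrite -(@ler_pXn2r _ 2)// ?nnegrE// !real_normK ?num_real//; rewrite exprMn; lra.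
have : `|x| <= `|2 * (x - z)|.
  have -> : 2 * (x - z) = (x + x) - 2 * z by ring.
  apply: le_trans (lerB_normD _ _); rewrite normrN.
  have -> : `|x + x| = `|x| + `|x| by rewrite -mulr2n normrMn mulr2n.
  lra.
by rewrite -(@ler_pXn2r _ 2)// ?nnegrE// !real_normK ?num_real// exprMn => h4; lra.
Qed.

Lemma uniformly_integrableP (X : nat -> T -> R) : (forall n, (0 < n)%N -> L2 (X n)) ->
  uniformly_integrable P [set n : nat | (0 < n)%N] (fun n w => X n w ^+ 2) <-> small_tails X.
Proof.
move=> LX.
have E K n : (0 < n)%N ->
    (\int[P]_(w in [set w | (K < `|X n w ^+ 2|)%R]) (`|X n w ^+ 2|%R)%:E)%E = (tail K (X n))%:E.
  move=> n0; rewrite -EFin_Ex; last exact/Int_tail_part/LX.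
  rewrite integral_mkcond; apply: eq_integral => w _.
  rewrite /patch /tail_part ger0_norm ?sqr_ge0//.
  case: ifPn => [/set_mem /=|]; first by rewrite ger0_norm ?sqr_ge0// => ->.
  by rewrite notin_setE /= ger0_norm ?sqr_ge0// => /negP/negbTE ->.
pose S K := ereal_sup [set (\int[P]_(w in [set w | (K < `|X i w ^+ 2|)%R]) (`|X i w ^+ 2|%R)%:E)%E
            | i in [set n : nat | (0 < n)%N]].
have S0 K : (0 <= S K)%E.
  apply: (@le_trans _ _ (tail K (X 1%N))%:E); first by rewrite lee_fin tail_ge0.
  by apply: ereal_sup_ubound; exists 1%N => //; exact: E.
have Se K e : (forall n, (0 < n)%N -> tail K (X n) <= e) -> (S K <= e%:E)%E.
  by move=> h; apply: ge_ereal_sup => _ [n n0 <-]; rewrite E// lee_fin h.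
rewrite /uniformly_integrable -/S; split.
  move=> /fine_cvgP[[M1 [M1r HM1]] /cvgrPdist_le H] e e0.
  have [M2 [M2r HM2]] := H _ e0.
  exists (Num.max M1 M2 + 1) => K hK n n0.
  have [K1 K2] : M1 < K /\ M2 < K.
    by split; apply: lt_le_trans hK; rewrite ltr_pwDr// le_max lexx ?orbT.
  have f := HM1 _ K1; have := HM2 _ K2; rewrite /= sub0r normrN => h.
  rewrite -lee_fin; apply: (@le_trans _ _ (S K)).
    by rewrite -E//; apply: ereal_sup_ubound; exists n.
  by rewrite -(fineK f) lee_fin; exact: le_trans (ler_norm _) h.
move=> H; apply/fine_cvgP; split.
  have [K0 HK0] := H _ ltr01; exists K0; split; first exact: num_real.
  move=> K hK; rewrite ge0_fin_numE ?S0//.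
  by apply: le_lt_trans (Se K 1 _) (ltry _); apply: HK0; exact: ltW.
apply/cvgrPdist_le => e e0; have [K0 HK0] := H _ e0.
exists K0; split; first exact: num_real.
move=> K hK /=; rewrite sub0r normrN ger0_norm; last by apply: fine_ge0; exact: S0.
have h := Se K e (HK0 K (ltW hK)).
by rewrite -lee_fin fineK// ge0_fin_numE ?S0//; apply: le_lt_trans h (ltry _).
Qed.

End Tails.

Section Distribution.
Context {R : realType} {d : measure_display} {T : measurableType d}.
Variable P : probability T R.
Local Notation Int := (Int P).
Local Notation Ex := (Ex P).
Local Notation L2 := (L2 P).

(** The pair of grid approximations takes countably many values, so any
    function of it is measurable. *)
Lemma mea_floor_pair (phi : R * R -> R) (X Y : T -> R) (k : R) : mea X -> mea Y ->
  mea (fun w => phi ((Num.floor (k * X w))%:~R / k, (Num.floor (k * Y w))%:~R / k)).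
Proof.
move=> mX mY; rewrite /mea => _ U mU; rewrite setTI.
have mfl (Z : T -> R) i : mea Z -> measurable [set w | Num.floor (k * Z w) = i].
  move=> mZ.
  have -> : [set w | Num.floor (k * Z w) = i] = (fun w => k * Z w) @^-1` `[i%:~R, (i + 1)%:~R[.
    apply/seteqP; split => w /=; rewrite in_itv/=.
      by move=> <-; exact: floor_itv.
    by move=> h; apply/eqP; rewrite floor_eq.
  rewrite -[X in measurable X]setTI; apply: (meaM (mea_cst k) mZ) => //.
pose A (n : nat) : set T := if unpickle n is Some (i, j) then
  (if `[< U (phi (i%:~R / k, j%:~R / k)) >] then
   [set w | Num.floor (k * X w) = i] `&` [set w | Num.floor (k * Y w) = j] else set0) else set0.
rewrite (_ : _ @^-1` _ = \bigcup_n A n).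
  apply: bigcupT_measurable => n; rewrite /A; case: unpickle => [[i j]|//].
  by case: asboolP => // _; apply: measurableI; exact: mfl.
apply/seteqP; split => w /=.
  move=> Uw; exists (pickle (Num.floor (k * X w), Num.floor (k * Y w))) => //.
  by rewrite /A pickleK; case: asboolP.
by move=> [n _]; rewrite /A; case: unpickle => [[i j]|//]; case: asboolP => // h [/= -> ->].
Qed.

Lemma cvg_floor_ratio (x : R) : (Num.floor (n.+1%:R * x))%:~R / n.+1%:R @[n --> \oo] --> x.
Proof.
apply: (@squeeze_cvgr _ _ _ _ (fun n => x - n.+1%:R^-1) (fun=> x)).
- apply: nearW => n; have n0 : 0 < n.+1%:R :> R by rewrite ltr0n.
  have /andP[h1 h2] := floor_itv (n.+1%:R * x).
  rewrite ler_pdivlMr// ler_pdivrMr// [x * _]mulrC h1 andbT mulrBl mulVf ?gt_eqF// mulrC.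
  by move: h2; rewrite intrD => h2; lra.
- rewrite -[X in _ --> X](subr0 x); apply: cvgB; first exact: cvg_cst.
  exact: cvg_harmonic.
- exact: cvg_cst.
Qed.

Lemma cvg_continuous_pair (phi : R * R -> R) (u v : nat -> R) (x y : R) : continuous phi ->
  u n @[n --> \oo] --> x -> v n @[n --> \oo] --> y ->
  phi (u n, v n) @[n --> \oo] --> phi (x, y).
Proof.
move=> cphi ux vy.
have h : (u n, v n) @[n --> \oo] --> (x, y) := @cvg_pair _ _ _ _ _ _ _ _ _ u v ux vy.
exact: (cvg_comp (fun n => (u n, v n)) phi (h _ _ _) (cphi (x, y))).
Qed.

(** Continuity makes phi (X, Y) the limit of its values at grid
    approximations of the pair. *)
Lemma mea_continuous_pair (phi : R * R -> R) (X Y : T -> R) : continuous phi ->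
  mea X -> mea Y -> mea (fun w => phi (X w, Y w)).
Proof.
move=> cphi mX mY.
apply: (mea_cvg (f_ := fun n w => phi ((Num.floor (n.+1%:R * X w))%:~R / n.+1%:R,
   (Num.floor (n.+1%:R * Y w))%:~R / n.+1%:R))).
  by move=> n; exact: mea_floor_pair.
by move=> w; apply: cvg_continuous_pair => //; exact: cvg_floor_ratio.
Qed.

Lemma bounded_Ex (phi : R * R -> R) M (X Y : T -> R) : continuous phi ->
  (forall v, `|phi v| <= M) -> mea X -> mea Y ->
  Int (fun w => phi (X w, Y w)).
Proof.
move=> c b mX mY; apply: (Int_le _ _ (Int_cst P M)) => [|w]; last exact: b.
exact: mea_continuous_pair.
Qed.

Lemma cvg_in_distributionP (X Y : nat -> T -> R) (X0 Y0 : T -> R) :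
  (forall n, (0 < n)%N -> mea (X n)) -> (forall n, (0 < n)%N -> mea (Y n)) -> mea X0 -> mea Y0 ->
  cvg_in_distribution P (fun n w => (X n w, Y n w)) (fun w => (X0 w, Y0 w)) <->
  forall phi : R * R -> R, continuous phi -> (exists M, forall v, `|phi v| <= M) ->
    Ex (fun w => phi (X n w, Y n w)) @[n --> \oo] --> Ex (fun w => phi (X0 w, Y0 w)).
Proof.
move=> mX mY mX0 mY0; split => H phi c [M b].
  have := H phi c (ex_intro _ M b); rewrite (expectation_Ex (bounded_Ex c b mX0 mY0)).
  move=> /fine_cvg; apply: cvg_eq_pos => n n0 /=.
  by rewrite (expectation_Ex (bounded_Ex c b (mX n n0) (mY n n0))).
rewrite (expectation_Ex (bounded_Ex c b mX0 mY0)).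
have : (Ex (fun w => phi (X n w, Y n w)))%:E @[n --> \oo] --> (Ex (fun w => phi (X0 w, Y0 w)))%:E.
  by apply: cvg_EFin; [exact: nearW|exact: H (ex_intro _ M b)].
apply: cvg_eq_pos => n n0 /=.
by rewrite (expectation_Ex (bounded_Ex c b (mX n n0) (mY n n0))).
Qed.

(** A bounded continuous function of the pair converges along almost surely
    convergent extractions by dominated convergence. *)
Lemma cvg_in_distribution_L2 (X Y : nat -> T -> R) (X0 Y0 : T -> R) :
  (forall n, (0 < n)%N -> L2 (X n)) -> (forall n, (0 < n)%N -> L2 (Y n)) -> L2 X0 -> L2 Y0 ->
  Ex (fun w => (X n w - X0 w) ^+ 2) @[n --> \oo] --> 0 ->
  Ex (fun w => (Y n w - Y0 w) ^+ 2) @[n --> \oo] --> 0 ->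
  cvg_in_distribution P (fun n w => (X n w, Y n w)) (fun w => (X0 w, Y0 w)).
Proof.
move=> LX LY LX0 LY0 cX cY.
apply/cvg_in_distributionP; try by [move=> n n0; exact: (LX n n0).1|move=> n n0; exact: (LY n n0).1|exact: LX0.1|exact: LY0.1].
move=> phi c [M b]; apply: cvg_of_extractions => h hn.
have LDX n (n0 : (0 < n)%N) := L2B (LX n n0) LX0.
have LDY n (n0 : (0 < n)%N) := L2B (LY n n0) LY0.
pose h1 n := h n.+1.
have h1n n : (n <= h1 n)%N by apply: leq_trans (hn n.+1).
have h10 n : (0 < h1 n)%N by apply: leq_trans (hn n.+1).
have [||| k [kn kcv]] := @ae_extraction _ _ _ P (fun n w => (X (h1 n) w - X0 w) ^+ 2 + (Y (h1 n) w - Y0 w) ^+ 2).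
- by move=> n; apply: IntD; [exact: (LDX _ (h10 n)).2|exact: (LDY _ (h10 n)).2].
- by move=> n w; rewrite addr_ge0 ?sqr_ge0.
- rewrite [X in X @ _](_ : _ = (fun n => Ex (fun w => (X (h1 n) w - X0 w) ^+ 2) + Ex (fun w => (Y (h1 n) w - Y0 w) ^+ 2))); last first.
    by apply/funext => n; rewrite ExD//; [exact: (LDX _ (h10 n)).2|exact: (LDY _ (h10 n)).2].
  rewrite -[X in _ --> X](addr0 0); apply: cvgD.
    exact: (cvg_extracted (u := fun n => Ex (fun w => (X n w - X0 w) ^+ 2)) h1n).
  exact: (cvg_extracted (u := fun n => Ex (fun w => (Y n w - Y0 w) ^+ 2)) h1n).
exists (fun n => (k n).+1); split; first by move=> n; exact: leq_trans (kn n) _.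
suff [] : Int (fun w => phi (X0 w, Y0 w)) /\
  Ex (fun w => phi (X (h1 (k n)) w, Y (h1 (k n)) w)) @[n --> \oo] --> Ex (fun w => phi (X0 w, Y0 w)) by [].
apply: (DCT (g := fun=> M)).
- move=> n; apply: mea_continuous_pair => //; [exact: (LX _ (h10 _)).1|exact: (LY _ (h10 _)).1].
- by apply: mea_continuous_pair => //; [exact: LX0.1|exact: LY0.1].
- exact: Int_cst.
- by move=> n w; exact: b.
apply: filterS kcv => w hw.
have cvs (u : nat -> R) (v : R) : (forall n, (u n - v) ^+ 2 <= (X (h1 (k n)) w - X0 w) ^+ 2 + (Y (h1 (k n)) w - Y0 w) ^+ 2) ->
    u n @[n --> \oo] --> v.
  move=> le; apply: cvg_of_sub0; apply: cvg_sqr0.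
  apply: (@squeeze_cvgr _ _ _ _ (fun=> 0) _ _ _ _ _ hw); last exact: cvg_cst.
  by apply: nearW => n; rewrite sqr_ge0 le.
by apply: cvg_continuous_pair => //; apply: cvs => n; rewrite ?lerDl ?lerDr sqr_ge0.
Qed.

(** Convergence in distribution extends from bounded functions to functions
    of quadratic growth under uniform integrability: truncating h at level K
    costs at most the sum of the two tails. *)
Lemma cvg_Ex_small_tails (X Y : nat -> T -> R) (X0 Y0 : T -> R) (h : R * R -> R) :
  (forall n, (0 < n)%N -> L2 (X n)) -> (forall n, (0 < n)%N -> L2 (Y n)) -> L2 X0 -> L2 Y0 ->
  small_tails P X -> small_tails P Y ->
  cvg_in_distribution P (fun n w => (X n w, Y n w)) (fun w => (X0 w, Y0 w)) ->
  continuous h -> (forall v, `|h v| <= Num.max (v.1 ^+ 2) (v.2 ^+ 2)) ->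
  Ex (fun w => h (X n w, Y n w)) @[n --> \oo] --> Ex (fun w => h (X0 w, Y0 w)).
Proof.
move=> LX LY LX0 LY0 tX tY cd ch bh.
have {}cd := (cvg_in_distributionP (fun n n0 => (LX n n0).1) (fun n n0 => (LY n n0).1) LX0.1 LY0.1).1 cd.
apply/cvgrPdist_le => e e0; have e6 : 0 < e / 6 by rewrite divr_gt0.
have [KX HX] := tX _ e6; have [KY HY] := tY _ e6.
have [KX0 HX0] := tail_small LX0 e6; have [KY0 HY0] := tail_small LY0 e6.
pose K := `|KX| + `|KY| + `|KX0| + `|KY0|.
have [K0 K1 K2 K3 K4] : [/\ 0 <= K, KX <= K, KY <= K, KX0 <= K & KY0 <= K].
  have := ler_norm KX; have := ler_norm KY; have := ler_norm KX0; have := ler_norm KY0.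
  have := normr_ge0 KX; have := normr_ge0 KY; have := normr_ge0 KX0; have := normr_ge0 KY0.
  by rewrite /K => *; split; lra.
have cl (U V : T -> R) : L2 U -> L2 V ->
    `|Ex (fun w => h (U w, V w)) - Ex (fun w => clamp K (h (U w, V w)))| <= tail P K U + tail P K V.
  move=> LU LV.
  have mh : mea (fun w => h (U w, V w)) by apply: mea_continuous_pair => //; [exact: LU.1|exact: LV.1].
  have Ih : Int (fun w => h (U w, V w)).
    apply: (Int_le mh _ (IntD LU.2 LV.2)) => w; apply: (le_trans (bh _)) => /=.
    by rewrite ge_max lerDl lerDr !sqr_ge0.
  have Ic : Int (fun w => clamp K (h (U w, V w))).
    apply: (Int_le _ _ (Int_cst P K)); last by move=> w; exact: clamp_le.
    by apply: mea_comp => //; exact: measurable_clamp.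
  rewrite -ExB//; apply: (le_trans (Ex_norm (IntB Ih Ic))).
  rewrite /tail -ExD; [|exact: Int_tail_part|exact: Int_tail_part].
  apply: Ex_le; [exact/Int_norm/IntB|by apply: IntD; exact: Int_tail_part|].
  move=> w; have := bh (U w, V w); move: (h _) => y /=; move: (U w) (V w) => u v yb.
  have [yK|Ky] := leP `|y| K.
    by rewrite clamp_id// subrr normr0 addr_ge0 ?tail_part_ge0.
  apply: (le_trans (sub_clamp_le _ K0)).
  have := lt_le_trans Ky yb; rewrite lt_max.
  have tu := tail_part_ge0 K u; have tv := tail_part_ge0 K v.
  move: yb; rewrite le_max => /orP[] yb _.
    have : tail_part K u = u ^+ 2 by rewrite /tail_part (lt_le_trans Ky yb).
    by move=> E; rewrite E in tu *; lra.
  have : tail_part K v = v ^+ 2 by rewrite /tail_part (lt_le_trans Ky yb).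
  by move=> E; rewrite E in tv *; lra.
have := cd (fun v => clamp K (h v)).
have cch : continuous (fun v => clamp K (h v)).
  by move=> v; apply: continuous_comp; [exact: ch|exact: continuous_clamp].
move=> /(_ cch (ex_intro _ K (fun v => clamp_le _ K0))) /cvgrPdist_le/(_ _ (_ : 0 < e / 3)).
have e3 : 0 < e / 3 by rewrite divr_gt0.
move=> /(_ e3) [N _ HN]; exists N.+1 => // n /= hn.
have n0 : (0 < n)%N by apply: leq_trans hn.
have := HN n (ltnW hn) => /= h1.
have h2 := cl _ _ LX0 LY0; have h3 := cl _ _ (LX n n0) (LY n n0).
have t1 := HX K K1 n n0; have t2 := HY K K2 n n0; have t3 := HX0 K K3; have t4 := HY0 K K4.
move: h1 h2 h3; rewrite !ler_norml => /andP[? ?] /andP[? ?] /andP[? ?].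
by apply/andP; split; lra.
Qed.

End Distribution.

(** * Strong and weak convergence tested on a total family *)

Section TestSequences.
Context {R : realType} {d : measure_display} {T : measurableType d}.
Variable P : probability T R.
Local Notation Int := (Int P).
Local Notation Ex := (Ex P).
Local Notation L2 := (L2 P).
Local Notation nrm := (nrm P).

Variables (X : T -> R) (Xn : nat -> T -> R).
Hypothesis LX : L2 X.
Hypothesis LXn : forall n, (0 < n)%N -> L2 (Xn n).

Definition L2_bounded := exists C, forall n, (0 < n)%N -> Ex (fun w => Xn n w ^+ 2) <= C.

Definition weakly_cvg := forall V, L2 V ->
  Ex (fun w => Xn n w * V w) @[n --> \oo] --> Ex (fun w => X w * V w).

Definition strongly_cvg := Ex (fun w => (Xn n w - X w) ^+ 2) @[n --> \oo] --> 0.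

Definition norms_cvg :=
  Ex (fun w => Xn n w ^+ 2) @[n --> \oo] --> Ex (fun w => X w ^+ 2).

Lemma L2_bounded_nrm : L2_bounded -> exists M, [/\ 0 < M, nrm X <= M &
  forall n, (0 < n)%N -> nrm (Xn n) <= M].
Proof.
move=> [C HC]; exists (Num.sqrt C + nrm X + 1).
have s0 := sqrtr_ge0 C; have n0 := nrm_ge0 P X.
split=> [||n n1]; [lra|lra|].
have : nrm (Xn n) <= Num.sqrt C by rewrite ler_wsqrtr// HC.
lra.
Qed.

Lemma cvg_nrm0 (D : nat -> T -> R) :
  Ex (fun w => D n w ^+ 2) @[n --> \oo] --> 0 -> nrm (D n) @[n --> \oo] --> 0.
Proof. by move=> h; apply: cvg_sqr0; under eq_cvg do rewrite nrm_sqr. Qed.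

(** Bounded against null in L2: this is what allows a test function to vary
    with n. *)
Lemma cvg_Ex_bounded_null (D : nat -> T -> R) : L2_bounded ->
  (forall n, (0 < n)%N -> L2 (D n)) -> Ex (fun w => D n w ^+ 2) @[n --> \oo] --> 0 ->
  Ex (fun w => Xn n w * D n w) @[n --> \oo] --> 0.
Proof.
move=> /L2_bounded_nrm [M [M0 _ HM]] LD /cvg_nrm0 cD.
have c1 : M * nrm (D n) @[n --> \oo] --> 0 by rewrite -(mulr0 M); exact: cvgMr.
apply/norm_cvg0P; apply: (@squeeze_cvgr _ _ _ _ (fun=> 0) _ _ _ _ _ c1); last exact: cvg_cst.
exists 1%N => // n /= n0; rewrite normr_ge0/=.
by apply: (le_trans (Ex_mul_le_nrm (LXn n0) (LD n n0))); rewrite ler_wpM2r ?nrm_ge0// HM.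
Qed.

(** For a bounded sequence, convergence of the pairings with V follows from
    convergence of those with functions close to V. *)
Lemma weakly_cvg_approx V : L2_bounded -> L2 V ->
  (forall e, 0 < e -> exists f, [/\ L2 f, nrm (fun w => V w - f w) <= e &
    Ex (fun w => Xn n w * f w) @[n --> \oo] --> Ex (fun w => X w * f w)]) ->
  Ex (fun w => Xn n w * V w) @[n --> \oo] --> Ex (fun w => X w * V w).
Proof.
move=> /L2_bounded_nrm [M [M0 XM XnM]] LV H.
apply/cvgrPdist_le => e e0; have e3 : 0 < e / (3 * M) by rewrite divr_gt0 ?mulr_gt0.
have [f [Lf fe /cvgrPdist_le cf]] := H _ e3.
have e3' : 0 < e / 3 by rewrite divr_gt0.
have [N _ HN] := cf _ e3'; exists N.+1 => // n /= Nn.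
have n0 : (0 < n)%N by apply: leq_trans Nn.
have LD := L2B LV Lf.
have E (W : T -> R) : L2 W -> Ex (fun w => W w * V w) = Ex (fun w => W w * (V w - f w)) + Ex (fun w => W w * f w).
  move=> LW; rewrite -ExD; [|exact: L2_IntM|exact: L2_IntM].
  by apply: eq_Ex => w; rewrite -mulrDr subrK.
have bd (W : T -> R) : L2 W -> nrm W <= M -> `|Ex (fun w => W w * (V w - f w))| <= e / 3.
  move=> LW WM; apply: (le_trans (Ex_mul_le_nrm LW LD)).
  have -> : e / 3 = M * (e / (3 * M)) by field; rewrite gt_eqF.
  by apply: ler_pM; rewrite ?nrm_ge0.
rewrite (E X)// (E (Xn n))//; last exact: LXn.
have := bd _ LX XM; have := bd _ (LXn n0) (XnM n n0); have := HN n (ltnW Nn).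
move=> /=; rewrite !ler_norml => /andP[? ?] /andP[? ?] /andP[? ?].
by apply/andP; split; lra.
Qed.

(** Convergent sequences of pairings are bounded, and uniform boundedness
    applies. *)
Lemma weakly_cvg_bounded : weakly_cvg -> L2_bounded.
Proof.
move=> wk; have [|V LV|C HC] := @L2_uniform_boundedness _ _ _ P (fun n => Xn n.+1).
- by move=> n; exact: LXn.
- have /cvg_seq_bounded [M [_ HM]] : cvgn (fun n => Ex (fun w => Xn n w * V w)).
    by apply/cvg_ex; eexists; exact: wk.
  by exists (M + 1) => n; apply: (HM (M + 1)); rewrite ?ltrDl.
- by exists C => -[//|n] _; exact: HC.
Qed.

Lemma strongly_cvg_weakly : strongly_cvg -> L2_bounded /\ weakly_cvg.
Proof.
move=> sc.
have bX : L2_bounded.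
  have /cvg_seq_bounded [M [_ HM]] : cvgn (fun n => Ex (fun w => (Xn n w - X w) ^+ 2)).
    by apply/cvg_ex; eexists; exact: sc.
  exists (2 * (M + 1) + 2 * Ex (fun w => X w ^+ 2)) => n n0.
  have LD := L2B (LXn n0) LX.
  apply: (@le_trans _ _ (2 * Ex (fun w => (Xn n w - X w) ^+ 2) + 2 * Ex (fun w => X w ^+ 2))); last first.
    rewrite lerD2r ler_wpM2l//; apply: le_trans (ler_norm _) _.
    by apply: (HM (M + 1)); rewrite ?ltrDl.
  rewrite -!ExZ; [|exact: LX.2|exact: LD.2].
  rewrite -ExD; [|apply: IntZ; exact: LD.2|apply: IntZ; exact: LX.2].
  apply: Ex_le; [exact: (LXn n0).2|by apply: IntD; apply: IntZ; [exact: LD.2|exact: LX.2]|].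
  by move=> w; have := sqr_ge0 (Xn n w - 2 * X w); nra.
split=> // V LV.
have c0 : nrm (fun w => Xn n w - X w) * nrm V @[n --> \oo] --> 0.
  by rewrite -(mul0r (nrm V)); apply: cvgMl; exact: cvg_nrm0.
apply/cvg_of_sub0/norm_cvg0P.
apply: (@squeeze_cvgr _ _ _ _ (fun=> 0) _ _ _ _ _ c0); last exact: cvg_cst.
exists 1%N => // n /= n0; rewrite normr_ge0/=.
have LD := L2B (LXn n0) LX.
rewrite -ExB; [|exact: (L2_IntM (LXn n0) LV)|exact: (L2_IntM LX LV)].
apply: le_trans (Ex_mul_le_nrm LD LV).
by rewrite le_eqVlt; apply/orP; left; apply/eqP; congr `|_|; apply: eq_Ex => w; rewrite mulrBl.
Qed.

Lemma Ex_sqr_sub n : (0 < n)%N -> Ex (fun w => (Xn n w - X w) ^+ 2) =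
  Ex (fun w => Xn n w ^+ 2) - 2 * Ex (fun w => Xn n w * X w) + Ex (fun w => X w ^+ 2).
Proof.
move=> n0; have L := LXn n0; have I := L2_IntM L LX.
rewrite -ExZ// -ExB; [|exact: L.2|exact: IntZ].
rewrite -ExD; [|by apply: IntB; [exact: L.2|exact: IntZ]|exact: LX.2].
by apply: eq_Ex => w; ring.
Qed.

(** Expand the square of Xn - X. *)
Lemma strongly_cvgE : strongly_cvg <-> weakly_cvg /\ norms_cvg.
Proof.
have EX : Ex (fun w => X w * X w) = Ex (fun w => X w ^+ 2) by apply: eq_Ex => w; rewrite expr2.
split=> [sc|[wk nc]].
  have [_ wk] := strongly_cvg_weakly sc; split=> //.
  have h : Ex (fun w => (Xn n w - X w) ^+ 2) + 2 * Ex (fun w => Xn n w * X w) - Ex (fun w => X w ^+ 2)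
     @[n --> \oo] --> 0 + 2 * Ex (fun w => X w * X w) - Ex (fun w => X w ^+ 2).
    by apply: cvgB; [apply: cvgD => //; apply: cvgMr; exact: wk|exact: cvg_cst].
  move: h; rewrite EX add0r mulrDl mul1r addrK.
  by apply: cvg_eq_pos => n n0; rewrite Ex_sqr_sub//; ring.
have h : Ex (fun w => Xn n w ^+ 2) - 2 * Ex (fun w => Xn n w * X w) + Ex (fun w => X w ^+ 2)
     @[n --> \oo] --> Ex (fun w => X w ^+ 2) - 2 * Ex (fun w => X w * X w) + Ex (fun w => X w ^+ 2).
  by apply: cvgD; [apply: cvgB => //; apply: cvgMr; exact: wk|exact: cvg_cst].
move: h; rewrite EX (_ : _ - _ + _ = 0); last by ring.
by apply: cvg_eq_pos => n n0; rewrite Ex_sqr_sub.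
Qed.

Lemma norms_cvg_bounded : norms_cvg -> L2_bounded.
Proof.
move=> nc; have /cvg_seq_bounded [M [_ HM]] : cvgn (fun n => Ex (fun w => Xn n w ^+ 2)).
  by apply/cvg_ex; eexists; exact: nc.
exists (M + 1) => n _; apply: le_trans (ler_norm _) _.
by apply: (HM (M + 1)); rewrite ?ltrDl.
Qed.

Variables (I : Type) (g0 : I) (Y : I -> T -> R) (Yn : I -> nat -> T -> R).
Hypothesis LY : forall g, L2 (Y g).
Hypothesis LYn : forall g n, (0 < n)%N -> L2 (Yn g n).
Hypothesis cY : forall g, Ex (fun w => (Yn g n w - Y g w) ^+ 2) @[n --> \oo] --> 0.
Hypothesis Y_total : forall L : set (T -> R), (forall f, L f -> L2 f) ->
  (forall a f g, L f -> L g -> L (fun w => a * f w + g w)) ->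
  (forall (f_ : nat -> T -> R) f g, (forall k, L (f_ k)) -> mea f -> L2 g ->
     (forall k w, `|f_ k w| <= `|g w|) ->
     {ae P, forall w, f_ k w @[k --> \oo] --> f w} -> L f) ->
  (forall g, L (Y g)) -> forall V, L2 V -> L V.

Definition tests_cvg := forall g,
  Ex (fun w => Xn n w * Yn g n w) @[n --> \oo] --> Ex (fun w => X w * Y g w).

Let cvg_tests_diff g : L2_bounded ->
  Ex (fun w => Xn n w * Yn g n w) - Ex (fun w => Xn n w * Y g w) @[n --> \oo] --> 0.
Proof.
move=> bX; have LD n (n0 : (0 < n)%N) := L2B (LYn g n0) (LY g).
apply: cvg_eq_pos (cvg_Ex_bounded_null bX LD (cY g)) => n n0.
rewrite -ExB; [|exact: (L2_IntM (LXn n0) (LYn g n0))|exact: (L2_IntM (LXn n0) (LY g))].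
by apply: eq_Ex => w; rewrite mulrBr.
Qed.

Lemma weakly_cvg_tests : weakly_cvg -> tests_cvg.
Proof.
move=> wk g.
have : Ex (fun w => Xn n w * Yn g n w) - Ex (fun w => Xn n w * Y g w) +
    Ex (fun w => Xn n w * Y g w) @[n --> \oo] --> 0 + Ex (fun w => X w * Y g w).
  by apply: cvgD; [exact/cvg_tests_diff/weakly_cvg_bounded|exact: wk].
by rewrite add0r; apply: cvg_eq_pos => n _; rewrite subrK.
Qed.

(** The set L of the V for which the pairings converge contains the limits Y g
    of the test sequences, because the Yn g differ from Y g by a null sequence.
    It is a linear space closed under dominated limits, and Y_total makes it
    everything. *)
Lemma tests_cvg_weakly : L2_bounded -> tests_cvg -> weakly_cvg.
Proof.
move=> bX tc V LV.
suff [] : L2 V /\ Ex (fun w => Xn n w * V w) @[n --> \oo] --> Ex (fun w => X w * V w) by [].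
pose L : set (T -> R) := fun V => L2 V /\
  Ex (fun w => Xn n w * V w) @[n --> \oo] --> Ex (fun w => X w * V w).
apply: (Y_total (L := L)) LV.
- by move=> f [].
- move=> a f g [Lf cf] [Lg cg]; split; first exact: (L2D (L2Z a Lf) Lg).
  have E (W : T -> R) : L2 W -> Ex (fun w => W w * (a * f w + g w)) =
      a * Ex (fun w => W w * f w) + Ex (fun w => W w * g w).
    move=> LW; rewrite -ExZ; last exact: L2_IntM.
    rewrite -ExD; [|apply: IntZ; exact: L2_IntM|exact: L2_IntM].
    by apply: eq_Ex => w; ring.
  rewrite (E _ LX).
  have : a * Ex (fun w => Xn n w * f w) + Ex (fun w => Xn n w * g w) @[n --> \oo] -->
     a * Ex (fun w => X w * f w) + Ex (fun w => X w * g w) by apply: cvgD => //; exact: cvgMr.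
  by apply: cvg_eq_pos => n n0; exact: E (LXn n0).
- move=> f_ f g Lf mf Lg fg fcv.
  have [If cf2] : Int (fun w => f w ^+ 2) /\
      Ex (fun w => f_ k w ^+ 2) @[k --> \oo] --> Ex (fun w => f w ^+ 2).
    apply: (DCT (g := fun w => g w ^+ 2)).
    + by move=> k; apply: mea_sqr; exact: (Lf k).1.1.
    + exact: mea_sqr.
    + exact: Lg.2.
    + by move=> k w; rewrite normrX -[g w ^+ 2]ger0_norm ?sqr_ge0// normrX lerXn2r ?nnegrE.
    + by apply: filterS fcv => w; exact: cvg_sqr.
  have L2f : L2 f by [].
  split=> //; apply: weakly_cvg_approx => // e e0.
  have := cvg_L2_of_ae (fun k => (Lf k).1) L2f fcv (fun k => lexx _) cf2 (lexx _).
  move=> /(cvg_nrm0 (D := fun k w => f_ k w - f w)) /cvgrPdist_le/(_ _ e0) [N _ /(_ N (leqnn N))] /=.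
  rewrite sub0r normrN => h; exists (f_ N); split; [exact: (Lf N).1| |exact: (Lf N).2].
  have -> : nrm (fun w => f w - f_ N w) = nrm (fun w => f_ N w - f w).
    by congr Num.sqrt; apply: eq_Ex => w; rewrite -sqrrN opprB.
  exact: le_trans (ler_norm _) h.
- move=> g; split; first exact: LY.
  have : Ex (fun w => Xn n w * Yn g n w) - (Ex (fun w => Xn n w * Yn g n w) -
      Ex (fun w => Xn n w * Y g w)) @[n --> \oo] --> Ex (fun w => X w * Y g w) - 0.
    by apply: cvgB; [exact: tc|exact: cvg_tests_diff].
  by rewrite subr0; apply: cvg_eq_pos => n _; rewrite subKr.
Qed.

Lemma strongly_cvg_tests : strongly_cvg <-> tests_cvg /\ norms_cvg.
Proof.
split=> [/strongly_cvgE [wk nc]|[tc nc]]; first by split; [exact: weakly_cvg_tests|].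
by apply/strongly_cvgE; split=> //; apply: tests_cvg_weakly => //; exact: norms_cvg_bounded.
Qed.

Lemma weakly_cvg_testsE : weakly_cvg <-> tests_cvg /\ L2_bounded.
Proof.
split=> [wk|[tc b]]; first by split; [exact: weakly_cvg_tests|exact: weakly_cvg_bounded].
exact: tests_cvg_weakly.
Qed.

(** Conversely, uniform integrability turns convergence in distribution into
    convergence of the means of the continuous functions x y and x^2, which are
    the pairings with the test sequences and the second moments. *)
Lemma strongly_cvg_distribution : strongly_cvg <->
  (forall g, cvg_in_distribution P (fun n w => (Xn n w, Yn g n w)) (fun w => (X w, Y g w))) /\
  uniformly_integrable P [set n : nat | (0 < n)%N] (fun n w => Xn n w ^+ 2).
Proof.
split=> [sc|[cd ui]].
  split=> [g|]; first exact: (cvg_in_distribution_L2 LXn (LYn g) LX (LY g) sc (cY g)).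
  by apply/uniformly_integrableP => //; exact: small_tails_L2 sc.
have tX : small_tails P Xn by apply/uniformly_integrableP.
have key h g := @cvg_Ex_small_tails _ _ _ P _ _ _ _ h LXn (LYn g) LX (LY g) tX (small_tails_L2 (LYn g) (LY g) (cY g)) (cd g).
apply/strongly_cvg_tests; split=> [g|].
  have c : continuous (fun v : R * R => v.1 * v.2).
    by move=> v; apply: cvgM; [exact: cvg_fst|exact: cvg_snd].
  apply: (key _ g c) => -[x y] /=; have [xy|yx] := leP `|x| `|y|.
    by rewrite le_max normrM -[y ^+ 2]ger0_norm ?sqr_ge0// normrX expr2 ler_wpM2r ?orbT.
  by rewrite le_max normrM -[x ^+ 2]ger0_norm ?sqr_ge0// normrX expr2 ler_wpM2l// ltW.
have c : continuous (fun v : R * R => v.1 ^+ 2).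
  have -> : (fun v : R * R => v.1 ^+ 2) = (fun v => v.1 * v.1) by apply/funext => v; rewrite expr2.
  by move=> v; apply: cvgM; exact: cvg_fst.
by apply: (key _ g0 c) => v; rewrite ger0_norm ?sqr_ge0// le_max lexx.
Qed.

End TestSequences.

(** * The equivalences for Wick exponentials *)

Section WickExponentials.
Context {R : realType} {d : measure_display} {T : measurableType d}.
Variable P : probability T R.
Local Notation Int := (Int P).
Local Notation Ex := (Ex P).
Local Notation L2 := (L2 P).

Lemma ae_eq_L2 f g : mea f -> mea g -> {ae P, forall w, f w = g w} -> L2 f -> L2 g.
Proof.
move=> mf mg fg [_ If]; split=> //; apply: (ae_eq_Int _ _ _ If); [exact: mea_sqr|exact: mea_sqr|].
by apply: filterS fg => w ->.
Qed.

(** A step function is indexed by a positive number of intervals; the index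
    size s carries the default pair (0, 0), which contributes nothing and covers
    the empty list. *)
Lemma span_indic_step (s : seq (R * R)) : step_functions (span_indic s).
Proof.
exists (size s).+1; split=> //.
exists (fun i => (nth (0, 0) s i).1), (fun _ => 0), (fun i => (nth (0, 0) s i).2).
apply/funext => x; rewrite /span_indic big_ord_recr/= nth_default//= mul0r addr0.
by rewrite (big_nth (0, 0)) big_mkord.
Qed.

Variables (B : R -> T -> R) (xi0 : T -> R) (xi : nat -> nat -> T -> R).
Hypothesis mB : forall t, mea (B t).
Hypothesis F_generated : (measurable : set (set T)) =
  null_completion P (sigma_of [set t : R | 0 <= t] B).
Hypothesis xi0_L2 : L2 xi0.
Hypothesis xi0_mean : Ex xi0 = 0.
Hypothesis xi0_sqr : Ex (fun w => xi0 w ^+ 2) = 1.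
Hypothesis mxi : forall n i, mea (xi n i).
Hypothesis xi_indep : forall n : nat, (0 < n)%N ->
  mutually_independent P [set i : nat | (0 < i)%N] (xi n).
Hypothesis xi_law : forall n i : nat, (0 < n)%N -> (0 < i)%N -> same_law P (xi n i) xi0.
Hypothesis walk_cvg : forall t : R, 0 <= t ->
  cvg_in_probability P (fun n => scaled_walk n (xi n) t) (B t).

Let span_sqr s : nonneg_times s -> L2 (span_integral B s) /\
  Ex (fun w => span_integral B s w ^+ 2) <= 4 * (expR (2^-1 * norm2 s) - 1).
Proof. exact: (Ex_span_integral_sqr mB xi0_L2 xi0_mean xi0_sqr mxi xi_indep xi_law walk_cvg). Qed.

Let dwick n g := discrete_wick_exp n (xi n) (grid g n).

Lemma wick_exp_L2 (g : R -> R) : step_functions g -> L2 (wick_exp P B g).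
Proof.
move=> gstep; have [s [s0 gs]] := step_function_span gstep.
have [mW aeW] := wick_exp_limit span_sqr gstep s0 gs.
have LW := wick_limit_L2 mB xi0_L2 xi0_mean xi0_sqr mxi xi_indep xi_law walk_cvg s0.
by apply: (ae_eq_L2 LW.1 mW _ LW); apply: filterS aeW => w ->.
Qed.

Let dwickE (g : R -> R) s n : nonneg_times s -> (forall x, 0 < x -> g x = span_indic s x) ->
  (0 < n)%N -> dwick n g = wick_prod xi s n.
Proof.
move=> s0 gs n0; apply/funext => w; exact: discrete_wick_exp_prod.
Qed.

Lemma discrete_wick_exp_L2 (g : R -> R) n : step_functions g -> (0 < n)%N -> L2 (dwick n g).
Proof.
move=> gstep n0; have [s [s0 gs]] := step_function_span gstep.
rewrite (dwickE s0 gs n0).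
exact: (@wick_prod_L2 _ _ _ P xi0 xi xi0_L2 xi0_mean xi0_sqr mxi xi_indep xi_law s n n0).1.
Qed.

Lemma discrete_wick_exp_cvg (g : R -> R) : step_functions g ->
  Ex (fun w => (dwick n g w - wick_exp P B g w) ^+ 2) @[n --> \oo] --> 0.
Proof.
move=> gstep; have [s [s0 gs]] := step_function_span gstep.
have [mW aeW] := wick_exp_limit span_sqr gstep s0 gs.
have LW := wick_limit_L2 mB xi0_L2 xi0_mean xi0_sqr mxi xi_indep xi_law walk_cvg s0.
have := wick_prod_cvg_L2 mB xi0_L2 xi0_mean xi0_sqr mxi xi_indep xi_law walk_cvg s0.
apply: cvg_eq_pos => n n0; have Ln := discrete_wick_exp_L2 gstep n0.
rewrite -(dwickE s0 gs n0); apply: ae_eq_Ex.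
- by apply: mea_sqr; apply: meaB => //; exact: Ln.1.
- by apply: mea_sqr; apply: meaB => //; [exact: Ln.1|exact: LW.1].
by apply: filterS aeW => w ->.
Qed.

(** Up to null sets e^(span_integral B s) is a constant multiple of the Wick
    exponential of span_indic s, so exponentials_total applies. *)
Lemma wick_exp_total (L : set (T -> R)) : (forall f, L f -> L2 f) ->
  (forall a f g, L f -> L g -> L (fun w => a * f w + g w)) ->
  (forall (f_ : nat -> T -> R) f g, (forall k, L (f_ k)) -> mea f -> L2 g ->
     (forall k w, `|f_ k w| <= `|g w|) ->
     {ae P, forall w, f_ k w @[k --> \oo] --> f w} -> L f) ->
  (forall g, step_functions g -> L (wick_exp P B g)) -> forall V, L2 V -> L V.
Proof.
move=> L_L2 L_lin L_dom L_wick V LV.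
apply: (exponentials_total mB F_generated L_L2 L_lin L_dom) LV => s s0.
have gstep := span_indic_step s; set g := span_indic s in gstep.
have gs x : 0 < x -> g x = span_indic s x by [].
have [mW aeW] := wick_exp_limit span_sqr gstep s0 gs.
have LW := L_wick g gstep.
pose c := expR (2^-1 * norm2 s).
have LcW := L_lin (c - 1) _ _ LW LW.
have me : mea (fun w => expR (span_integral B s w)).
  by apply: mea_comp; [exact: measurable_expR|exact: (span_sqr s0).1.1].
apply: (L_dom (fun=> _) _ _ (fun=> LcW) me (L_L2 _ LcW)) => [//|].
apply: filterS aeW => w wE.
have -> : (c - 1) * wick_exp P B g w + wick_exp P B g w = expR (span_integral B s w).
  by rewrite wE /wick_limit /c expRB mulrBl mul1r subrK mulrC divfK// gt_eqF// expR_gt0.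
exact: cvg_cst.
Qed.

End WickExponentials.

Section ExtendedExpectations.
Context {R : realType} {d : measure_display} {T : measurableType d}.
Variable P : probability T R.
Local Notation Ex := (Ex P).
Local Notation L2 := (L2 P).

Lemma cvg_expectation (f_ : nat -> T -> R) (f : T -> R) :
  (forall n, (0 < n)%N -> Int P (f_ n)) -> Int P f ->
  (('E_P[f_ n])%E @[n --> \oo] --> ('E_P[f])%E) <-> Ex (f_ n) @[n --> \oo] --> Ex f.
Proof.
move=> If_ If; rewrite (expectation_Ex If); split.
  by move=> /fine_cvg; apply: cvg_eq_pos => n n0 /=; rewrite expectation_Ex//; exact: If_.
move=> h; have : (Ex (f_ n))%:E @[n --> \oo] --> (Ex f)%:E.
  by apply: cvg_EFin; [exact: nearW|exact: h].
by apply: cvg_eq_pos => n n0; rewrite expectation_Ex//; exact: If_.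
Qed.

Lemma L2_boundedE (Xn : nat -> T -> R) : (forall n, (0 < n)%N -> L2 (Xn n)) ->
  L2_bounded P Xn <->
  (ereal_sup [set 'E_P[fun w => (Xn n w ^+ 2)%R] | n in [set n : nat | (0 < n)%N]] < +oo)%E.
Proof.
move=> LX; set S := ereal_sup _.
have E n : (0 < n)%N -> ('E_P[fun w => (Xn n w ^+ 2)%R] = (Ex (fun w => Xn n w ^+ 2))%:E)%E.
  by move=> n0; rewrite expectation_Ex//; exact: (LX n n0).2.
split=> [[C HC]|h].
  apply: le_lt_trans (ltry C); apply: ge_ereal_sup => _ [n n0 <-].
  by rewrite E// lee_fin HC.
have le n : (0 < n)%N -> ((Ex (fun w => Xn n w ^+ 2))%:E <= S)%E.
  by move=> n0; rewrite -E//; apply: ereal_sup_ubound; exists n.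
have Sfin : S \is a fin_num.
  rewrite ge0_fin_numE//; apply: le_trans (le 1%N isT).
  by rewrite lee_fin Ex_ge0// => w; exact: sqr_ge0.
by exists (fine S) => n n0; rewrite -lee_fin (fineK Sfin); exact: le.
Qed.

End ExtendedExpectations.

Theorem theorem1 (R : realType) (d : measure_display) (T : measurableType d)
  (P : probability T R)
  (B : R -> {RV P >-> R})
  (B_brownian : brownian_motion P (fun t => B t))
  (F_generated : (measurable : set (set T)) =
     null_completion P (sigma_of [set t : R | 0 <= t] (fun t => B t)))
  (xi0 : {RV P >-> R})
  (xi0_L2 : (xi0 : T -> R) \in Lfun P 2%:E)
  (xi0_mean : ('E_P[xi0] = 0)%E)
  (xi0_var : ('V_P[xi0] = 1)%E)
  (xi : nat -> nat -> {RV P >-> R})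
  (xi_indep : forall n : nat, (0 < n)%N ->
     mutually_independent P [set i : nat | (0 < i)%N] (fun i => xi n i))
  (xi_law : forall n i : nat, (0 < n)%N -> (0 < i)%N ->
     same_law P (xi n i) xi0)
  (walk_cvg : forall t : R, 0 <= t ->
     cvg_in_probability P (fun n => scaled_walk n (fun i => xi n i) t) (B t))
  (X : T -> R) (X_L2 : X \in Lfun P 2%:E)
  (Xn : nat -> T -> R)
  (Xn_L2 : forall n : nat, (0 < n)%N -> Xn n \in Lfun P 2%:E)
  (Xn_meas : forall n : nat, (0 < n)%N ->
     measurable_wrt (sigma_of [set i : nat | (0 < i)%N] (fun i => xi n i))
                    (Xn n)) :
  let S_cvg := forall g : R -> R, step_functions g ->
    discrete_S_transform P n (fun i => xi n i) (Xn n) (grid g n)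
      @[n --> \oo] --> S_transform P (fun t => B t) X g in
  [/\ cvg_L2_strong P Xn X <->
        S_cvg /\
        ('E_P[fun w => (Xn n w ^+ 2)%R])%E @[n --> \oo]
          --> ('E_P[fun w => (X w ^+ 2)%R])%E,
      cvg_L2_weak P Xn X <->
        S_cvg /\
        (ereal_sup [set 'E_P[fun w => (Xn n w ^+ 2)%R]
                   | n in [set n : nat | (0 < n)%N]] < +oo)%E
    & cvg_L2_strong P Xn X <->
        (forall g : R -> R, step_functions g ->
           cvg_in_distribution P
             (fun n w => (Xn n w,
                discrete_wick_exp n (fun i => xi n i) (grid g n) w))
             (fun w => (X w, wick_exp P (fun t => B t) g w))) /\
        uniformly_integrable P [set n : nat | (0 < n)%N]
          (fun n w => Xn n w ^+ 2)].
Proof.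
have xi0_sqr : Ex P (fun w => xi0 w ^+ 2) = 1.
  move: xi0_var; rewrite (varianceE xi0_L2) xi0_mean expe2 mule0 sube0.
  rewrite (@expectation_Ex _ _ _ P (fun w => xi0 w ^+ 2)); first by move=> [->].
  by have /L2P[] := xi0_L2.
have {}xi0_L2 : L2 P xi0 by apply/L2P.
have {}xi0_mean : Ex P xi0 = 0.
  by move: xi0_mean; rewrite expectation_Ex; [move=> [->]|exact: L2_Int].
have mB t : mea (B t) by exact: measurable_funPT.
have mxi n i : mea (xi n i) by exact: measurable_funPT.
have {}X_L2 : L2 P X by apply/L2P.
have {}Xn_L2 n : (0 < n)%N -> L2 P (Xn n) by move=> n0; apply/L2P; exact: Xn_L2.
pose I := {g : R -> R | step_functions g}.
have gp (g : I) : step_functions (sval g) := svalP g.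
have sg0 := @span_indic_step R [::].
pose Y (g : I) := wick_exp P (fun t => B t) (sval g).
pose Yn (g : I) n := discrete_wick_exp n (fun i => xi n i) (grid (sval g) n).
have LY g : L2 P (Y g).
  exact: (wick_exp_L2 mB xi0_L2 xi0_mean xi0_sqr mxi xi_indep xi_law walk_cvg (gp g)).
have LYn g n : (0 < n)%N -> L2 P (Yn g n).
  exact: (@discrete_wick_exp_L2 _ _ _ P _ _ xi0_L2 xi0_mean xi0_sqr mxi xi_indep xi_law (sval g) n (gp g)).
have cY g : Ex P (fun w => (Yn g n w - Y g w) ^+ 2) @[n --> \oo] --> 0.
  exact: (discrete_wick_exp_cvg mB xi0_L2 xi0_mean xi0_sqr mxi xi_indep xi_law walk_cvg (gp g)).
have tot (L : set (T -> R)) : _ -> _ -> _ -> (forall g, L (Y g)) -> forall V, L2 P V -> L V :=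
  fun h1 h2 h3 h4 => @wick_exp_total _ _ _ P _ _ _ mB F_generated xi0_L2 xi0_mean xi0_sqr mxi
    xi_indep xi_law walk_cvg L h1 h2 h3 (fun g sg => h4 (exist _ g sg)).
move=> S_cvg.
have SE : S_cvg <-> tests_cvg P X Xn Y Yn.
  have E (g : I) : (discrete_S_transform P n (fun i => xi n i) (Xn n) (grid (sval g) n)
      @[n --> \oo] --> S_transform P (fun t => B t) X (sval g)) <->
      Ex P (fun w => Xn n w * Yn g n w) @[n --> \oo] --> Ex P (fun w => X w * Y g w).
    apply: (@cvg_expectation _ _ _ P (fun n w => Xn n w * Yn g n w)).
      by move=> n n0; exact: (L2_IntM (Xn_L2 n n0) (LYn g n n0)).
    exact: (L2_IntM X_L2 (LY g)).
  by split=> [h g|h g sg]; [apply/E; exact: h (gp g)|exact: (E (exist _ g sg)).2 (h _)].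
have strongE : cvg_L2_strong P Xn X <-> strongly_cvg P X Xn by exact: cvg_L2_strongE.
have weakE : cvg_L2_weak P Xn X <-> weakly_cvg P X Xn.
  have E V : L2 P V -> (('E_P[Xn n \* V])%E @[n --> \oo] --> ('E_P[X \* V])%E) <->
      Ex P (fun w => Xn n w * V w) @[n --> \oo] --> Ex P (fun w => X w * V w).
    move=> LV; apply: (@cvg_expectation _ _ _ P (fun n w => Xn n w * V w)).
      by move=> n n0; exact: (L2_IntM (Xn_L2 n n0) LV).
    exact: (L2_IntM X_L2 LV).
  by split=> h V LV; [apply/(E _ LV)/h/L2P|have LV' := (L2P P V).1 LV; apply/(E _ LV')/h].
have normE : ('E_P[fun w => (Xn n w ^+ 2)%R])%E @[n --> \oo] --> ('E_P[fun w => (X w ^+ 2)%R])%E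
    <-> norms_cvg P X Xn.
  apply: (@cvg_expectation _ _ _ P (fun n w => Xn n w ^+ 2)); last exact: X_L2.2.
  by move=> n n0; exact: (Xn_L2 n n0).2.
split.
- rewrite SE normE strongE.
  exact: (strongly_cvg_tests X_L2 Xn_L2 LY LYn cY tot).
- rewrite SE weakE -(L2_boundedE Xn_L2).
  exact: (weakly_cvg_testsE X_L2 Xn_L2 LY LYn cY tot).
rewrite strongE (strongly_cvg_distribution X_L2 Xn_L2 (exist _ _ sg0) LY LYn cY tot).
by split=> -[h ui]; split=> // g; [move=> sg; exact: (h (exist _ g sg))|exact: h (gp g)].
Qed.
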